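(* Let $A$ be a recursively enumerable set of integers. Then there is a finitely presentable group $G$ which is $A$-torsion-free and contains an embedded copy of every countably generated recursively presentable $A$-torsion-free group.
   Context: A countably generated recursive presentation $\langle X \mid R\rangle$ is a group presentation where $X$ is a recursively enumerated set of generators and $R$ is a recursive enumeration of relators. A group is countably generated recursively presentable if it is isomorphic to the group presented by such a presentation. For a group $G$ and set of integers $A$, $G$ is $A$-torsion-free if there is no $g \neq e$ in $G$ with $g^{n} = e$ for some $n \in A$. *)

(* Defs.v *)
From Stdlib Require Import List ZArith Arith.
Import ListNotations.

Inductive prf : Type :=
| PZero : prf
| PSucc : prf
| PProj : nat -> prf
| PComp : prf -> list prf -> prf
| PRec  : prf -> prf -> prf.

Fixpoint prf_eval (c : prf) (args : list nat) {struct c} : nat :=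
  match c with
  | PZero => 0
  | PSucc => S (hd 0 args)
  | PProj i => nth i args 0
  | PComp f gs => prf_eval f (map (fun g => prf_eval g args) gs)
  | PRec f g =>
      let rest := tl args in
      (fix r (n : nat) : nat :=
         match n with
         | 0 => prf_eval f rest
         | S k => prf_eval g (k :: r k :: rest)
         end) (hd 0 args)
  end.

(* A set of naturals is recursively enumerable iff it is the projection of a
   primitive recursive relation (Kleene normal form). *)
Definition re_nat (S : nat -> Prop) : Prop :=
  exists c : prf, forall x, S x <-> exists m, prf_eval c [x; m] = 0.

Definition code_Z (z : Z) : nat :=
  match z with
  | Z0 => 0
  | Zpos p => 2 * Pos.to_nat p
  | Zneg p => 2 * Pos.to_nat p - 1
  end.

Definition re_Z (A : Z -> Prop) : Prop :=
  exists c : prf, forall z, A z <-> exists m, prf_eval c [code_Z z; m] = 0.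

(* A letter is (generator index, inverted?) ; a word is a list of letters. *)
Definition letter := (nat * bool)%type.
Definition word := list letter.

Definition pair_nat (a b : nat) : nat := (a + b) * (a + b + 1) / 2 + b.

Fixpoint code_word (w : word) : nat :=
  match w with
  | [] => 0
  | (g, b) :: w' => S (pair_nat (2 * g + (if b then 1 else 0)) (code_word w'))
  end.

Definition re_word (R : word -> Prop) : Prop :=
  exists c : prf, forall w, R w <-> exists m, prf_eval c [code_word w; m] = 0.

Definition word_over (X : nat -> Prop) (w : word) : Prop :=
  forall l, In l w -> X (fst l).

Definition linv (l : letter) : letter := (fst l, negb (snd l)).
Definition winv (w : word) : word := rev (map linv w).

Inductive wequiv (R : word -> Prop) : word -> word -> Prop :=
| weq_refl : forall u, wequiv R u u
| weq_sym : forall u v, wequiv R u v -> wequiv R v u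
| weq_trans : forall u v w, wequiv R u v -> wequiv R v w -> wequiv R u w
| weq_cancel : forall u v l, wequiv R (u ++ l :: linv l :: v) (u ++ v)
| weq_rel : forall u v r, R r -> wequiv R (u ++ r ++ v) (u ++ v).

Fixpoint wpow_nat (w : word) (n : nat) : word :=
  match n with 0 => [] | S k => w ++ wpow_nat w k end.

Definition wpow (w : word) (z : Z) : word :=
  if (0 <=? z)%Z then wpow_nat w (Z.to_nat z) else wpow_nat (winv w) (Z.to_nat (- z)).

Definition torsion_free (A : Z -> Prop) (X : nat -> Prop) (R : word -> Prop) : Prop :=
  forall w, word_over X w -> ~ wequiv R w [] ->
    forall n, A n -> ~ wequiv R (wpow w n) [].

(* f (acting on representatives) induces an injective homomorphism
   <X | R> -> <Y | S>. *)
Definition embedding (X : nat -> Prop) (R : word -> Prop)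
                     (Y : nat -> Prop) (S : word -> Prop) (f : word -> word) : Prop :=
  (forall u, word_over X u -> word_over Y (f u)) /\
  (forall u v, word_over X u -> word_over X v -> wequiv R u v -> wequiv S (f u) (f v)) /\
  (forall u v, word_over X u -> word_over X v -> wequiv S (f (u ++ v)) (f u ++ f v)) /\
  (forall u v, word_over X u -> word_over X v -> wequiv S (f u) (f v) -> wequiv R u v).

(* Main.v *)
Require Import Defs.
From Stdlib Require Import List ZArith Arith Lia.
From Stdlib Require Import Classical ClassicalEpsilon FunctionalExtensionality PropExtensionality ProofIrrelevance.
From Corelib Require Import ssreflect.
Import ListNotations.
Set SsrOldRewriteGoalsOrder.
Local Open Scope general_if_scope.
Set Implicit Arguments.
Unset Strict Implicit.
Unset Printing Implicit Defensive.

(* Some finitely generated group [F / T] contains all the groups considered: [F] is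
   free of rank four and [T] consists of the words accepted by a Horn program
   whose clauses make [T] normal and closed under taking roots with exponent
   in [A], and kill the image of every relator of every presentation, the [g]-th
   generator of the presentation enumerated by [c] being sent to a commutator
   [[a, d^-1 b d]], with [d] a positive word coding [(c, g)]. No relation among the
   generators is lost, since [F] maps to an iterated wreath product over the
   presented group in which only the commutators of that presentation survive
   (as the given generators).

   It remains to embed [F / T] in a finitely presented [A]-torsion-free group, as in
   Higman's theorem. The Horn program is turned into a nondeterministic system of
   partial affine maps on integer vectors, which HNN extensions simulate, so that a
   finitely generated subgroup recognizes [T]; the rope trick then kills [T]. Only free
   groups, direct and semidirect products and HNN extensions are used, and these
   create no new torsion. *)

(** In general the [A]-torsion-free presentations cannot be enumerated, so all presentations share
    one quotient; one with torsion does no harm to the others, whose interpretations trivialize its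
    commutators. Commutators serve this end: in the wreath product [a] is supported at a single
    coordinate, and conjugation by [d] decides which value of [b] it meets there. Unique readability
    of [d] keeps these values apart.

    Two obstacles shape the finite presentation. Stable letters are invertible, so HNN extensions
    detect connection by rules used in both directions, not reachability; an integer oracle listing
    the rules to be applied removes the ambiguity. And the reachable set is first visible as a set
    of free generators [kx (acc, w)], not as the subgroup [T]. Hence the rope trick is used twice:
    to adjoin a letter [z] commuting with [T], then, as [z F z^-1] meets [F] in [T], to kill [T].

    Torsion stays under control because elements of finite order in an HNN extension are conjugate
    into the base. The case of [0] in [A], where only trivial groups qualify, is separated;
    otherwise only absolute values of exponents matter. *)

Record group := Group {
  car :> Type;
  mul : car -> car -> car;
  one : car;
  inv : car -> car;
  mulA : forall x y z, mul x (mul y z) = mul (mul x y) z;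
  mul1g : forall x, mul one x = x;
  mulVg : forall x, mul (inv x) x = one }.

Arguments mul {g}.
Arguments one {g}.
Arguments inv {g}.
#[global] Arguments mul : simpl never.
#[global] Arguments one : simpl never.
#[global] Arguments inv : simpl never.
Infix "**" := mul (at level 40, left associativity).

Section Basics.
Variable G : group.
Implicit Types x y z : G.

Lemma mulKVg x y : inv x ** (x ** y) = y.
Proof. by rewrite mulA mulVg mul1g. Qed.

Lemma mulgI x y z : x ** y = x ** z -> y = z.
Proof. by move=> E; rewrite -(mulKVg x y) E mulKVg. Qed.
Arguments mulgI : clear implicits.

Lemma mulg1 x : x ** one = x.
Proof. by apply: (mulgI (inv x)); rewrite mulA mulVg mul1g. Qed.

Lemma mulgV x : x ** inv x = one.
Proof. by apply: (mulgI (inv x)); rewrite mulKVg mulg1. Qed.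

Lemma mulKg x y : x ** (inv x ** y) = y.
Proof. by rewrite mulA mulgV mul1g. Qed.

Lemma inv_uniq x y : x ** y = one -> y = inv x.
Proof. by move=> E; apply: (mulgI x); rewrite E mulgV. Qed.

Lemma invgK x : inv (inv x) = x.
Proof. by symmetry; apply: inv_uniq; rewrite mulVg. Qed.

Lemma invMg x y : inv (x ** y) = inv y ** inv x.
Proof. by symmetry; apply: inv_uniq; rewrite -mulA mulKg mulgV. Qed.

Lemma inv1g : inv one = one :> G.
Proof. by symmetry; apply: inv_uniq; rewrite mul1g. Qed.

Lemma mulAr x y z : x ** y ** z = x ** (y ** z).
Proof. by rewrite mulA. Qed.

Lemma mulIg x y z : y ** x = z ** x -> y = z.
Proof. by move=> E; rewrite -(mulg1 y) -(mulgV x) mulA E mulAr mulgV mulg1. Qed.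

Lemma div_eq1 x y : inv x ** y = one -> x = y.
Proof. by move=> E; apply: (mulgI (inv x)); rewrite mulVg E. Qed.

Fixpoint pow x n : G := match n with 0 => one | S k => x ** pow x k end.

Lemma pow_comm x n : pow x n ** x = x ** pow x n.
Proof. by elim: n => [|n IH] /=; rewrite ?mul1g ?mulg1 // mulAr IH. Qed.

Lemma powV x n : pow (inv x) n = inv (pow x n).
Proof. by elim: n => [|n IH] /=; rewrite ?inv1g // invMg IH -IH pow_comm. Qed.

End Basics.

Arguments mulKVg {G}. Arguments mulg1 {G}. Arguments mulgV {G}. Arguments mulKg {G}.
Arguments invgK {G}. Arguments invMg {G}. Arguments mulAr {G}. Arguments pow {G}.
Arguments mulgI {G}. Arguments mulIg {G} x y z. Arguments mul1g {g}. Arguments mulVg {g}. Arguments mulA {g}.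

#[global] Hint Rewrite @mulAr @mul1g @mulg1 @mulVg @mulgV @mulKg @mulKVg @invMg @invgK @inv1g : grp.
Ltac grp := autorewrite with grp; try reflexivity.

Lemma pow_conj (G : group) (x y : G) n : pow (y ** x ** inv y) n = y ** pow x n ** inv y.
Proof. by elim: n => [|n IH] /=; [grp | rewrite IH; grp]. Qed.

(** * Homomorphisms, generated subgroups and torsion-freeness *)

Definition hom {G H : group} (f : G -> H) := forall x y, f (x ** y) = f x ** f y.

Lemma hom1 {G H : group} (f : G -> H) : hom f -> f one = one.
Proof. by move=> hf; apply: (mulgI (f one)); rewrite -hf mul1g mulg1. Qed.

Lemma homV {G H : group} (f : G -> H) x : hom f -> f (inv x) = inv (f x).
Proof. by move=> hf; apply: inv_uniq; rewrite -hf mulgV hom1. Qed.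

Lemma hom_pow {G H : group} (f : G -> H) x n : hom f -> f (pow x n) = pow (f x) n.
Proof. by move=> hf; elim: n => [|n IH] /=; rewrite ?hom1 // hf IH. Qed.

Lemma hom_comp {G H K : group} (f : G -> H) (g : H -> K) :
  hom f -> hom g -> hom (fun x => g (f x)).
Proof. by move=> hf hg x y; rewrite hf hg. Qed.

Lemma hom_inj {G H : group} (f : G -> H) :
  hom f -> (forall x, f x = one -> x = one) -> forall x y, f x = f y -> x = y.
Proof.
move=> hf h x y E; apply: div_eq1; apply: h.
by rewrite hf homV // E mulVg.
Qed.

Record subgroup {G : group} (A : G -> Prop) : Prop := Subgroup {
  sg1 : A one;
  sgM : forall x y, A x -> A y -> A (x ** y);
  sgV : forall x, A x -> A (inv x) }.

Inductive gen {G : group} (S : G -> Prop) : G -> Prop :=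
| gen_in x : S x -> gen S x
| gen1 : gen S one
| genM x y : gen S x -> gen S y -> gen S (x ** y)
| genV x : gen S x -> gen S (inv x).

Lemma gen_sg {G : group} (S : G -> Prop) : subgroup (gen S).
Proof. by split; [apply: gen1 | apply: genM | apply: genV]. Qed.

Lemma gen_sub {G : group} (S A : G -> Prop) :
  subgroup A -> (forall x, S x -> A x) -> forall x, gen S x -> A x.
Proof. by move=> [a1 aM aV] h x; elim=> *; auto. Qed.

Lemma gen_mono {G : group} (S S' : G -> Prop) :
  (forall x, S x -> S' x) -> forall x, gen S x -> gen S' x.
Proof. by move=> h; apply: gen_sub; [apply: gen_sg | move=> x /h; apply: gen_in]. Qed.

Lemma gen_img {G H : group} (f : G -> H) (S : G -> Prop) (A : H -> Prop) :
  hom f -> subgroup A -> (forall x, S x -> A (f x)) -> forall x, gen S x -> A (f x).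
Proof.
move=> hf [a1 aM aV] h x; elim=> {x} *; rewrite ?hom1 ?hf ?homV //; auto.
Qed.

Lemma gen_hom_eq {G H : group} (f g : G -> H) (S : G -> Prop) :
  hom f -> hom g -> (forall x, S x -> f x = g x) -> forall x, gen S x -> f x = g x.
Proof.
by move=> hf hg h x; elim=> {x} [x /h||x y _ E1 _ E2|x _ E]; rewrite ?hom1 ?hf ?hg ?homV //; congruence.
Qed.

Lemma sg_conj {G : group} (A : G -> Prop) x y : subgroup A -> A x -> A y -> A (inv x ** y).
Proof. by move=> [a1 aM aV] ? ?; auto. Qed.

Definition tf (N : nat -> Prop) (G : group) :=
  forall n, N n -> forall x : G, pow x n = one -> x = one.

(** * Evaluation of words in a group *)

Section Eval.
Variables (G : group) (e : nat -> G).

Definition evl (l : letter) : G := if snd l then inv (e (fst l)) else e (fst l).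

Fixpoint eval (w : word) : G :=
  match w with [] => one | l :: w' => evl l ** eval w' end.

Lemma eval_app u v : eval (u ++ v) = eval u ** eval v.
Proof. by elim: u => [|l u IH] /=; rewrite ?mul1g // IH mulA. Qed.

Lemma evl_linv l : evl (linv l) = inv (evl l).
Proof. by case: l => g []; rewrite /evl /= ?invgK. Qed.

Lemma eval_winv u : eval (winv u) = inv (eval u).
Proof.
elim: u => [|l u IH] /=; first by rewrite inv1g.
by rewrite /winv /= eval_app /= -/(winv u) IH evl_linv mulg1 invMg.
Qed.

Lemma eval_pow u n : eval (wpow_nat u n) = pow (eval u) n.
Proof. by elim: n => //= n IH; rewrite eval_app IH. Qed.

Lemma eval_wequiv (R : word -> Prop) u v :
  (forall r, R r -> eval r = one) -> wequiv R u v -> eval u = eval v.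
Proof.
move=> h; elim=> {u v} // [u v w _ -> _ ->|u v l|u v r /h E] //; rewrite !eval_app /=.
  by rewrite evl_linv mulKg.
by rewrite E mul1g.
Qed.

Lemma gen_eval n x : gen (fun y => exists2 i, i < n & y = e i) x ->
  exists2 w, word_over (fun i => i < n) w & eval w = x.
Proof.
elim=> {x} [x [i hi ->]||x y _ [u hu <-] _ [v hv <-]|x _ [u hu <-]].
- exists [(i, false)]; last by rewrite /= mulg1.
  by move=> l [<-|[]].
- by exists [].
- exists (u ++ v); last by rewrite eval_app.
  by move=> l hl; case: (in_app_or _ _ _ hl); [apply: hu | apply: hv].
- exists (winv u); last by rewrite eval_winv.
  by move=> l; rewrite /winv -in_rev => /(in_map_iff _ _ _) [l' [<- /hu]]; case: l'.
Qed.

Lemma eval_gen n w : word_over (fun i => i < n) w ->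
  gen (fun y => exists2 i, i < n & y = e i) (eval w).
Proof.
elim: w => [|[i b] w IH] h /=; first exact: gen1.
apply: genM; last by (apply: IH => l hl; apply: h; right).
have hi : i < n by apply: (h (i, b)); left.
have g : gen (fun y => exists2 i, i < n & y = e i) (e i) by apply: gen_in; exists i.
by rewrite /evl /=; case: b {h} => //; apply: genV.
Qed.

End Eval.
Arguments eval {G}.
Arguments evl {G}.

Lemma hom_eval {G H : group} (f : G -> H) (e : nat -> G) w :
  hom f -> f (eval e w) = eval (fun i => f (e i)) w.
Proof.
move=> hf; elim: w => [|[i b] w IH] /=; first by rewrite hom1.
by rewrite hf IH; case: b; rewrite /evl /= ?homV.
Qed.

Lemma eval_ext {G : group} (e e' : nat -> G) n w :
  (forall i, i < n -> e i = e' i) -> word_over (fun i => i < n) w -> eval e w = eval e' w.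
Proof.
move=> h; elim: w => [|[i b] w IH] hw //=.
rewrite IH; last by (move=> l hl; apply: hw; right).
by rewrite /evl /= h //; apply: (hw (i, b)); left.
Qed.

(** * Quotients by congruences, and presented groups *)

Section Quotient.
Variables (X : Type) (R : X -> X -> Prop) (m : X -> X -> X) (o : X) (v : X -> X).
Hypothesis Rrefl : forall x, R x x.
Hypothesis Rsym : forall x y, R x y -> R y x.
Hypothesis Rtrans : forall x y z, R x y -> R y z -> R x z.
Hypothesis mR : forall x x' y y', R x x' -> R y y' -> R (m x y) (m x' y').
Hypothesis vR : forall x x', R x x' -> R (v x) (v x').
Hypothesis mA : forall x y z, R (m x (m y z)) (m (m x y) z).
Hypothesis m1 : forall x, R (m o x) x.
Hypothesis mV : forall x, R (m (v x) x) o.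

Definition qcar := {C : X -> Prop | exists x, C = R x}.
Definition qcls (x : X) : qcar := exist _ (R x) (ex_intro _ x eq_refl).

Lemma qcls_eq x y : qcls x = qcls y <-> R x y.
Proof.
split=> [E|h].
  have -> : R x y = R y y by rewrite (f_equal (@proj1_sig _ _) E : R x = R y).
  exact: Rrefl.
apply: eq_sig_hprop => [P|/=]; first by intros; apply: proof_irrelevance.
apply: functional_extensionality => z; apply: propositional_extensionality.
by split; apply: Rtrans => //; apply: Rsym.
Qed.

Lemma qcls_surj (C : qcar) : exists x, C = qcls x.
Proof.
case: C => C [x E]; exists x; apply: eq_sig_hprop => //.
by intros; apply: proof_irrelevance.
Qed.

Definition qrep (C : qcar) : X := proj1_sig (constructive_indefinite_description _ (qcls_surj C)).

Lemma qrepK C : qcls (qrep C) = C.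
Proof. by rewrite /qrep; case: constructive_indefinite_description. Qed.

Lemma qrep_cls x : R (qrep (qcls x)) x.
Proof. by apply/qcls_eq; rewrite qrepK. Qed.

Program Definition qgroup : group :=
  @Group qcar (fun C D => qcls (m (qrep C) (qrep D))) (qcls o) (fun C => qcls (v (qrep C))) _ _ _.
Next Obligation.
apply/qcls_eq; apply: Rtrans (mR (Rrefl _) (qrep_cls _)) _.
apply: Rtrans (mA _ _ _) _; apply: mR; last exact: Rrefl.
by apply: Rsym; apply: qrep_cls.
Qed.
Next Obligation.
rewrite -{2}(qrepK x); apply/qcls_eq.
by apply: Rtrans (mR (qrep_cls _) (Rrefl _)) _.
Qed.
Next Obligation.
by apply/qcls_eq; apply: Rtrans (mR (qrep_cls _) (Rrefl _)) _.
Qed.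

Lemma qclsM x y : qcls (m x y) = (qcls x : qgroup) ** qcls y.
Proof. by apply/qcls_eq; apply: mR; apply: Rsym; apply: qrep_cls. Qed.

Lemma qclsV x : qcls (v x) = inv (qcls x : qgroup).
Proof. by apply/qcls_eq; apply: vR; apply: Rsym; apply: qrep_cls. Qed.

End Quotient.

Section Pres.
Variable R : word -> Prop.

Lemma wequiv_appl u v w : wequiv R u v -> wequiv R (w ++ u) (w ++ v).
Proof.
elim=> {u v} [u|u v _|u v x _ h _|u v l|u v r h]; try (by constructor).
- exact: weq_trans.
- by rewrite !app_assoc; constructor.
- by rewrite !(app_assoc w); constructor.
Qed.

Lemma wequiv_appr u v w : wequiv R u v -> wequiv R (u ++ w) (v ++ w).
Proof.
elim=> {u v} [u|u v _|u v x _ h _|u v l|u v r h]; try (by constructor).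
- exact: weq_trans.
- by rewrite -!app_assoc; constructor.
- by rewrite -!app_assoc; constructor.
Qed.

Lemma wequiv_app u u' v v' : wequiv R u u' -> wequiv R v v' -> wequiv R (u ++ v) (u' ++ v').
Proof. by move=> h h'; apply: weq_trans (wequiv_appr _ h) (wequiv_appl _ h'). Qed.

Lemma linvK l : linv (linv l) = l.
Proof. by case: l => g []. Qed.

Lemma winv_cons l u : winv (l :: u) = winv u ++ [linv l].
Proof. by []. Qed.

Lemma winv_app u v : winv (u ++ v) = winv v ++ winv u.
Proof. by rewrite /winv map_app rev_app_distr. Qed.

Lemma winvK u : winv (winv u) = u.
Proof. by elim: u => //= l u IH; rewrite winv_cons winv_app IH /= linvK. Qed.

Lemma wequiv_winvl u : wequiv R (winv u ++ u) [].
Proof.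
elim: u => [|l u IH]; first exact: weq_refl.
rewrite winv_cons -app_assoc /=; apply: weq_trans IH.
by have := weq_cancel R (winv u) u (linv l); rewrite linvK.
Qed.

Lemma wequiv_winvr u : wequiv R (u ++ winv u) [].
Proof. by have := wequiv_winvl (winv u); rewrite winvK. Qed.

Lemma wequiv_winv u v : wequiv R u v -> wequiv R (winv u) (winv v).
Proof.
move=> h.
have h1 := wequiv_appl (winv u) (wequiv_appr (winv v) h).
apply: weq_trans (weq_trans _ _ _ _ (weq_sym _ _ _ h1) _).
  have := wequiv_appl (winv u) (wequiv_winvr v).
  by rewrite app_nil_r => /(weq_sym _ _ _).
by rewrite app_assoc; have := wequiv_appr (winv v) (wequiv_winvl u).
Qed.

Definition pres : group :=
  @qgroup word (wequiv R) (@app letter) [] winv (@weq_refl R) (@weq_sym R) (@weq_trans R)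
    wequiv_app
    (fun x y z => eq_ind _ (fun t => wequiv R (x ++ y ++ z) t) (weq_refl R _) _ (app_assoc x y z))
    (fun x => weq_refl R x) wequiv_winvl.

Definition pcls (u : word) : pres :=
  qcls (wequiv R) u.

Lemma pcls_eq u v : pcls u = pcls v <-> wequiv R u v.
Proof. by apply: qcls_eq; [apply: weq_refl | apply: weq_sym | apply: weq_trans]. Qed.

Lemma pcls_surj (x : pres) : exists u, x = pcls u.
Proof. exact: qcls_surj. Qed.

Lemma pclsM u v : pcls (u ++ v) = pcls u ** pcls v.
Proof. by apply: (@qclsM word (wequiv R)). Qed.

Lemma pclsV u : pcls (winv u) = inv (pcls u).
Proof. by apply: qclsV; apply: wequiv_winv. Qed.

Lemma pcls1 : pcls [] = one.
Proof. by []. Qed.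

Lemma pcls_eval u : eval (fun i => pcls [(i, false)]) u = pcls u.
Proof.
elim: u => [|[i b] u IH] //=.
have -> : pcls ((i, b) :: u) = pcls [(i, b)] ** pcls u by rewrite -pclsM.
rewrite IH; f_equal; rewrite /evl /=; case: b => //. by rewrite -pclsV.
Qed.

Lemma pcls_pow u n : pcls (wpow_nat u n) = pow (pcls u) n.
Proof. by elim: n => //= n IH; rewrite pclsM IH. Qed.

End Pres.
Arguments pcls {R}.

(** * Finite presentations by universal property *)

Record fp (G : group) (n : nat) (e : nat -> G) (rels : list word) : Prop := FP {
  fp_over : forall r, In r rels -> word_over (fun i => i < n) r;
  fp_rel : forall r, In r rels -> eval e r = one;
  fp_gen : forall x, gen (fun y => exists2 i, i < n & y = e i) x;
  fp_univ : forall (K : group) (k : nat -> K), (forall r, In r rels -> eval k r = one) ->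
    exists2 f : G -> K, hom f & forall i, i < n -> f (e i) = k i }.

Definition is_fp (G : group) := exists n (e : nat -> G) rels, fp n e rels.

(** For the converse, the universal property is applied to the group of words modulo [rels], where
    the relators hold by construction: the resulting map turns an equality in [G] into one of word
    classes. *)
Lemma fp_wequiv (G : group) n (e : nat -> G) rels u v : fp n e rels ->
  word_over (fun i => i < n) u -> word_over (fun i => i < n) v ->
  (wequiv (fun r => In r rels) u v <-> eval e u = eval e v).
Proof.
move=> h hu hv; split; first by apply: eval_wequiv; apply: fp_rel h.
have [|f hf E] := fp_univ (K := pres (fun r => In r rels)) (k := fun i => pcls [(i, false)]) h.
  by move=> r hr; rewrite pcls_eval -pcls1; apply/pcls_eq; have := weq_rel (fun r => In r rels) [] [] r hr; rewrite app_nil_r.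
move=> /(f_equal f); rewrite !hom_eval //.
rewrite (eval_ext E hu) (eval_ext E hv).
by rewrite !pcls_eval => /pcls_eq.
Qed.

Lemma fp_word (G : group) n (e : nat -> G) rels (x : G) : fp n e rels ->
  exists2 w, word_over (fun i => i < n) w & eval e w = x.
Proof. by move=> h; apply: gen_eval; apply: fp_gen h x. Qed.

Definition genl {G : group} (l : list G) := gen (fun x => In x l).

Lemma sig_inj (T : Type) (P : T -> Prop) (x y : {t | P t}) : proj1_sig x = proj1_sig y -> x = y.
Proof. by move=> E; apply: eq_sig_hprop => // *; apply: proof_irrelevance. Qed.

(** * HNN extensions *)

(* The associated isomorphism of a stable letter is given by its graph. *)
Record pip {G H : group} (Phi : G -> H -> Prop) : Prop := Pip {
  pip1 : Phi one one;
  pipM : forall a b a' b', Phi a b -> Phi a' b' -> Phi (a ** a') (b ** b');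
  pipV : forall a b, Phi a b -> Phi (inv a) (inv b);
  pipl : forall b, Phi one b -> b = one;
  pipr : forall a, Phi a one -> a = one }.

Section PipTheory.
Variables (G H : group) (Phi : G -> H -> Prop).
Hypothesis hP : pip Phi.

Lemma pip_fun a b b' : Phi a b -> Phi a b' -> b = b'.
Proof.
move=> h h'; apply: div_eq1; apply: (pipl hP); rewrite -(mulVg a).
by apply: (pipM hP) => //; apply: (pipV hP).
Qed.

Lemma pip_flip : pip (fun b a => Phi a b).
Proof. by case: hP => ? ? ? ? ?; split=> *; auto. Qed.

End PipTheory.

Section HNN.
Variables (G : group) (I : Type) (Phi : I -> G -> G -> Prop).
Hypothesis hP : forall i, pip (Phi i).

Definition sl := (I * bool)%type.
Implicit Types j : sl.
Definition jinv j : sl := (fst j, negb (snd j)).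
(** Stands for [a t_j = t_j b]. A negative sign flips the graph, so both exponents of a stable
    letter are treated at once. *)
Definition Ph j a b := if snd j then Phi (fst j) a b else Phi (fst j) b a.

Lemma jinvK j : jinv (jinv j) = j. Proof. by case: j => i []. Qed.
Lemma jinv_neq j : j <> jinv j. Proof. by case: j => i []. Qed.
Lemma Ph_inv j a b : Ph (jinv j) a b <-> Ph j b a. Proof. by case: j => i []. Qed.
Lemma Ph_pip j : pip (Ph j).
Proof. by case: j => i []; [exact: (hP i) | exact: (pip_flip (hP i))]. Qed.

Definition dom j a := exists b, Ph j a b.
Definition phi j a : G := epsilon (inhabits one) (Ph j a).
Definition rep j g : G :=
  if excluded_middle_informative (dom j g) then one
  else epsilon (inhabits one) (fun h => dom j (inv h ** g)).

Lemma phiP j a : dom j a -> Ph j a (phi j a).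
Proof. exact: epsilon_spec. Qed.

Lemma phi_eq j a b : Ph j a b -> phi j a = b.
Proof. by move=> h; apply: (pip_fun (Ph_pip j) (phiP (ex_intro _ b h)) h). Qed.

Lemma dom_sg j : subgroup (dom j).
Proof.
split; first by (exists one; apply: (pip1 (Ph_pip j))).
- by move=> x y [a h] [b h']; exists (a ** b); apply: (pipM (Ph_pip j)).
- by move=> x [a h]; exists (inv a); apply: (pipV (Ph_pip j)).
Qed.

Lemma domMr j x y : dom j y -> (dom j (x ** y) <-> dom j x).
Proof.
case: (dom_sg j) => _ dM dV hy; split=> [h|h]; last exact: dM.
by have := dM _ _ h (dV _ hy); rewrite mulAr mulgV mulg1.
Qed.

Lemma dom_rep j g : dom j (inv (rep j g) ** g).
Proof.
rewrite /rep; case: excluded_middle_informative => h; first by rewrite inv1g mul1g.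
apply: (epsilon_spec (inhabits one) (fun x => dom j (inv x ** g))).
by exists g; rewrite mulVg; apply: (sg1 (dom_sg j)).
Qed.

(** The predicate handed to [epsilon] depends only on the coset, hence by extensionality so does the
    chosen value. *)
Lemma rep_coset j g a : dom j a -> rep j (g ** a) = rep j g.
Proof.
move=> ha; rewrite /rep.
have E h : dom j (h ** (g ** a)) <-> dom j (h ** g) by rewrite mulA; apply: domMr.
have E1 : dom j (g ** a) <-> dom j g := domMr _ ha.
do 2 case: excluded_middle_informative => //; try tauto.
move=> _ _; congr epsilon; apply: functional_extensionality => h.
by apply: propositional_extensionality; apply: E.
Qed.

Lemma rep_dom j g : dom j g -> rep j g = one.
Proof. by rewrite /rep; case: excluded_middle_informative. Qed.

Lemma rep1 j : rep j one = one.
Proof. by apply: rep_dom; apply: (sg1 (dom_sg j)). Qed.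

Lemma rep_rep j g : rep j (rep j g) = rep j g.
Proof. by rewrite -{2}(mulKg (rep j g) g) (rep_coset _ (dom_rep j g)). Qed.

Lemma rep_dom_iff j g : dom j (rep j g) -> dom j g.
Proof. by move=> h; have := sgM (dom_sg j) h (dom_rep j g); rewrite mulKg. Qed.

Lemma phi1 j : phi j one = one.
Proof. by apply: phi_eq; apply: (pip1 (Ph_pip j)). Qed.

Lemma dom_phi j a : dom j a -> dom (jinv j) (phi j a).
Proof. by move=> h; exists a; apply/Ph_inv/phiP. Qed.

Lemma phiK j a : dom j a -> phi (jinv j) (phi j a) = a.
Proof. by move=> h; apply: phi_eq; apply/Ph_inv/phiP. Qed.

Lemma phiM j a b : dom j a -> dom j b -> phi j (a ** b) = phi j a ** phi j b.
Proof. by move=> ha hb; apply: phi_eq; apply: (pipM (Ph_pip j)); apply: phiP. Qed.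

(* A state [((c_n, j_n) :: .. :: (c_1, j_1), g)] is the normal form
   [c_1 t_{j_1} .. c_n t_{j_n} g]; letters act by right multiplication. *)
Definition state := (list (G * sl) * G)%type.
Implicit Types s : state.

Definition push j (st : list (G * sl)) g : state :=
  ((rep j g, j) :: st, phi j (inv (rep j g) ** g)).

(** Right multiplication of a normal form by [t_j]. If it ends in [c t_j^-1 g] with [g] in the
    domain, this is a pinch and leaves [c (phi g)]; otherwise [g t_j = r t_j phi(r^-1 g)] with [r]
    the representative of [g]. *)
Definition step j s : state :=
  match fst s with
  | (c, j') :: st =>
      if excluded_middle_informative (dom j (snd s) /\ j' = jinv j)
      then (st, c ** phi j (snd s)) else push j (fst s) (snd s)
  | [] => push j [] (snd s)
  end.

Definition rmul (g : G) s : state := (fst s, snd s ** g).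

Definition okhd j (c : G) (st : list (G * sl)) :=
  dom j c -> match st with (_, j') :: _ => j' <> jinv j | [] => True end.

Fixpoint valid (st : list (G * sl)) : Prop :=
  match st with
  | [] => True
  | (c, j) :: st' => rep j c = c /\ okhd j c st' /\ valid st'
  end.

Lemma step_pop j c st g : dom j g -> step j ((c, jinv j) :: st, g) = (st, c ** phi j g).
Proof. by move=> h; rewrite /step /=; case: excluded_middle_informative => // -[]. Qed.

Lemma step_push j st g : okhd j g st -> step j (st, g) = push j st g.
Proof.
move=> h; rewrite /step /=; case: st h => [|[c j'] st] //= h.
by case: excluded_middle_informative => // -[/h].
Qed.

Lemma step_case j st g :
  (exists c st', dom j g /\ st = (c, jinv j) :: st') \/ okhd j g st.
Proof.
case: st => [|[c j'] st]; first by right.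
case: (classic (dom j g /\ j' = jinv j)) => [[h ->]|h]; first by (left; exists c, st).
by right=> h1 h2; apply: h.
Qed.

Lemma okhd_coset j g a st : dom j a -> okhd j g st -> okhd j (g ** a) st.
Proof. by move=> ha h /(domMr _ ha); apply: h. Qed.

Lemma okhd_rep j g st : okhd j g st -> okhd j (rep j g) st.
Proof. by move=> h /rep_dom_iff; apply: h. Qed.

Lemma step_valid j s : valid (fst s) -> valid (fst (step j s)).
Proof.
case: s => st g /=; case: (step_case j st g) => [[c [st' [h ->]]]|h].
  by rewrite step_pop //= => -[_ []].
by rewrite step_push //= => hv; split; [apply: rep_rep | split; [apply: okhd_rep|]].
Qed.

Lemma stepK j s : valid (fst s) -> step (jinv j) (step j s) = s.
Proof.
case: s => st g /=; case: (step_case j st g) => [[c [st' [h ->]]]|h].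
  rewrite step_pop //= => -[hc [ho hv]].
  rewrite step_push; last by (apply: okhd_coset => //; apply: dom_phi).
  by rewrite /push rep_coset ?hc ?mulKVg ?phiK //; apply: dom_phi.
move=> hv; rewrite step_push // /push.
have hd := dom_rep j g.
by have := step_pop (rep j g) st (dom_phi hd); rewrite jinvK => ->; rewrite phiK ?mulKg.
Qed.

Lemma step_rel j a b s : Ph j a b -> step j (rmul a s) = rmul b (step j s).
Proof.
case: s => st g h; have ha : dom j a by exists b.
rewrite /rmul /=; case: (step_case j st g) => [[c [st' [hg ->]]]|hg].
  rewrite !step_pop //; last by apply: (sgM (dom_sg j)).
  by rewrite phiM // (phi_eq h) mulA.
rewrite !step_push //; last exact: okhd_coset.
by rewrite /push rep_coset //= mulA phiM // ?(phi_eq h) //; apply: dom_rep.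
Qed.

Section Ev.
Variables (M : Type) (m : M -> M -> M) (o : M).
Hypothesis mA : forall x y z, m x (m y z) = m (m x y) z.
Hypothesis m1 : forall x, m x o = x.
Hypothesis om : forall x, m o x = x.
Variables (f : G -> M) (s : sl -> M).
Hypothesis f1 : f one = o.
Hypothesis fM : forall x y, f (x ** y) = m (f x) (f y).
Hypothesis sV : forall j, m (s j) (s (jinv j)) = o.
Hypothesis sP : forall j a b, Ph j a b -> m (f a) (s j) = m (s j) (f b).

(** The target is only a monoid because two instances are needed: self-maps of the set of normal
    forms, which yield the group law, and arbitrary groups, which yield the universal property. *)
Fixpoint evs (st : list (G * sl)) : M :=
  match st with [] => o | (c, j) :: st' => m (m (evs st') (f c)) (s j) end.
Definition ev (x : state) := m (evs (fst x)) (f (snd x)).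

Lemma ev_rmul g x : ev (rmul g x) = m (ev x) (f g).
Proof. by rewrite /ev /= fM mA. Qed.

Lemma ev_step j x : ev (step j x) = m (ev x) (s j).
Proof.
case: x => st g; case: (step_case j st g) => [[c [st' [h ->]]]|h].
  rewrite step_pop // /ev /= fM -!mA (sP (phiP h)) (mA (s (jinv j))).
  by have := sV (jinv j); rewrite jinvK => ->; rewrite om.
rewrite step_push // /ev /= -mA -(sP (phiP (dom_rep j g))) mA.
by congr m; rewrite -mA -fM mulKg.
Qed.

End Ev.

Definition vst := {x : state | valid (fst x)}.
Definition vmk x (h : valid (fst x)) : vst := exist _ x h.
Definition vstep j (x : vst) : vst := vmk (step_valid j (proj2_sig x)).
Definition vrmul g (x : vst) : vst := vmk (proj2_sig x : valid (fst (rmul g (proj1_sig x)))).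
Definition vone : vst := vmk (x := ([], one)) Logic.I.

Let cmp (F F' : vst -> vst) := fun x => F' (F x).

Lemma vrmul1 : vrmul one = id.
Proof. by apply: functional_extensionality => -[[st g] v]; apply: sig_inj; rewrite /= /rmul /= mulg1. Qed.

Lemma vrmulM x y : vrmul (x ** y) = cmp (vrmul x) (vrmul y).
Proof. by apply: functional_extensionality => -[[st g] v]; apply: sig_inj; rewrite /= /rmul /= mulA. Qed.

Lemma vstepK j : cmp (vstep j) (vstep (jinv j)) = id.
Proof. by apply: functional_extensionality => -[[st g] v]; apply: sig_inj; rewrite /= stepK. Qed.

Lemma vstep_rel j a b : Ph j a b -> cmp (vrmul a) (vstep j) = cmp (vstep j) (vrmul b).
Proof. by move=> h; apply: functional_extensionality => -[[st g] v]; apply: sig_inj; rewrite /= (step_rel _ h). Qed.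

(** [x] acts by right multiplication with its letters, one after the other, so [act x y] will be the
    product [y x]. *)
Definition act (x : vst) : vst -> vst := ev cmp id vrmul vstep (proj1_sig x).

Fixpoint acti (st : list (G * sl)) : vst -> vst :=
  match st with
  | [] => id
  | (c, j) :: st' => cmp (vstep (jinv j)) (cmp (vrmul (inv c)) (acti st'))
  end.

Section EvAct.
Variables (M : Type) (m : M -> M -> M) (o : M).
Hypothesis mA : forall x y z, m x (m y z) = m (m x y) z.
Hypothesis m1 : forall x, m x o = x.
Hypothesis om : forall x, m o x = x.
Variables (f : G -> M) (s : sl -> M).
Hypothesis f1 : f one = o.
Hypothesis fM : forall x y, f (x ** y) = m (f x) (f y).
Hypothesis sV : forall j, m (s j) (s (jinv j)) = o.
Hypothesis sP : forall j a b, Ph j a b -> m (f a) (s j) = m (s j) (f b).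

(** With self-maps of [vst] as monoid this is associativity of the product; with a group it is
    multiplicativity of the extended homomorphism. *)
Lemma ev_act (x y : vst) :
  ev m o f s (proj1_sig (act x y)) = m (ev m o f s (proj1_sig y)) (ev m o f s (proj1_sig x)).
Proof.
have H st z : ev m o f s (proj1_sig (evs cmp id vrmul vstep st z)) =
    m (ev m o f s (proj1_sig z)) (evs m o f s st).
  elim: st => [|[c j] st IH]; first by rewrite /= m1.
  rewrite [evs cmp _ _ _ _]/= {1 2}/cmp [proj1_sig _]/= ev_step ?ev_rmul //.
  by rewrite IH /= !mA.
case: x => -[st g] v; rewrite /act {2}/ev {1}/cmp [proj1_sig (vrmul _ _)]/=.
by rewrite ev_rmul // H mA.
Qed.
End EvAct.

Lemma cmpA F1 F2 F3 : cmp F1 (cmp F2 F3) = cmp (cmp F1 F2) F3. Proof. by []. Qed.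

Lemma act_one x : act x vone = x.
Proof.
case: x => -[st g] v; apply: sig_inj; rewrite /act /ev /= /cmp.
suff -> : proj1_sig (evs cmp id vrmul vstep st vone) = (st, one) by rewrite /rmul /= mul1g.
elim: st v => [|[c j] st IH] //= [hc [ho hv]].
rewrite /cmp /= IH // /rmul /= mul1g step_push // /push hc mulVg phi1 //.
Qed.

Lemma act_act x y z : act (act x y) z = act x (act y z).
Proof.
have E := @ev_act _ cmp id cmpA (fun _ => eq_refl) (fun _ => eq_refl) vrmul vstep vrmulM vstepK vstep_rel x y.
by rewrite /act E.
Qed.

Definition vinv (x : vst) : vst :=
  cmp (vrmul (inv (snd (proj1_sig x)))) (acti (fst (proj1_sig x))) vone.

Lemma act_vinv x : act x (vinv x) = vone.
Proof.
case: x => -[st g] v; rewrite /act /vinv /ev /=.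
set y := vone; rewrite /cmp.
have E z : evs (fun F F' : vst -> vst => fun x => F' (F x)) id vrmul vstep st (acti st z) = z.
  elim: st z {v} => [|[c j] st IH] z //=; rewrite /cmp IH.
  have -> : vrmul c (vrmul (inv c) (vstep (jinv j) z)) = vstep (jinv j) z.
    by have := vrmulM (inv c) c; rewrite mulVg vrmul1 => /(f_equal (fun F => F (vstep (jinv j) z))).
  by have := vstepK (jinv j); rewrite jinvK => /(f_equal (fun F => F z)).
by rewrite E; have := vrmulM (inv g) g; rewrite mulVg vrmul1 => /(f_equal (fun F => F y)).
Qed.

Definition hnn : group :=
  @Group vst (fun x y => act y x) vone vinv
    (fun x y z => act_act z y x) act_one act_vinv.

Definition hi (g : G) : hnn := vmk (x := ([], g)) Logic.I.
Definition ht j : hnn := vstep j vone.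

Lemma mul_hi (x : hnn) g : x ** hi g = vrmul g x.
Proof. by []. Qed.

Lemma mul_ht (x : hnn) j : x ** ht j = vstep j x.
Proof.
rewrite /mul /= /act (@ev_step _ cmp id) //; [|exact: vrmulM|exact: vstepK|exact: vstep_rel].
by rewrite /ev /= {1}/cmp vrmul1.
Qed.

Lemma hi_hom : hom hi.
Proof. by move=> x y; rewrite mul_hi; apply: sig_inj. Qed.

Lemma hi_inj x y : hi x = hi y -> x = y.
Proof. by move=> /(f_equal (fun z => snd (proj1_sig z))). Qed.

Lemma ht_inv j : ht (jinv j) = inv (ht j).
Proof.
apply: inv_uniq; rewrite mul_ht; exact: (f_equal (fun F => F vone) (vstepK j)).
Qed.

Lemma ht_rel j a b : Ph j a b -> hi a ** ht j = ht j ** hi b.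
Proof.
move=> h; rewrite mul_ht mul_hi -(mul1g (hi a)) mul_hi.
exact: (f_equal (fun F => F vone) (vstep_rel h)).
Qed.

(** Compare normal forms: the left side keeps the representative of [a] in front of [t_j], the right
    side has [one] there, so [a] lies in the trivial coset. *)
Lemma ht_dom j a b : hi a ** ht j = ht j ** hi b -> dom j a.
Proof.
rewrite mul_ht mul_hi => /(f_equal (fun x => fst (proj1_sig x))) /= [E].
by have := dom_rep j a; rewrite E rep1 inv1g mul1g.
Qed.

Lemma hnn_ind (P : hnn -> Prop) : P one ->
  (forall x g, P x -> P (x ** hi g)) -> (forall x j, P x -> P (x ** ht j)) -> forall x, P x.
Proof.
move=> h1 hg hj x; rewrite -(act_one x); case: x => -[st g] v.
rewrite /act /ev [fst _]/= [snd _]/= {1}/cmp.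
suff H y : P y -> P (evs cmp id vrmul vstep st y) by have := hg _ g (H _ h1); rewrite mul_hi.
elim: st y {v} => [|[c j] st IH] y hy //=.
by have := hj _ j (hg _ c (IH _ hy)); rewrite mul_ht.
Qed.

Lemma hnn_univ (K : group) (f : G -> K) (s : I -> K) : hom f ->
  (forall i a b, Phi i a b -> f a ** s i = s i ** f b) ->
  exists F : hnn -> K, hom F /\ (forall g, F (hi g) = f g) /\ (forall i, F (ht (i, true)) = s i).
Proof.
move=> hf hs; pose sj j := if snd j then s (fst j) else inv (s (fst j)).
have sV j : sj j ** sj (jinv j) = one by case: j => i []; rewrite /sj /=; grp.
have sP j a b : Ph j a b -> f a ** sj j = sj j ** f b.
  case: j => i []; rewrite /Ph /sj /= => /hs // E.
  by apply: (mulgI (s i)); rewrite mulKg mulA -E; grp.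
have mA := @mulA K; have m1 := @mulg1 K; have om := @mul1g K.
exists (fun x => ev mul one f sj (proj1_sig x)); split; last split.
- by move=> x y; rewrite (@ev_act K mul one mA m1 om f sj hf sV sP).
- by move=> g; rewrite /ev /= mul1g.
- by move=> i; rewrite (@ev_step K mul one) // /ev /= hom1 // !mul1g.
Qed.

(** * Relations on an HNN extension generated over the base *)

Section GraphLemma.
Variables (W : group) (Ga : G -> W -> Prop) (s : I -> W).
Hypothesis Ga1 : Ga one one.
Hypothesis GaM : forall a b a' b', Ga a b -> Ga a' b' -> Ga (a ** a') (b ** b').
Hypothesis GaV : forall a b, Ga a b -> Ga (inv a) (inv b).
Hypothesis Gal : forall i a b w, Phi i a b -> Ga a w -> Ga b (inv (s i) ** w ** s i).
Hypothesis Gar : forall i a b w, Phi i a b -> Ga b w -> Ga a (s i ** w ** inv (s i)).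

Let sj j := if snd j then s (fst j) else inv (s (fst j)).

Inductive grel : hnn -> W -> Prop :=
| gr1 : grel one one
| grG x w g v : grel x w -> Ga g v -> grel (x ** hi g) (w ** v)
| grT x w j : grel x w -> grel (x ** ht j) (w ** sj j).

Lemma sjV j : sj (jinv j) = inv (sj j).
Proof. by case: j => i []; rewrite /sj /= ?invgK. Qed.

Lemma Gaj j a b w : Ph j a b -> Ga a w -> Ga b (inv (sj j) ** w ** sj j).
Proof. by case: j => i []; rewrite /Ph /sj /= ?invgK => h /=; [apply: Gal h | apply: Gar h]. Qed.

Lemma grelM x w y v : grel x w -> grel y v -> grel (x ** y) (w ** v).
Proof.
move=> h; elim=> {y v} [|y u g v _ IH hg|y u j _ IH]; rewrite ?mulg1 // !mulA.
- exact: grG.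
- exact: grT.
Qed.

Lemma grel_hi g v : Ga g v -> grel (hi g) v.
Proof. by move=> h; have := grG gr1 h; rewrite !mul1g. Qed.

Lemma grel_ht j : grel (ht j) (sj j).
Proof. by have := grT j gr1; rewrite !mul1g. Qed.

Lemma grelV x w : grel x w -> grel (inv x) (inv w).
Proof.
elim=> {x w} [|x w g v _ IH hg|x w j _ IH]; first by rewrite !inv1g; apply: gr1.
- by rewrite !invMg; apply: grelM => //; rewrite -(homV _ hi_hom); apply/grel_hi/GaV.
- by rewrite !invMg -ht_inv -sjV; apply: grelM => //; apply: grel_ht.
Qed.

(** The coset representatives of a normal form need not be related to anything by [Ga]. They become
    so only after moving some [a] of the domain across the stable letter,
    [c t_j g = (c a) t_j (b^-1 g)], hence the quantifiers. *)
Fixpoint Inv (st : list (G * sl)) (g : G) (w : W) : Prop :=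
  match st with
  | [] => Ga g w
  | (c, j) :: st' => exists a b w1 w2, Ph j a b /\ Inv st' (c ** a) w1 /\
      Ga (inv b ** g) w2 /\ w = w1 ** sj j ** w2
  end.

Lemma Inv_mulr st g w h v : Inv st g w -> Ga h v -> Inv st (g ** h) (w ** v).
Proof.
case: st => [|[c j] st] /=; first exact: GaM.
move=> [a [b [w1 [w2 [h1 [h2 [h3 ->]]]]]]] hh; exists a, b, w1, (w2 ** v).
by rewrite !mulA; do !split=> //; apply: GaM.
Qed.

Lemma Inv_step j st g w : Inv st g w -> Inv (fst (step j (st, g))) (snd (step j (st, g))) (w ** sj j).
Proof.
case: (step_case j st g) => [[c [st' [hg ->]]]|h] hI.
  rewrite step_pop //=; move: hI => /= [a [b [w1 [w2 [h1 [h2 [h3 ->]]]]]]].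
  move/Ph_inv: h1 => h1.
  have h4 : Ph j (inv b ** g) (inv a ** phi j g).
    by apply: (pipM (Ph_pip j)); [apply: (pipV (Ph_pip j)) | apply: phiP].
  have := Inv_mulr h2 (Gaj h4 h3).
  by rewrite !mulAr mulKg sjV.
rewrite step_push //=; exists (inv (rep j g) ** g), (phi j (inv (rep j g) ** g)), w, one.
by rewrite mulKg mulVg mulg1; do !split=> //; apply/phiP/dom_rep.
Qed.

Lemma grel_Inv x w : grel x w -> Inv (fst (proj1_sig x)) (snd (proj1_sig x)) w.
Proof.
elim=> {x w} [|x w g v _ IH hg|x w j _ IH]; first exact: Ga1.
- by rewrite mul_hi /=; apply: Inv_mulr.
- by rewrite mul_ht /=; case: (proj1_sig x) IH => st g; apply: Inv_step.
Qed.

(** By [Gal] and [Gar], adjoining the pairs of stable letters to [Ga] adds nothing above the base.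
    For trivial [W] this computes the intersection of a subgroup with [G]; in general it shows that
    a map on a subgroup is well defined. *)
Lemma grel_hi_inv g v : grel (hi g) v -> Ga g v.
Proof. by move/grel_Inv. Qed.

End GraphLemma.

(** * Cyclically reduced elements and torsion in HNN extensions *)

Definition size (x : hnn) := length (fst (proj1_sig x)).
Let run st (z : vst) : vst := evs cmp id vrmul vstep st z.

Lemma act_run x z : act x z = vrmul (snd (proj1_sig x)) (run (fst (proj1_sig x)) z).
Proof. by []. Qed.

Definition okbot (st : list (G * sl)) (z : vst) :=
  forall st0 c j, st = st0 ++ [(c, j)] -> okhd j (snd (proj1_sig z) ** c) (fst (proj1_sig z)).

(** There is no pinch inside [st], and none at the junction by [okbot], so every letter is pushed.
    The second part carries the induction: after a push, the base element lies in the domain of the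
    inverse letter, so the next pinch test depends only on [st]. *)
Lemma run_len st (z : vst) : valid st -> okbot st z ->
  length (fst (proj1_sig (run st z))) = length st + length (fst (proj1_sig z)) /\
  match st with
  | [] => run st z = z
  | (c, j) :: _ => (exists c' st', fst (proj1_sig (run st z)) = (c', j) :: st') /\
                   dom (jinv j) (snd (proj1_sig (run st z)))
  end.
Proof.
elim: st => [|[c j] st IH] //= [hc [ho hv]] hb.
have hb' : okbot st z by move=> st0 c' j' E; apply: (hb ((c, j) :: st0)); rewrite E.
have [E1 E2] := IH hv hb'.
rewrite -/(run st z); move: (run st z) E1 E2 => z' E1 E2.
have hok : okhd j (snd (proj1_sig z') ** c) (fst (proj1_sig z')).
  case: st ho {hv IH} hb hb' E1 E2 => [|[c0 j0] st] ho hb hb' E1 E2.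
    by rewrite E2; apply: (hb []).
  case: E2 => -[c' [st' E2]] hd; rewrite E2 => hdj Ej.
  rewrite Ej jinvK in hd; apply: (ho _ Ej).
  by have := sg_conj (dom_sg j) hd hdj; rewrite mulKVg.
have -> : step j (rmul c (proj1_sig z')) = push j (fst (proj1_sig z')) (snd (proj1_sig z') ** c).
  by rewrite -step_push.
split; first by rewrite /= -E1.
split; first by (exists (rep j (snd (proj1_sig z') ** c)), (fst (proj1_sig z'))).
by apply: dom_phi; apply: dom_rep.
Qed.

Lemma run_app st st' z : run (st ++ st') z = run st (run st' z).
Proof. by elim: st => //= -[c j] st IH; rewrite /cmp -/run IH. Qed.

Lemma valid_app st st' : valid (st ++ st') -> valid st.
Proof.
elim: st => [|[c j] st IH] //= [hc [ho /IH hv]]; split=> //; split=> //.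
by move: ho; case: st {IH hv}.
Qed.

Lemma run_cons c j st z : run ((c, j) :: st) z = vstep j (vrmul c (run st z)).
Proof. by []. Qed.

(** The hypothesis forbids a pinch where two copies of [x] meet. The factor [b] in [dom (jinv j2)]
    shows that the junction of a power with one more copy of [x] is no worse than that of [x] with
    itself. *)
Lemma pow_len (x : hnn) c1 j1 c2 j2 st st0 n :
  fst (proj1_sig x) = (c2, j2) :: st -> fst (proj1_sig x) = st0 ++ [(c1, j1)] ->
  ~ (dom j1 (snd (proj1_sig x) ** c1) /\ j2 = jinv j1) ->
  size (pow x (S n)) = S n * size x /\
  exists b c st', proj1_sig (pow x (S n)) = ((c, j2) :: st', b ** snd (proj1_sig x)) /\ dom (jinv j2) b.
Proof.
move=> E E0 h; elim: n => [|n [IH1 [b [c [st' [IH2 hb]]]]]].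
  rewrite [pow _ _]/= mulg1 /size; split; first lia.
  exists one, c2, st; rewrite mul1g -E; split; last apply: (sg1 (dom_sg _)).
  by case: (proj1_sig x).
have [|E1 E2] := @run_len (fst (proj1_sig x)) (pow x (S n)) (proj2_sig x).
  move=> st1 c' j'; rewrite E0 => /(@app_inj_tail _ _ _ _ _) [_ [<- <-]]; rewrite IH2 /= => hd Ej.
  apply: h; split=> //; rewrite Ej jinvK in hb.
  by have := sg_conj (dom_sg j1) hb hd; rewrite !mulA mulVg mul1g.
have -> : pow x (S (S n)) = act x (pow x (S n)) by (symmetry; apply: (pow_comm x (S n))).
rewrite act_run; move: (run _ _) E1 E2 => z E1 E2.
split; first by rewrite {1}/size [fst _]/= E1 -/(size (pow x (S n))) IH1 -/(size x) /=; lia.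
move: E2; rewrite {1}E => -[[c' [st2 E2]] hd].
by exists (snd (proj1_sig z)), c', st2; rewrite -E2.
Qed.

(** Induction on the number of stable letters. If [x] is cyclically reduced, its powers grow in
    length; otherwise conjugation by its first syllable [c1 t_{j1}] makes the last letter cancel and
    removes two letters. *)
Lemma hnn_torsion n (x : hnn) : 0 < n -> pow x n = one -> exists y g, x = y ** hi g ** inv y.
Proof.
move=> hn; have [k hk] : exists k, size x <= k by exists (size x).
elim: k x hk => [|k IH] x hk E.
  exists one, (snd (proj1_sig x)); rewrite mul1g inv1g mulg1; apply: sig_inj => /=.
  by move: hk; rewrite /size; case: (proj1_sig x) => -[|y st] g //=; lia.
case Ex : (fst (proj1_sig x)) => [|[c2 j2] st].
  by apply: IH => //; rewrite /size Ex /=; lia.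
have [st0 [[c1 j1] E0]] : exists st0 y, fst (proj1_sig x) = st0 ++ [y].
  have [|st0 [y hy]] := @exists_last _ (fst (proj1_sig x)); first by rewrite Ex.
  by exists st0, y.
case: (classic (dom j1 (snd (proj1_sig x) ** c1) /\ j2 = jinv j1)) => [[hd Ej]|h]; last first.
  have [n' En] : exists n', n = S n' by exists (Nat.pred n); lia.
  have [h1 _] := pow_len n' Ex E0 h; rewrite -En E in h1.
  by move: h1; rewrite {2}/size Ex En.
have hx : proj1_sig x = ((c2, j2) :: st, snd (proj1_sig x)) by rewrite -Ex; case: (proj1_sig x).
(* A single stable letter would be its own inverse, so there are at least two. *)
case: st0 E0 => [|[c0 j0] st0] E0.
  by move: E0; rewrite Ex => -[_ Ej' _]; case: (jinv_neq (j := j1)); rewrite -Ej Ej'.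
move: (E0); rewrite Ex => -[_ _ E1]; rewrite E1 in hx Ex => {E0}.
have hv := proj2_sig x; rewrite {1}hx /= in hv.
pose y := hi c1 ** ht j1.
have [x' [Ex' hs]] : exists x', x ** y = y ** x' /\ size x' <= k.
  have Exy : proj1_sig (x ** y) = (st0 ++ [(c1, j1)], c2 ** phi j1 (snd (proj1_sig x) ** c1)).
    rewrite /y mulA mul_ht mul_hi /= hx /rmul /= Ej step_pop //.
  pose x' : hnn := vmk (x := (st0, c2 ** phi j1 (snd (proj1_sig x) ** c1)))
    (valid_app (proj2 (proj2 hv))).
  exists x'; split.
    rewrite -[x ** y]act_one /mul /= !act_run Exy run_app run_cons /=.
    by rewrite /y mul_ht -(mul1g (hi c1)) mul_hi.
  by move: hk; rewrite /size Ex /= length_app /=; lia.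
have Ex2 : x' = inv y ** x ** inv (inv y) by rewrite invgK mulAr Ex' mulKVg.
have [|z [g Ez]] := IH x' hs; first by rewrite Ex2 pow_conj E mulg1 mulgV.
exists (y ** z), g; apply: (mulIg y); rewrite Ex' Ez; grp.
Qed.

Lemma hnn_tf N : (forall n, N n -> 0 < n) -> tf N G -> tf N hnn.
Proof.
move=> N0 tG n Nn x E; have [y [g Ex]] := hnn_torsion (N0 _ Nn) E.
rewrite Ex pow_conj -(hom_pow _ _ hi_hom) in E.
have {}E : pow g n = one.
  apply: hi_inj; rewrite (hom1 hi_hom); apply: (mulgI y); apply: (mulIg (inv y)).
  by rewrite E mulg1 mulgV.
by rewrite Ex (tG n Nn g E) (hom1 hi_hom) mulg1 mulgV.
Qed.

End HNN.

(** * Direct products and finitely generated relations *)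

Definition prodg (G H : group) : group.
Proof.
refine (@Group (G * H) (fun x y => (fst x ** fst y, snd x ** snd y)) (one, one)
  (fun x => (inv (fst x), inv (snd x))) _ _ _).
- by move=> x y z; rewrite /= !mulA.
- by case=> x y; rewrite /= !mul1g.
- by case=> x y; rewrite /= !mulVg.
Defined.

Lemma prodM (G H : group) (a a' : G) (b b' : H) :
  ((a, b) : prodg G H) ** (a', b') = (a ** a', b ** b').
Proof. by []. Qed.

Lemma prodV (G H : group) (a : G) (b : H) : inv ((a, b) : prodg G H) = (inv a, inv b).
Proof. by []. Qed.

Lemma prod1 (G H : group) : (one : prodg G H) = (one, one).
Proof. by []. Qed.

Lemma hom_fst (G H : group) : hom (fun x : prodg G H => fst x).
Proof. by []. Qed.

Lemma hom_snd (G H : group) : hom (fun x : prodg G H => snd x).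
Proof. by []. Qed.

Lemma prod_tf N (G H : group) : tf N G -> tf N H -> tf N (prodg G H).
Proof.
move=> tG tH n Nn [x y] E.
have := f_equal fst E; rewrite (hom_pow _ _ (@hom_fst G H)) /= => /(tG n Nn) ->.
by have := f_equal snd E; rewrite (hom_pow _ _ (@hom_snd G H)) /= => /(tH n Nn) ->.
Qed.

Definition genr {G H : group} (l : list (G * H)) (a : G) (b : H) : Prop :=
  @gen (prodg G H) (fun p => In p l) (a, b).

Lemma genr_ind {G H : group} (l : list (G * H)) (P : G -> H -> Prop) :
  P one one -> (forall a b a' b', P a b -> P a' b' -> P (a ** a') (b ** b')) ->
  (forall a b, P a b -> P (inv a) (inv b)) -> (forall a b, In (a, b) l -> P a b) ->
  forall a b, genr l a b -> P a b.
Proof.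
move=> h1 hM hV hl a b h.
apply: (@gen_sub (prodg G H) (fun p => In p l) (fun p => P (fst p) (snd p)) _ _ (a, b) h).
  by split=> //= *; [apply: hM | apply: hV].
by case.
Qed.

Lemma genr_pip {G H : group} (l : list (G * H)) :
  (forall b, genr l one b -> b = one) -> (forall a, genr l a one -> a = one) -> pip (genr l).
Proof.
move=> hl hr; split=> //; first exact: gen1.
- by move=> a b a' b' h h'; apply: (genM h h').
- by move=> a b h; apply: (genV h).
Qed.

Lemma genr_in {G H : group} (l : list (G * H)) a b : In (a, b) l -> genr l a b.
Proof. exact: gen_in. Qed.

(** * Finite presentation of HNN extensions *)

Definition ord (r : nat) := {i | i < r}.

Lemma word_over_mono n m w : n <= m -> word_over (fun i => i < n) w -> word_over (fun i => i < m) w.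
Proof. by move=> h hw l /hw; lia. Qed.

Lemma word_over_app X u v : word_over X u -> word_over X v -> word_over X (u ++ v).
Proof. by move=> hu hv l hl; case: (in_app_or _ _ _ hl); [apply: hu | apply: hv]. Qed.

Lemma word_over_cons (X : nat -> Prop) l u : X (fst l) -> word_over X u -> word_over X (l :: u).
Proof. by move=> hl hu l' [<-|] //; apply: hu. Qed.

Lemma word_over_nil X : word_over X [].
Proof. by []. Qed.

Lemma word_over_winv X u : word_over X u -> word_over X (winv u).
Proof.
by move=> hu l; rewrite /winv -in_rev => /(in_map_iff _ _ _) [l' [<- /hu]]; case: l'.
Qed.

Definition wof {G : group} (n : nat) (e : nat -> G) (x : G) : word :=
  epsilon (inhabits []) (fun w => word_over (fun i => i < n) w /\ eval e w = x).

Lemma wofP (G : group) n (e : nat -> G) rels x : fp n e rels ->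
  word_over (fun i => i < n) (wof n e x) /\ eval e (wof n e x) = x.
Proof.
move=> h.
apply: (epsilon_spec (inhabits []) (fun w => word_over (fun i => i < n) w /\ eval e w = x)).
by have [w ? ?] := fp_word x h; exists w.
Qed.

Definition ordlist {T : Type} r (F : ord r -> list T) : list T :=
  flat_map (fun i => match lt_dec i r with left h => F (exist _ i h) | right _ => [] end) (seq 0 r).

Lemma in_ordlist (T : Type) r (F : ord r -> list T) x :
  In x (ordlist F) <-> exists i, In x (F i).
Proof.
rewrite /ordlist in_flat_map; split.
  by move=> [i [_]]; case: lt_dec => // h hx; exists (exist _ i h).
move=> [[i h] hx]; exists i; split; first by apply/in_seq; lia.
case: lt_dec => // h'.
by rewrite (proof_irrelevance _ h' h).
Qed.

Section HnnFp.
Variables (G : group) (n : nat) (e : nat -> G) (rels : list word).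
Hypothesis hG : fp n e rels.
Variables (r : nat) (Phi : ord r -> G -> G -> Prop).
Hypothesis hP : forall i, pip (Phi i).
Variable pr : ord r -> list (G * G).
Hypothesis hgen : forall i a b, Phi i a b -> genr (pr i) a b.
Hypothesis hin : forall i a b, In (a, b) (pr i) -> Phi i a b.

Let e' (x : nat) : hnn hP :=
  if lt_dec x n then hi hP (e x) else
  match lt_dec (x - n) r with left h => ht hP (exist _ (x - n) h, true) | right _ => one end.
Let rel (i : ord r) (p : G * G) : word :=
  winv (wof n e (snd p)) ++ (n + proj1_sig i, true) :: wof n e (fst p) ++ [(n + proj1_sig i, false)].
Let rels' := rels ++ ordlist (fun i => map (rel i) (pr i)).

Let e'l x : x < n -> e' x = hi hP (e x).
Proof. by rewrite /e'; case: lt_dec. Qed.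

Let e'r (i : ord r) : e' (n + proj1_sig i) = ht hP (i, true).
Proof.
rewrite /e'; case: lt_dec => [|_]; first by lia.
case: lt_dec => [h|]; last by (case: i => i h /=; lia).
by do 2 f_equal; apply: sig_inj => /=; lia.
Qed.

Let eval_hi w : word_over (fun i => i < n) w -> eval e' w = hi hP (eval e w).
Proof. by move=> hw; rewrite (hom_eval _ _ (hi_hom hP)); apply: eval_ext hw => i; apply: e'l. Qed.

(** Relators for generating pairs of each graph suffice, since the pairs satisfying
    [f a ** t = t ** f b] are closed under products and inverses. *)
Lemma hnn_fp : is_fp (hnn hP).
Proof.
exists (n + r), e', rels'; split.
- move=> w hw; case: (in_app_or _ _ _ hw) => {hw}.
    by move/(fp_over hG); apply: word_over_mono; lia.
  move/in_ordlist => [i /(in_map_iff _ _ _) [p [<- hp]]].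
  have h x : word_over (fun i => i < n + r) (wof n e x).
    by apply: (@word_over_mono n); [lia | apply: (proj1 (wofP x hG))].
  have hi : n + proj1_sig i < n + r by case: i {hp} => i h' /=; lia.
  apply: word_over_app; first by apply: word_over_winv.
  by apply: word_over_cons => //; apply: word_over_app => //; apply: word_over_cons.
- move=> w hw; case: (in_app_or _ _ _ hw) => {hw}.
    by move=> hw; rewrite eval_hi; [rewrite (fp_rel hG) ?(hom1 (hi_hom hP)) | apply: (fp_over hG hw)].
  move/in_ordlist => [i /(in_map_iff _ _ _) [[a b] [<- hp]]].
  have [ha Ea] := wofP a hG; have [hb Eb] := wofP b hG.
  rewrite /rel /= eval_app /= eval_app /= eval_winv !eval_hi // Ea Eb /evl /= e'r mulg1.
  have E : Ph Phi (i, true) a b by apply: hin.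
  by rewrite (ht_rel hP E); grp.
- apply: hnn_ind; first exact: gen1.
    move=> x g hx; apply: genM => //; have [w hw <-] := fp_word g hG.
    by rewrite -eval_hi //; apply: eval_gen; apply: word_over_mono hw; lia.
  move=> x [i b] hx; apply: genM => //.
  have h : gen (fun y => exists2 i0, i0 < n + r & y = e' i0) (ht hP (i, true)).
    by apply: gen_in; exists (n + proj1_sig i); [case: i => i h /=; lia | rewrite e'r].
  by case: b => //; have := ht_inv hP (i, true); rewrite /jinv /= => ->; apply: genV.
- move=> K k hk.
  have [f hf Ef] : exists2 f : G -> K, hom f & forall i, i < n -> f (e i) = k i.
    by apply: (fp_univ hG) => w hw; apply: hk; apply: in_or_app; left.
  have E w : word_over (fun i => i < n) w -> eval k w = f (eval e w).
    by move=> hw; rewrite (hom_eval _ _ hf); symmetry; apply: eval_ext hw.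
  have [|F [hF [E1 E2]]] := @hnn_univ _ _ _ hP K f (fun i => k (n + proj1_sig i)) hf.
  { move=> i a b /hgen; move: a b; apply: genr_ind.
    + by rewrite hom1 // mul1g mulg1.
    + by move=> a b a' b' h h'; rewrite !hf -mulA h' !mulA h.
    + move=> a b h; rewrite !(homV _ hf); apply: (mulgI (f a)); apply: (mulIg (f b)).
      by rewrite mulKg !mulA h; grp; rewrite -h; grp.
    + move=> a b hab.
      have := hk (rel i (a, b)); rewrite /rel /= !(eval_app, eval_winv) /= eval_app /=.
      have [ha Ea] := wofP a hG; have [hb Eb] := wofP b hG.
      rewrite !E // Ea Eb /evl /= mulg1 => h.
      have {}h : inv (f b) ** (inv (k (n + proj1_sig i)) ** (f a ** k (n + proj1_sig i))) = one.
        apply: h; apply: in_or_app; right; apply/in_ordlist; exists i.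
        by apply/in_map_iff; exists (a, b).
      by apply: (mulgI (inv (k (n + proj1_sig i)))); rewrite mulKVg; symmetry; apply: div_eq1. }
  exists F => // x hx; case: (lt_dec x n) => h; first by rewrite e'l // E1 Ef.
  have hx' : x - n < r by lia.
  have := E2 (exist (fun i => i < r) _ hx'); rewrite -e'r /=.
  by have -> : n + (x - n) = x by lia.
Qed.
End HnnFp.

(** * Free groups *)

Definition triv : group.
Proof. by refine (@Group unit (fun _ _ => tt) tt (fun _ => tt) _ _ _) => // -[]. Defined.

Lemma triv_pip (I : Type) (i : I) : @pip triv triv (fun _ _ => True).
Proof. by split=> // -[]. Qed.

(** The HNN extension of the trivial group with stable letters [I], so that torsion-freeness, finite
    presentation and the universal property are those of the general case. *)
Definition fr (I : Type) : group := hnn (@triv_pip I).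
Definition frx {I : Type} (i : I) : fr I := ht (@triv_pip I) (i, true).

Section Free.
Variable I : Type.

Lemma fr_ind (P : fr I -> Prop) : P one -> (forall x i, P x -> P (x ** frx i)) ->
  (forall x i, P x -> P (x ** inv (frx i))) -> forall x, P x.
Proof.
move=> h1 hM hV; apply: hnn_ind => //.
  move=> x []; suff -> : hi (@triv_pip I) tt = one by rewrite mulg1.
  exact: (hom1 (hi_hom _)).
move=> x [i []]; first exact: hM.
by have := ht_inv (@triv_pip I) (i, true); rewrite /jinv /= => ->; apply: hV.
Qed.

Lemma fr_gen (x : fr I) : gen (fun y => exists i, y = frx i) x.
Proof.
elim/fr_ind: x => [|x i h|x i h]; first exact: gen1.
- by apply: genM => //; apply: gen_in; exists i.
- by apply: genM => //; apply: genV; apply: gen_in; exists i.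
Qed.

Lemma fr_ex (K : group) (k : I -> K) : exists F : fr I -> K, hom F /\ forall i, F (frx i) = k i.
Proof.
have h1 : @hom triv K (fun _ => one) by move=> *; rewrite mulg1.
have [|F [hF [_ E]]] := @hnn_univ _ _ _ (@triv_pip I) K (fun _ => one) k h1.
  by move=> *; rewrite mulg1 mul1g.
by exists F.
Qed.

Definition frl {K : group} (k : I -> K) : fr I -> K :=
  proj1_sig (constructive_indefinite_description _ (fr_ex k)).

Lemma frl_hom {K : group} (k : I -> K) : hom (frl k).
Proof. by rewrite /frl; case: constructive_indefinite_description => F /= []. Qed.

Lemma frlx {K : group} (k : I -> K) i : frl k (frx i) = k i.
Proof. by rewrite /frl; case: constructive_indefinite_description => F /= []. Qed.

Lemma fr_ext {K : group} (f g : fr I -> K) : hom f -> hom g ->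
  (forall i, f (frx i) = g (frx i)) -> forall x, f x = g x.
Proof. by move=> hf hg E x; apply: gen_hom_eq (fr_gen x) => // y [i ->]. Qed.

Lemma fr_tf N : (forall n, N n -> 0 < n) -> tf N (fr I).
Proof. by move=> N0; apply: hnn_tf => // n Nn []. Qed.
End Free.

Definition fre r (i : nat) : fr (ord r) :=
  match lt_dec i r with left h => frx (exist _ i h : ord r) | right _ => one end.

Lemma freE r (i : ord r) : fre r (proj1_sig i) = frx i.
Proof.
case: i => i h /=; rewrite /fre; case: lt_dec => // h'.
by rewrite (proof_irrelevance _ h' h).
Qed.

Lemma fr_fp r : fp r (fre r) [].
Proof.
split=> //.
- move=> x; apply: gen_mono (fr_gen x) => y [i ->].
  by exists (proj1_sig i); [case: i | rewrite freE].
- move=> K k _; exists (frl (fun i : ord r => k (proj1_sig i))); first exact: frl_hom.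
  by move=> i h; rewrite /fre; case: lt_dec => // h'; rewrite frlx.
Qed.

(** * Semidirect products, for a right action by automorphisms *)

Record ract {Q N : group} (act : Q -> N -> N) : Prop := Ract {
  actM : forall b, hom (act b);
  act1 : forall n, act one n = n;
  actC : forall b b' n, act (b ** b') n = act b' (act b n) }.

Definition semi {Q N : group} (act : Q -> N -> N) (h : ract act) : group.
Proof.
refine (@Group (Q * N) (fun x y => (fst x ** fst y, act (fst y) (snd x) ** snd y)) (one, one)
  (fun x => (inv (fst x), act (inv (fst x)) (inv (snd x)))) _ _ _).
- by move=> x y z; rewrite /= !mulA (actM h) -(actC h).
- by case=> x y; rewrite /= mul1g hom1 ?mul1g //; apply: (actM h).
- by case=> x y; rewrite /= mulVg -(actC h) mulVg (act1 h) mulVg.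
Defined.

Section Semi.
Variables (Q N : group) (act : Q -> N -> N) (h : ract act).
Notation S := (semi h).

Lemma semiM b n b' n' : ((b, n) : S) ** (b', n') = (b ** b', act b' n ** n').
Proof. by []. Qed.

Lemma semi_fst : hom (fun x : S => fst x).
Proof. by []. Qed.

Definition sq (b : Q) : S := (b, one).
Definition sn (n : N) : S := (one, n).

Lemma sq_hom : hom sq.
Proof. by move=> x y; rewrite /sq semiM (hom1 (actM h y)) mulg1. Qed.

Lemma sn_hom : hom sn.
Proof. by move=> x y; rewrite /sn semiM (act1 h) mulg1. Qed.

Lemma semiE b n : ((b, n) : S) = sq b ** sn n.
Proof. by rewrite /sq /sn semiM (act1 h) mul1g mulg1. Qed.

Lemma sn_sq b n : sn n ** sq b = sq b ** sn (act b n).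
Proof. by rewrite /sq /sn !semiM (act1 h) !mul1g !mulg1. Qed.

Lemma semi_tf N0 : tf N0 Q -> tf N0 N -> tf N0 S.
Proof.
move=> tQ tN n Nn [b x] E.
have := f_equal fst E; rewrite (hom_pow _ _ semi_fst) /= => /(tQ n Nn) Eb.
rewrite Eb in E *; rewrite -/(sn x) -(hom_pow _ _ sn_hom) in E.
by have := f_equal snd E => /= /(tN n Nn) ->.
Qed.
End Semi.

Definition fung (X : Type) (P : group) : group.
Proof.
refine (@Group (X -> P) (fun f g x => f x ** g x) (fun _ => one) (fun f x => inv (f x)) _ _ _).
- by move=> f g k; apply: functional_extensionality => x; rewrite mulA.
- by move=> f; apply: functional_extensionality => x; rewrite mul1g.
- by move=> f; apply: functional_extensionality => x; rewrite mulVg.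
Defined.

Lemma fung_app (X : Type) (P : group) (x : X) : hom (fun f : fung X P => f x).
Proof. by []. Qed.

Lemma fung_tf N X P : tf N P -> tf N (fung X P).
Proof.
move=> tP n Nn f E; apply: functional_extensionality => x.
apply: (tP n Nn); have := f_equal (fun g => g x) E.
by rewrite (hom_pow _ _ (@fung_app X P x)).
Qed.

Lemma wr_act (C P : group) : @ract C (fung C P) (fun c f x => f (c ** x)).
Proof.
split=> // [f|b b' f]; apply: functional_extensionality => x; first by rewrite mul1g.
by rewrite mulA.
Qed.

(** The unrestricted wreath product: functions such as [ramp] and [dlam] below may have infinite
    support. *)
Definition wr (C P : group) : group := semi (wr_act C P).

Lemma wr_tf N C P : tf N C -> tf N P -> tf N (wr C P).
Proof. by move=> tC tP; apply: semi_tf => //; apply: fung_tf. Qed.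

(** * The free group on a group, extended by right translations *)

Lemma kg_act (Q : group) : @ract Q (fr Q) (fun b => frl (fun g : Q => frx (g ** b))).
Proof.
split=> [b|x|b b' x]; first exact: frl_hom.
- by apply: (fr_ext (g := id)) => // [|i]; [apply: frl_hom | rewrite frlx mulg1].
- move: x; apply: fr_ext; [exact: frl_hom | by apply: hom_comp; apply: frl_hom |].
  by move=> i; rewrite !frlx mulA.
Qed.

(** By [kg_univ] this is the free product of [Q] with the infinite cyclic group on [kx one], which
    gives a finite presentation; the semidirect form displays the conjugates [kx g] as a free
    basis. *)
Definition kg (Q : group) : group := semi (kg_act Q).
Definition kx {Q : group} (g : Q) : kg Q := sn (kg_act Q) (frx g).
Definition kq {Q : group} (b : Q) : kg Q := sq (kg_act Q) b.

Lemma kq_hom (Q : group) : hom (@kq Q).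
Proof. exact: sq_hom. Qed.

Lemma kx_kq (Q : group) (g b : Q) : inv (kq b) ** kx g ** kq b = kx (g ** b).
Proof. by rewrite mulAr /kx sn_sq mulKVg frlx. Qed.

Lemma kg_univ (Q K : group) (f : Q -> K) (t : K) : hom f ->
  exists F : kg Q -> K, hom F /\ (forall b, F (kq b) = f b) /\ F (kx one) = t.
Proof.
move=> hf; pose ka := frl (fun g : Q => inv (f g) ** t ** f g).
have hka : hom ka by apply: frl_hom.
have ha b n : ka (frl (fun g : Q => frx (g ** b)) n) = inv (f b) ** ka n ** f b.
  move: n; apply: fr_ext; first by apply: hom_comp; apply: frl_hom.
    by move=> x y; rewrite hka; grp.
  by move=> g; rewrite frlx /ka !frlx !hf; grp.
exists (fun x => f (fst x) ** ka (snd x)); split; last split.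
- by move=> [b n] [b' n']; rewrite semiM /= hf hka ha; grp.
- by move=> b; rewrite /= (hom1 hka) mulg1.
- by rewrite /= /ka frlx (hom1 hf); grp.
Qed.

Lemma kg_tf N (Q : group) : (forall n, N n -> 0 < n) -> tf N Q -> tf N (kg Q).
Proof. by move=> N0 tQ; apply: semi_tf => //; apply: fr_tf. Qed.

Lemma kg_fp (Q : group) : is_fp Q -> is_fp (kg Q).
Proof.
move=> [n [e [rels hQ]]].
pose e' i := if lt_dec i n then kq (e i) else kx one.
have e'l i : i < n -> e' i = kq (e i) by rewrite /e'; case: lt_dec.
have e'r : e' n = kx one by rewrite /e'; case: lt_dec => //; lia.
have E w : word_over (fun i => i < n) w -> eval e' w = kq (eval e w).
  by move=> hw; rewrite (hom_eval _ _ (@kq_hom Q)); apply: eval_ext hw.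
have hq b : gen (fun y => exists2 i, i < S n & y = e' i) (kq b).
  have [w hw <-] := fp_word b hQ; rewrite -E //.
  by apply: eval_gen; apply: word_over_mono hw; lia.
exists (S n), e', rels; split.
- by move=> w /(fp_over hQ); apply: word_over_mono; lia.
- move=> w hw; rewrite E; last exact: (fp_over hQ hw).
  by rewrite (fp_rel hQ hw) (hom1 (@kq_hom Q)).
- case=> b n0; rewrite semiE; apply: genM; first exact: hq.
  elim: (fr_gen n0) => {n0} [x [g ->]||x y _ h _ h'|x _ hx].
  + rewrite -/(kx g) -(mul1g g) -kx_kq; apply: genM; last exact: hq.
    apply: genM; first by apply: genV; apply: hq.
    by apply: gen_in; exists n => //; lia.
  + exact: gen1.
  + by rewrite sn_hom; apply: genM.
  + by rewrite (homV _ (sn_hom _)); apply: genV.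
- move=> K k hk; have [f hf Ef] := fp_univ hQ hk.
  have [F [hF [F1 F2]]] := kg_univ (k n) hf.
  exists F => // i hi; case: (lt_dec i n) => h; first by rewrite e'l // F1 Ef.
  by have -> : i = n; [lia | rewrite e'r].
Qed.

(** * The infinite cyclic group *)

Definition zg : group.
Proof.
by refine (@Group Z Z.add 0%Z Z.opp _ _ _) => *; lia.
Defined.

Section Zpow.
Variables (K : group) (k : K).

Definition zpow (z : Z) : K :=
  if (0 <=? z)%Z then pow k (Z.to_nat z) else inv (pow k (Z.to_nat (- z))).

Lemma zpow_succ z : zpow (z + 1) = k ** zpow z.
Proof.
rewrite /zpow; case: (Z.leb_spec 0 (z + 1)); case: (Z.leb_spec 0 z); try lia.
- by move=> h _; have -> : Z.to_nat (z + 1) = S (Z.to_nat z) by lia.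
- move=> h h'; have -> : z = (-1)%Z by lia.
  by rewrite /= mulg1 mulgV.
- move=> h h'; have -> : Z.to_nat (- z) = S (Z.to_nat (- (z + 1))) by lia.
  by rewrite /= -pow_comm invMg mulKg.
Qed.

Lemma zpow0 : zpow 0 = one. Proof. by []. Qed.
Lemma zpow1 : zpow 1 = k. Proof. by rewrite -[1%Z]/(0 + 1)%Z zpow_succ zpow0 mulg1. Qed.

Lemma zpow_pred z : zpow (z - 1) = inv k ** zpow z.
Proof. by apply: (mulgI k); rewrite mulKg -zpow_succ; f_equal; lia. Qed.

Lemma zpow_hom : @hom zg K zpow.
Proof.
move=> x y; change (zpow (x + y)%Z = zpow x ** zpow y); move: x; apply: Z.peano_ind.
- by rewrite mul1g.
- move=> x E. have -> : (Z.succ x + y = x + y + 1)%Z by lia.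
  by rewrite -Z.add_1_r !zpow_succ E mulA.
- move=> x E; have -> : (Z.pred x + y = x + y - 1)%Z by lia.
  by rewrite -Z.sub_1_r !zpow_pred E mulA.
Qed.

End Zpow.

Lemma zg_pow (z : zg) n : pow z n = (Z.of_nat n * z)%Z.
Proof.
elim: n => [|n IH] //; rewrite [LHS]/= IH.
change (z + Z.of_nat n * z = Z.of_nat (S n) * z)%Z; lia.
Qed.

Lemma zg_tf N : (forall n, N n -> 0 < n) -> tf N zg.
Proof.
move=> N0 n /N0 hn x; rewrite zg_pow => E.
change (Z.of_nat n * x = 0)%Z in E; change (x = 0%Z); nia.
Qed.

Lemma pow1_zg z : zpow (1%Z : zg) z = z.
Proof.
move: z; apply: Z.peano_ind => // z E.
  by rewrite -Z.add_1_r zpow_succ E; change (1 + z = z + 1)%Z; lia.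
by rewrite -Z.sub_1_r zpow_pred E; change (-1 + z = z - 1)%Z; lia.
Qed.

Lemma gen_pow (G : group) (S : G -> Prop) x n : gen S x -> gen S (pow x n).
Proof. by move=> h; elim: n => [|n IH] /=; [apply: gen1 | apply: genM]. Qed.

Lemma gen_zpow (G : group) (S : G -> Prop) x z : gen S x -> gen S (zpow x z).
Proof. by move=> h; rewrite /zpow; case: Z.leb; [|apply: genV]; apply: gen_pow. Qed.

Lemma zg_fp : is_fp zg.
Proof.
exists 1, (fun _ => 1%Z : zg), []; split=> //.
- move=> x; rewrite -(pow1_zg x); apply: gen_zpow; apply: gen_in; by exists 0.
- move=> K k _; exists (zpow (k 0)); first exact: zpow_hom.
  by move=> i hi; rewrite zpow1; f_equal; lia.
Qed.

Lemma cent_sg (G : group) (u : G) : subgroup (fun x => x ** u = u ** x).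
Proof.
split=> [|x y hx hy|x hx]; first by rewrite mul1g mulg1.
- by rewrite mulAr hy mulA hx mulAr.
- by apply: (mulgI x); apply: (mulIg x); rewrite !mulA mulgV mul1g mulAr -hx; grp.
Qed.

(** * Finite presentation of direct products *)

Section ProdFp.
Variables (G H : group) (n m : nat) (e : nat -> G) (e' : nat -> H) (rels rels' : list word).
Hypotheses (hG : fp n e rels) (hH : fp m e' rels').

Let shift (w : word) : word := map (fun l => (n + fst l, snd l)) w.
Let pe (i : nat) : prodg G H := if lt_dec i n then (e i, one) else (one, e' (i - n)).
Let com i j : word := [(i, false); (n + j, false); (i, true); (n + j, true)].
Let prels := rels ++ map shift rels' ++
  flat_map (fun i => map (com i) (seq 0 m)) (seq 0 n).

Let eval_shift (K : group) (k : nat -> K) w : eval k (shift w) = eval (fun i => k (n + i)) w.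
Proof. by elim: w => //= -[i b] w ->. Qed.

Let in_prels w : In w prels -> In w rels \/ (exists2 w', In w' rels' & w = shift w') \/
  exists i j, i < n /\ j < m /\ w = com i j.
Proof.
move=> hw; case: (in_app_or _ _ _ hw) => {}hw; first by left.
case: (in_app_or _ _ _ hw) => {}hw; right.
  by left; move/(in_map_iff _ _ _): hw => [w' [<- ?]]; exists w'.
right; move/in_flat_map: hw => [i [/in_seq hi /(in_map_iff _ _ _) [j [<- /in_seq hj]]]].
by exists i, j; do !split=> //; lia.
Qed.

Let hl : @hom G (prodg G H) (fun x => (x, one)).
Proof. by move=> x y; rewrite prodM mulg1. Qed.
Let hr : @hom H (prodg G H) (fun x => (one, x)).
Proof. by move=> x y; rewrite prodM mulg1. Qed.

Let pel i : i < n -> pe i = (e i, one).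
Proof. by rewrite /pe; case: lt_dec. Qed.
Let per j : pe (n + j) = (one, e' j).
Proof. by rewrite /pe; case: lt_dec => h; [lia | do 2 f_equal; lia]. Qed.

Let evall w : word_over (fun i => i < n) w -> eval pe w = (eval e w, one).
Proof. by move=> hw; rewrite (hom_eval _ _ hl); apply: eval_ext hw. Qed.
Let evalr w : eval pe (shift w) = (one, eval e' w).
Proof.
rewrite eval_shift (hom_eval _ _ hr); f_equal; apply: functional_extensionality => j; exact: per.
Qed.

Lemma prod_fp' : is_fp (prodg G H).
Proof.
exists (n + m), pe, prels; split.
- move=> w /in_prels [hw|[[w' hw ->]|[i [j [hi [hj ->]]]]]].
  + by apply: word_over_mono (fp_over hG hw); lia.
  + move=> l /(in_map_iff _ _ _) [l' [<- /(fp_over hH hw)]] /=; lia.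
  + by do !apply: word_over_cons => //=; lia.
- move=> w /in_prels [hw|[[w' hw ->]|[i [j [hi [hj ->]]]]]].
  + by rewrite evall ?(fp_rel hG) //; apply: (fp_over hG).
  + by rewrite evalr (fp_rel hH).
  + by rewrite /= /evl /= per pel // !prodM !prodV; grp; rewrite !mulgV; grp; rewrite !mulgV.
- case=> x y; have -> : ((x, y) : prodg G H) = ((x, one) : prodg G H) ** (one, y).
    by rewrite prodM mulg1 mul1g.
  apply: genM.
  + have [w hw <-] := fp_word x hG; rewrite -evall //.
    by apply: eval_gen; apply: word_over_mono hw; lia.
  + have [w hw <-] := fp_word y hH; rewrite -evalr; apply: eval_gen.
    by move=> l /(in_map_iff _ _ _) [l' [<- /hw]] /=; lia.
- move=> K k hk.
  have [|f hf Ef] := @fp_univ _ _ _ _ hG K k.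
    by move=> w hw; apply: hk; apply: in_or_app; left.
  have [|g hg Eg] := @fp_univ _ _ _ _ hH K (fun i => k (n + i)).
    move=> w hw; rewrite -eval_shift; apply: hk; apply: in_or_app; right.
    by apply: in_or_app; left; apply: in_map.
  have E x y : f x ** g y = g y ** f x.
    have Eij i j : i < n -> j < m -> f (e i) ** g (e' j) = g (e' j) ** f (e i).
      move=> hi hj; rewrite Ef // Eg //.
      have : eval k (com i j) = one.
        apply: hk; apply: in_or_app; right; apply: in_or_app; right.
        apply/in_flat_map; exists i; split; first by apply/in_seq; lia.
        by apply: in_map; apply/in_seq; lia.
      rewrite /com /= /evl /= mulg1 mulA => /(@inv_uniq K) /(f_equal inv).
      by rewrite invgK invMg !invgK => ->.
    have h1 j : j < m -> f x ** g (e' j) = g (e' j) ** f x.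
      move=> hj; apply: (gen_img hf (cent_sg (g (e' j))) _ (fp_gen hG x)).
      by move=> _ [i hi ->]; apply: Eij.
    symmetry; apply: (gen_img hg (cent_sg (f x)) _ (fp_gen hH y)).
    by move=> _ [j hj ->]; rewrite h1.
  exists (fun z => f (fst z) ** g (snd z)).
    move=> [x y] [x' y'] /=; rewrite hf hg !mulA; congr mul.
    by rewrite !mulAr; congr mul; rewrite E.
  move=> i hi; case: (lt_dec i n) => h; first by rewrite pel //= (hom1 hg) mulg1 Ef.
  have -> : i = n + (i - n) by lia.
  by rewrite per /= (hom1 hf) mul1g Eg; [|lia].
Qed.
End ProdFp.

Lemma prod_fp (G H : group) : is_fp G -> is_fp H -> is_fp (prodg G H).
Proof. by move=> [n [e [r h]]] [m [e' [r' h']]]; apply: (prod_fp' h h'). Qed.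

(** * Groups encoding partial affine bijections *)

Section HalfRule.
Variables (Q : group) (p q : Q) (be ga : Q -> Q).
Hypotheses (hbe : hom be) (hga : hom ga) (ker : forall d, be d = one -> ga d = one).

(** Killing the basis elements outside the coset [p be(Q)] gives a total endomorphism. The relation
    generated by a rule is thereby shown to be functional without describing the subgroups it
    relates. By [ker], the choice of [d] is immaterial. *)
Definition hrule : fr Q -> fr Q := frl (fun g =>
  match excluded_middle_informative (exists d, g = p ** be d) with
  | left H => frx (q ** ga (proj1_sig (constructive_indefinite_description _ H)))
  | right _ => one end).

Lemma hrule_hom : hom hrule.
Proof. exact: frl_hom. Qed.

Lemma hrule_in d : hrule (frx (p ** be d)) = frx (q ** ga d).
Proof.
rewrite /hrule frlx; case: excluded_middle_informative => [h|h]; last by case: h; exists d.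
case: constructive_indefinite_description => d' /= /(mulgI p) E; do 2 f_equal.
symmetry; apply: div_eq1; rewrite -homV // -hga; apply: ker.
by rewrite hbe homV // E mulVg.
Qed.

Lemma hrule_out g : ~ (exists d, g = p ** be d) -> hrule (frx g) = one.
Proof. by move=> h; rewrite /hrule frlx; case: excluded_middle_informative. Qed.

Lemma hrule_act d n : hrule (frl (fun g => frx (g ** be d)) n) = frl (fun g => frx (g ** ga d)) (hrule n).
Proof.
move: n; apply: fr_ext; try by (apply: hom_comp; apply: frl_hom).
move=> g; rewrite frlx; case: (classic (exists d, g = p ** be d)) => [[d' ->]|h].
  by rewrite -mulA -hbe !hrule_in frlx hga mulA.
rewrite !hrule_out // ?(hom1 (frl_hom _)) // => -[d' E]; apply: h; exists (d' ** inv d).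
by rewrite hbe homV // mulA -E mulAr mulgV mulg1.
Qed.

(** The conclusion passes to products because [hrule] intertwines translation by [be d] with
    translation by [ga d]. Used for a rule and its reverse, it makes the generated relation a
    partial isomorphism. *)
Lemma genr_hrule (l : list Q) k k' :
  genr ((kx p, kx q) :: map (fun d => (kq (be d), kq (ga d))) l) k k' ->
  (exists d, fst k = be d /\ fst k' = ga d) /\ snd k' = hrule (snd k).
Proof.
move: k k'; apply: genr_ind => /=.
- by split; [exists one; rewrite !hom1 | rewrite (hom1 hrule_hom)].
- move=> a b a' b' [[d [E1 E2]] E3] [[d' [E4 E5]] E6]; split.
    by exists (d ** d'); rewrite hbe hga E1 E2 E4 E5.
  by rewrite /= hrule_hom E4 E5 hrule_act E3 E6.
- move=> a b [[d [E1 E2]] E3]; split; first by exists (inv d); rewrite !homV // E1 E2.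
  by rewrite /= E1 E2 -!(homV _ hbe) -!(homV _ hga) hrule_act (homV _ hrule_hom) E3.
- move=> a b [[<- <-]|/(in_map_iff _ _ _) [d [[<- <-] _]]] /=.
    split; first by (exists one; rewrite !hom1).
    by have := hrule_in one; rewrite (hom1 hbe) (hom1 hga) !mulg1.
  by split; [exists d | rewrite (hom1 hrule_hom)].
Qed.

Lemma hrule_gen (P : Q -> Prop) n : (forall d, P (p ** be d) -> P (q ** ga d)) ->
  gen (fun y => exists2 g, P g & y = frx g) n -> gen (fun y => exists2 g, P g & y = frx g) (hrule n).
Proof.
move=> h; apply: gen_img; [exact: hrule_hom | exact: gen_sg|].
move=> _ [g hg ->]; case: (classic (exists d, g = p ** be d)) => [[d E]|h'].
  by rewrite E hrule_in; apply: gen_in; exists (q ** ga d) => //; apply: h; rewrite -E.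
by rewrite hrule_out //; apply: gen1.
Qed.
End HalfRule.

(** The partial bijection taking [p be(d)] to [q ga(d)]. Equality of the kernels makes it well
    defined and injective, while both homomorphisms may forget coordinates. *)
Record rule (Q : group) := Rule {
  rp : Q; rbe : Q -> Q; rga : Q -> Q; rq : Q;
  rbe_hom : hom rbe; rga_hom : hom rga;
  rker : forall d, rbe d = one <-> rga d = one }.

Section MachineGroup.
Variables (N : nat -> Prop) (Q : group) (r : nat) (R : ord r -> rule Q) (s : Q).
Hypothesis N0 : forall n, N n -> 0 < n.
Hypothesis tQ : tf N Q.
Hypothesis fQ : is_fp Q.

(** Rules act by conjugation with stable letters, which are invertible, so the group sees each rule
    in both directions. *)
Inductive conn : Q -> Prop :=
| conn_s : conn s
| conn_fw i d : conn (rp (R i) ** rbe (R i) d) -> conn (rq (R i) ** rga (R i) d)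
| conn_bw i d : conn (rq (R i) ** rga (R i) d) -> conn (rp (R i) ** rbe (R i) d).

Definition ksub (P : Q -> Prop) (k : kg Q) :=
  fst k = one /\ gen (fun y => exists2 g, P g & y = frx g) (snd k).

Lemma ksub_sg P : subgroup (ksub P).
Proof.
split; first by split=> //; apply: gen1.
- move=> [a x] [b y] [/= -> hx] [/= -> hy]; split; first by rewrite /= mul1g.
  by rewrite /= (act1 (kg_act Q)); apply: genM.
- move=> [a x] [/= -> hx]; split; first by rewrite /= inv1g.
  by rewrite /= inv1g (act1 (kg_act Q)); apply: genV.
Qed.

Variable Good : Q -> Prop.
Hypothesis good_fw : forall i d, Good (rp (R i) ** rbe (R i) d) -> Good (rq (R i) ** rga (R i) d).
Hypothesis good_bw : forall i d, Good (rq (R i) ** rga (R i) d) -> Good (rp (R i) ** rbe (R i) d).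
Hypothesis good_s : Good s.

(** One stable letter per rule takes [kx p] to [kx q] and [kq (be d)] to [kq (ga d)], hence
    [kx (p ** be d)] to [kx (q ** ga d)]. The list [L] consists of [kx s] and the stable letters. *)
Lemma machine_group : exists (H : group) (j : kg Q -> H) (L : list H),
  is_fp H /\ tf N H /\ hom j /\ (forall x, j x = one -> x = one) /\
  (forall k, genl L (j k) -> ksub Good k) /\ (forall g, conn g -> genl L (j (kx g))).
Proof.
have [n [e [rels hQ]]] := fQ.
pose l := map e (seq 0 n).
have hl d : gen (fun x => In x l) d.
  apply: gen_mono (fp_gen hQ d) => y [i hi ->]; apply: in_map; apply/in_seq; lia.
pose pr (i : ord r) : list (kg Q * kg Q) :=
  (kx (rp (R i)), kx (rq (R i))) :: map (fun d => (kq (rbe (R i) d), kq (rga (R i) d))) l.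
pose pr' (i : ord r) : list (kg Q * kg Q) :=
  (kx (rq (R i)), kx (rp (R i))) :: map (fun d => (kq (rga (R i) d), kq (rbe (R i) d))) l.
have flip i a b : genr (pr i) a b -> genr (pr' i) b a.
{ move: a b; apply: genr_ind; first exact: gen1.
  - by move=> a b a' b' h h'; apply: (genM h h').
  - by move=> a b h; apply: (genV h).
  - move=> a b hab; apply: genr_in; case: hab => [[<- <-]|/(in_map_iff _ _ _) [d [[<- <-] hd]]].
      by left.
    by right; apply/in_map_iff; exists d. }
have fw i a b := @genr_hrule Q (rp (R i)) (rq (R i)) _ _ (@rbe_hom _ (R i)) (@rga_hom _ (R i))
  (fun d => proj1 (rker (R i) d)) l a b.
have bw i a b := @genr_hrule Q (rq (R i)) (rp (R i)) _ _ (@rga_hom _ (R i)) (@rbe_hom _ (R i))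
  (fun d => proj2 (rker (R i) d)) l a b.
have key i a b : genr (pr i) a b -> a = one -> b = one.
  move=> /fw [[d [E1 E2]] E3] Ea; rewrite Ea /= in E1 E3.
  have E : rga (R i) d = one by apply/(rker (R i)).
  by case: b E2 E3 => x y /= -> ->; rewrite E (hom1 (@hrule_hom _ _ _ _ _)).
have key' i a b : genr (pr i) a b -> b = one -> a = one.
  move=> /flip /bw [[d [E1 E2]] E3] Eb; rewrite Eb /= in E1 E3.
  have E : rbe (R i) d = one by apply/(rker (R i)).
  by case: a E2 E3 => x y /= -> ->; rewrite E (hom1 (@hrule_hom _ _ _ _ _)).
have hP i : pip (genr (pr i)).
  by apply: genr_pip => x hx; [apply: key hx _ | apply: key' hx _].
pose H := hnn hP.
pose L : list H := hi hP (kx s) :: ordlist (fun i => [ht hP (i, true)]).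
have gl i a b : genr (pr i) a b -> ksub Good a -> ksub Good b.
  move=> /fw [[d [E1 E2]] E3] [h1 h2]; rewrite h1 in E1; split.
    by rewrite E2; apply/(rker (R i)).
  rewrite E3; apply: (hrule_gen (@rbe_hom _ (R i)) (@rga_hom _ (R i)) _ _ h2) => d'.
    by move/(rker (R i)).
  exact: good_fw.
have gr i a b : genr (pr i) a b -> ksub Good b -> ksub Good a.
  move=> /flip /bw [[d [E1 E2]] E3] [h1 h2]; rewrite h1 in E1; split.
    by rewrite E2; apply/(rker (R i)).
  rewrite E3; apply: (hrule_gen (@rga_hom _ (R i)) (@rbe_hom _ (R i)) _ _ h2) => d'.
    by move/(rker (R i)).
  exact: good_bw.
have sgG := ksub_sg Good.
exists H, (hi hP), L; split; last split; last split; last split; last split.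
- have [m [e' [rels' hK]]] := kg_fp fQ.
  by apply: (@hnn_fp _ _ _ _ hK _ _ hP pr) => // i a b; apply: genr_in.
- by apply: hnn_tf => //; apply: kg_tf.
- exact: hi_hom.
- by move=> x; rewrite -(hom1 (hi_hom hP)); apply: hi_inj.
- move=> k hk.
  (* The second group is trivial here: only membership in [ksub Good] is followed. *)
  have hgl := @grel_hi_inv _ _ _ hP triv (fun a _ => ksub Good a) (fun _ => tt).
  apply: (hgl (sg1 sgG) _ _ _ k tt) => //; [by move=> a _ a' _; apply: (sgM sgG) | by move=> i a b _; apply: gl
    | by move=> i a b _; apply: gr |].
  pose P (x : H) := @grel _ _ _ hP triv (fun a (_ : triv) => ksub Good a) (fun _ => tt) x tt.
  apply: (@gen_sub _ _ P _ _ _ hk); last first.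
    move=> x [<-|/in_ordlist [i [<-|[]]]].
      by apply: grel_hi; split=> //; apply: gen_in; exists s.
    exact: (grel_ht hP (fun a (_ : triv) => ksub Good a) (fun _ => tt) (i, true)).
  split; first exact: gr1.
    by move=> x y hx hy; apply: (grelM hx hy).
  by move=> x hx; apply: (grelV _ hx) => a _; apply: (sgV sgG).
- have hgt i : genl L (ht hP (i, true)) by apply: gen_in; right; apply/in_ordlist; exists i; left.
  have hc i d : hi hP (kx (rp (R i) ** rbe (R i) d)) ** ht hP (i, true) =
                ht hP (i, true) ** hi hP (kx (rq (R i) ** rga (R i) d)).
    apply: ht_rel; rewrite /Ph /= -!kx_kq.
    have hd : genr (pr i) (kq (rbe (R i) d)) (kq (rga (R i) d)).
    { elim: (hl d) => {d} [d h||d d' _ h _ h'|d _ h].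
      + by apply: genr_in; right; apply/in_map_iff; exists d.
      + by rewrite (hom1 (@rbe_hom _ (R i))) (hom1 (@rga_hom _ (R i))); apply: gen1.
      + by rewrite (@rbe_hom _ (R i)) (@rga_hom _ (R i)) !kq_hom; apply: (pipM (hP i)).
      + rewrite (homV _ (@rbe_hom _ (R i))) (homV _ (@rga_hom _ (R i))) !(homV _ (@kq_hom Q)).
        exact: (pipV (hP i)). }
    apply: (pipM (hP i)) => //; apply: (pipM (hP i)); first by apply: (pipV (hP i)).
    by apply: genr_in; left.
  move=> g; elim=> {g} [|i d _ h|i d _ h].
  + by apply: gen_in; left.
  + rewrite -(mulKVg (ht hP (i, true)) (hi hP _)) -hc.
    exact: (genM (genV (hgt i)) (genM h (hgt i))).
  + rewrite -(mulg1 (hi hP _)) -(mulgV (ht hP (i, true))) mulA hc.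
    exact: (genM (genM (hgt i) h) (genV (hgt i))).
Qed.
End MachineGroup.

(** * Nondeterministic reachability *)

Section Oracle.
Variables (N : nat -> Prop) (Q : group) (r : nat) (R : ord r -> rule Q) (s : Q).
Hypothesis N0 : forall n, N n -> 0 < n.
Hypothesis tQ : tf N Q.
Hypothesis fQ : is_fp Q.

Inductive reach : Q -> Prop :=
| reach_s : reach s
| reach_step i d : reach (rp (R i) ** rbe (R i) d) -> reach (rq (R i) ** rga (R i) d).

Definition obase : Z := Z.of_nat (r + 1).
(** The shift by one reserves the oracle [0] for the end of a run: an oracle with last digit [oid i]
    is never [0]. *)
Definition oid (i : ord r) : Z := Z.of_nat (proj1_sig i + 1).
Notation M := obase.
Notation QZ := (prodg zg Q).

Lemma oid_bound i : (0 < oid i < M)%Z.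
Proof. by rewrite /oid /M; case: i => k hk /=; lia. Qed.

Definition orb i (x : QZ) : QZ := ((M * fst x)%Z, rbe (R i) (snd x)).
Definition org i (x : QZ) : QZ := (fst x, rga (R i) (snd x)).
Definition osb (x : QZ) : QZ := (fst x, one).

Lemma orb_hom i : hom (orb i).
Proof.
move=> [x d] [y d']; rewrite /orb !prodM (@rbe_hom _ (R i)); congr (_, _).
change (M * (x + y) = M * x + M * y)%Z; lia.
Qed.

Lemma org_hom i : hom (org i).
Proof. by move=> [x d] [y d']; rewrite /org !prodM (@rga_hom _ (R i)). Qed.

Lemma o_ker i d : orb i d = one <-> org i d = one.
Proof.
have hM : (M > 0)%Z by rewrite /M; lia.
case: d => x d; rewrite /orb /org !prod1; split=> -[E /(rker (R i)) ->]; congr (_, _).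
  by change (x = 0%Z); change (M * x = 0)%Z in E; nia.
by change (x = 0%Z) in E; rewrite E; change (M * 0 = 0)%Z; lia.
Qed.

Lemma osb_hom : hom osb.
Proof. by move=> [x d] [y d']; rewrite /osb !prodM mulg1. Qed.

(* The first coordinate is an oracle in base [r + 1]: rule [i] consumes the
   digit [i + 1], which makes the extended system deterministic. *)
Definition orule i : rule QZ :=
  @Rule QZ (oid i, rp (R i)) (orb i) (org i) (0%Z, rq (R i)) (@orb_hom i) (@org_hom i) (o_ker i).

(** Counts the oracle up and down at the start, so that every sequence of choices is available. *)
Definition srule : rule QZ :=
  @Rule QZ (0%Z, s) osb osb (1%Z, s) osb_hom osb_hom (fun d => iff_refl _).

Definition orules (i : ord (S r)) : rule QZ :=
  match lt_dec (proj1_sig i) r with left h => orule (exist (fun k => k < r) _ h) | right _ => srule end.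

Inductive runs : Z -> Q -> Q -> Prop :=
| runs0 y : runs 0 y y
| runsS i d o y : runs o (rq (R i) ** rga (R i) d) y ->
    runs (M * o + oid i) (rp (R i) ** rbe (R i) d) y.

Lemma runs_inv o x y : runs o x y -> (o = 0%Z /\ x = y) \/
  exists i d o', o = (M * o' + oid i)%Z /\ x = rp (R i) ** rbe (R i) d /\
    runs o' (rq (R i) ** rga (R i) d) y.
Proof. by case=> [z|i d o' z h]; [left | right; exists i, d, o']. Qed.

Lemma runs_reach o x y : runs o x y -> reach x -> reach y.
Proof. by elim=> // i d o' y' _ IH h; apply: IH; apply: reach_step. Qed.

(** An invariant of the rules in both directions that at oracle [0] reduces to reachability, through
    the empty run. *)
Definition ogood (x : QZ) := forall y, runs (fst x) (snd x) y -> reach y.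

Lemma orules_case i : (exists j, orules i = orule j) \/ orules i = srule.
Proof. by rewrite /orules; case: lt_dec => h; [left; exists (exist (fun k => k < r) _ h) | right]. Qed.

Lemma orules_l j : exists i, orules i = orule j.
Proof.
case: j => j h; exists (exist (fun k => k < S r) j (Nat.lt_lt_succ_r _ _ h)); rewrite /orules /=.
by case: lt_dec => // h'; rewrite (proof_irrelevance _ h' h).
Qed.

Lemma orules_r : exists i, orules i = srule.
Proof.
exists (exist (fun k => k < S r) r (Nat.lt_succ_diag_r r)); rewrite /orules /=.
by case: lt_dec => // h; lia.
Qed.

Lemma ogood_s o : ogood (o, s).
Proof. by move=> y /runs_reach; apply; apply: reach_s. Qed.

Lemma osrc j z d : rp (orule j) ** rbe (orule j) (z, d) =
  ((M * z + oid j)%Z, rp (R j) ** rbe (R j) d).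
Proof. by rewrite /= /orb prodM; congr (_, _); change (oid j + M * z = M * z + oid j)%Z; lia. Qed.

Lemma otgt j z d : rq (orule j) ** rga (orule j) (z, d) = (z, rq (R j) ** rga (R j) d).
Proof. by []. Qed.

Lemma ogood_fw i d : ogood (rp (orules i) ** rbe (orules i) d) -> ogood (rq (orules i) ** rga (orules i) d).
Proof.
case: (orules_case i) => [[j ->]|->]; case: d => z d; last first.
  by move=> _; rewrite /= /osb prodM mulg1; apply: ogood_s.
by rewrite osrc otgt => h y /= hy; apply: h; apply: runsS.
Qed.

(** A backward step appends the digit of rule [j]. A run from there cannot be empty and must start
    with [j], because the last digit determines the rule; [d] is determined up to the kernel, so the
    run passes through the given target. *)
Lemma ogood_bw i d : ogood (rq (orules i) ** rga (orules i) d) -> ogood (rp (orules i) ** rbe (orules i) d).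
Proof.
case: (orules_case i) => [[j ->]|->]; case: d => z d; last first.
  by move=> _; rewrite /= /osb prodM mulg1; apply: ogood_s.
rewrite osrc otgt => h y /= /runs_inv hy; apply: h => /=.
have hj := oid_bound j.
have uniq o a : (0 <= a < M)%Z -> (M * z + oid j = M * o + a)%Z -> z = o /\ oid j = a.
  by move=> ha; apply: Z.div_mod_unique; left; lia.
case: hy => [[E _]|[k [d' [o [Eo [Ex hy]]]]]].
  by have [||_ E'] := uniq 0%Z 0%Z; lia.
have hk := oid_bound k; have [|Ez Ek] := uniq o (oid k) _ Eo; first lia.
have Ekj : k = j by apply: sig_inj; move: Ek; rewrite /oid; lia.
rewrite Ekj -Ez in hy Ex; rewrite /=; suff -> : rga (R j) d = rga (R j) d' by [].
apply: div_eq1; rewrite -(homV _ (@rga_hom _ (R j))) -(@rga_hom _ (R j)); apply/(rker (R j)).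
by rewrite (@rbe_hom _ (R j)) (homV _ (@rbe_hom _ (R j))) (mulgI _ _ _ Ex) mulVg.
Qed.

(** The quantifier over [o] drives the induction: to be left with oracle [o] after rule [j], one
    starts from oracle [M * o + oid j]. *)
Lemma conn_reach y : reach y -> forall o, conn orules ((0%Z, s) : QZ) (o, y).
Proof.
elim=> {y} [|j d _ IH] o.
  have [i Ei] := orules_r.
  have E1 z : rp (orules i) ** rbe (orules i) (z, one) = (z, s).
    by rewrite Ei /= /osb prodM mulg1.
  have E2 z : rq (orules i) ** rga (orules i) (z, one) = ((1 + z)%Z, s).
    by rewrite Ei /= /osb prodM mulg1.
  have up z : conn orules ((0%Z, s) : QZ) (z, s) -> conn orules ((0%Z, s) : QZ) ((1 + z)%Z, s).
    by rewrite -(E1 z) -(E2 z); apply: conn_fw.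
  have dn z : conn orules ((0%Z, s) : QZ) ((1 + z)%Z, s) -> conn orules ((0%Z, s) : QZ) (z, s).
    by rewrite -(E1 z) -(E2 z); apply: conn_bw.
  move: o; apply: Z.peano_ind; first exact: conn_s.
    by move=> z /up; have -> : (1 + z = Z.succ z)%Z by lia.
  by move=> z h; apply: dn; have -> : (1 + Z.pred z = z)%Z by lia.
have [i Ei] := orules_l j.
have := IH (M * o + oid j)%Z; rewrite -(otgt j) -(osrc j) -Ei.
exact: conn_fw.
Qed.

(** The copy of [kg Q] at oracle [0]; on free parts [kback] is a left inverse, killing the basis
    elements with another oracle. *)
Definition kemb (x : kg Q) : kg QZ := ((0%Z, fst x), frl (fun g => frx ((0%Z, g) : QZ)) (snd x)).
Definition kback : fr QZ -> fr Q :=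
  frl (fun x : QZ => if Z.eq_dec (fst x) 0 then frx (snd x) else one).

Lemma kemb_hom : hom kemb.
Proof.
move=> [a x] [b y]; rewrite /kemb !semiM; apply: (f_equal2 pair); first by [].
rewrite [snd _]/= frl_hom; apply: (f_equal2 mul) => //=.
move: x; apply: (@fr_ext Q (fr QZ)
  (fun x => frl (fun g : Q => frx ((0%Z, g) : QZ)) (frl (fun g => frx (g ** b)) x))
  (fun x => frl (fun g : QZ => frx (g ** ((0%Z, b) : QZ))) (frl (fun g : Q => frx ((0%Z, g) : QZ)) x))).
- by apply: hom_comp; apply: frl_hom.
- by apply: hom_comp; apply: frl_hom.
- by move=> g; rewrite !frlx.
Qed.

Lemma kback_emb x : kback (frl (fun g => frx ((0%Z, g) : QZ)) x) = x.
Proof.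
move: x; apply: (fr_ext (g := fun x => x)) => //; first by apply: hom_comp; apply: frl_hom.
by move=> g; rewrite /kback !frlx.
Qed.

(* Higman-type encoding of a nondeterministic reachability relation. *)
Lemma reach_group : exists (H : group) (j : kg Q -> H) (L : list H),
  is_fp H /\ tf N H /\ hom j /\ (forall x, j x = one -> x = one) /\
  (forall k, genl L (j k) -> ksub reach k) /\ (forall g, reach g -> genl L (j (kx g))).
Proof.
have tQZ : tf N QZ by apply: prod_tf => //; apply: zg_tf.
have fQZ : is_fp QZ by apply: prod_fp => //; apply: zg_fp.
have [H [j [L [h1 [h2 [h3 [h4 [h5 h6]]]]]]]] :=
  machine_group N0 tQZ fQZ ogood_fw ogood_bw (@ogood_s 0%Z).
exists H, (fun x => j (kemb x)), L; split=> //; split=> //; split; last split; last split.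
- exact: hom_comp kemb_hom h3.
- move=> [a x] /h4 [-> E]; congr (_, _).
  by rewrite -(kback_emb x) E /kback (hom1 (frl_hom _)).
- move=> [a x] /h5 [/= [->] h]; split=> //=.
  rewrite -(kback_emb x); apply: gen_img h; [exact: frl_hom | exact: gen_sg|].
  move=> _ [[o g] hg ->]; rewrite /kback frlx /=; case: Z.eq_dec => /= E; last exact: gen1.
  by apply: gen_in; exists g => //; apply: hg; rewrite /= E; apply: runs0.
- move=> g /conn_reach /(_ 0%Z) /h6.
  by rewrite /kemb /kx /= frlx.
Qed.
End Oracle.

(** * The rope trick *)

Definition bg : group.
Proof. by refine (@Group bool xorb false (fun x => x) _ _ _) => [[] [] []|[]|[]]. Defined.

Lemma commute_gen (G : group) (S S' : G -> Prop) :
  (forall x y, S x -> S' y -> x ** y = y ** x) -> forall x y, gen S x -> gen S' y -> x ** y = y ** x.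
Proof.
move=> h x y hx hy.
have h1 z : S z -> y ** z = z ** y.
  by move=> hz; apply: (gen_sub (cent_sg z) _ hy) => t ht; symmetry; apply: h.
by apply: (gen_sub (cent_sg y) _ hx) => z /h1.
Qed.

(** As every [a i] commutes with every [y j], a word in the products [a i ** y i] separates into the
    word in [a] and the word in [y]. Below, [C] is conjugation by the last stable letter. *)
Lemma diag_word (K : group) r (a y : nat -> K) (C : K -> K) W : hom C ->
  (forall i, i < r -> C (a i) = a i ** y i) ->
  (forall i j, i < r -> j < r -> a i ** y j = y j ** a i) ->
  word_over (fun i => i < r) W -> C (eval a W) = eval a W ** eval y W.
Proof.
move=> hC h1 h2.
have c W1 W2 : word_over (fun i => i < r) W1 -> word_over (fun i => i < r) W2 ->
    eval a W1 ** eval y W2 = eval y W2 ** eval a W1.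
  move=> /(@eval_gen _ a) g1 /(@eval_gen _ y) g2; apply: commute_gen g1 g2.
  by move=> _ _ [i hi ->] [j hj ->]; apply: h2.
elim: W => [|[i b] W IH] hW; first by rewrite /= (hom1 hC) mulg1.
have hW' : word_over (fun i => i < r) W by move=> l hl; apply: hW; right.
have hi : i < r by apply: (hW (i, b)); left.
have h1W : word_over (fun i => i < r) [(i, b)] by move=> l [<-|[]].
have E : C (evl a (i, b)) = evl a (i, b) ** evl y (i, b).
  rewrite /evl /=; case: b {h1W hW}; rewrite ?(homV _ hC) h1 // invMg.
  by rewrite -!invMg h2.
have cc := c W [(i, b)] hW' h1W; rewrite /= mulg1 in cc.
by rewrite /= hC E (IH hW') !mulAr; congr mul; rewrite !mulA cc.
Qed.

(* The rope trick: adjoin [u] commuting with [L], form the direct product with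
   [P], and conjugate the two copies of the subgroup generated by the [m i]
   into their graphs over [P] by a last stable letter. *)
Section Rope.
Variables (N : nat -> Prop) (H : group) (n : nat) (e : nat -> H) (rels : list word).
Variables (L : list H) (r : nat) (m : nat -> H) (P : group) (p : nat -> P) (bb : nat -> bool).
Hypothesis N0 : forall k, N k -> 0 < k.
Hypothesis fH : fp n e rels.
Hypothesis tH : tf N H.
Hypothesis tP : tf N P.
Hypothesis pgen : forall x, gen (fun y => exists2 i, i < r & y = p i) x.
Notation over := (word_over (fun i => i < r)).
(** Covers both uses. If [bb] is constantly false, words with value in [L] become trivial in [P]. If
    it is true at one index, they become equal to what remains after erasing the other generators,
    which expresses that one generator commutes with certain elements. *)
Notation kill K k := (fun i => if bb i then k i else one : K).
Hypothesis m1p : forall W, over W -> eval m W = one -> eval p W = one.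
Hypothesis mLp : forall W, over W -> genl L (eval m W) -> eval p W = eval (kill P p) W.
Hypothesis puniv : forall (K : group) (k : nat -> K),
  (forall W, over W -> genl L (eval m W) -> eval k W = eval (kill K k) W) ->
  exists2 f : P -> K, hom f & forall i, i < r -> f (p i) = k i.

Let PhiL (_ : unit) (a b : H) := a = b /\ genl L a.

Lemma PhiL_pip i : pip (PhiL i).
Proof.
split=> [|a b a' b' [-> h] [-> h']|a b [-> h]|b []|a []] //.
- by split=> //; apply: gen1.
- by split=> //; apply: genM.
- by split=> //; apply: genV.
Qed.

Let Hu := hnn PhiL_pip.
Let hu : Hu := ht PhiL_pip (tt, true).
Let hm (x : H) : Hu := hi PhiL_pip x.

Let pp (i : nat) : fung bool P := fun c => if c then kill P p i else p i.

Let eval_pp W c : (eval pp W : bool -> P) c = if c then eval (kill P p) W else eval p W.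
Proof. by rewrite (hom_eval pp W (@fung_app bool P c)); case: c. Qed.

(** Sending [m i] to the pair with coordinates [p i] (at [false]) and [kill P p i] (at [true]), and
    [u] to the swap, prescribes the values of [m i] and of [u (m i) u^-1] together: they are read at
    coordinate [false]. This wreath product is only a target for checking consistency, so its
    elements of order two do no harm. *)
Let W0 : group := wr bg P.
Let wn (f : bool -> P) : W0 := sn (wr_act bg P) (f : fung bool P).
Let wq : W0 := sq (wr_act bg P) true.

Let Ga (h : H) (w : W0) := exists W, over W /\ h = eval m W /\ w = wn (eval pp W).

Let wn_hom : @hom (fung bool P) W0 wn.
Proof. exact (sn_hom (wr_act bg P)). Qed.

Let wq_conj f : inv wq ** wn f ** wq = wn (fun c => f (negb c)).
Proof. by rewrite mulAr /wn /wq sn_sq mulKVg. Qed.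

Let wq_inv : inv wq = wq.
Proof. by apply: (mulgI wq); rewrite mulgV /wq -sq_hom. Qed.

(** Since [u] commutes with [L], the image of an element of [L] has to be fixed by the swap; this is
    what [mLp] provides. *)
Let Ga_swap W : over W -> genl L (eval m W) -> (fun c => (eval pp W : bool -> P) (negb c)) = eval pp W.
Proof.
move=> hW hL; apply: functional_extensionality => c; rewrite !eval_pp.
by case: c; rewrite /= (mLp hW hL).
Qed.

Let GL := @grel _ _ _ PhiL_pip W0 Ga (fun _ => wq).

Let GL_hi h w : GL (hm h) w -> Ga h w.
Proof.
apply: grel_hi_inv.
- by exists []; split; [exact: word_over_nil | split=> //; rewrite (hom1 wn_hom)].
- move=> a b a' b' [W [hW [-> ->]]] [W' [hW' [-> ->]]]; exists (W ++ W'); split.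
    exact: word_over_app.
  by rewrite !eval_app wn_hom.
- move=> i a b v [<- hL] [W [hW [E ->]]]; exists W; do !split=> //.
  by rewrite wq_conj Ga_swap // -E.
- move=> i a b v [-> hL] [W [hW [E ->]]]; exists W; do !split=> //.
  by rewrite -{1}wq_inv wq_inv -{1}wq_inv wq_conj Ga_swap // -E.
Qed.

Let GaV a b : Ga a b -> Ga (inv a) (inv b).
Proof.
move=> [W [hW [-> ->]]]; exists (winv W); split; first exact: word_over_winv.
by rewrite !eval_winv (homV _ wn_hom).
Qed.

Let lt (i : nat) : list (prodg Hu P * prodg Hu P) :=
  [((hm (m i), one), (hm (m i), p i));
   ((hu ** hm (m i) ** inv hu, one), (hu ** hm (m i) ** inv hu, kill P p i))].
Let pairs := flat_map lt (seq 0 r).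

Let in_pairs a b : In (a, b) pairs -> exists2 i, i < r &
  (a = (hm (m i), one) /\ b = (hm (m i), p i)) \/
  (a = (hu ** hm (m i) ** inv hu, one) /\ b = (hu ** hm (m i) ** inv hu, kill P p i)).
Proof.
move=> /in_flat_map [i [/in_seq hi [[<- <-]|[[<- <-]|[]]]]]; exists i; try lia; by auto.
Qed.

Let pairsl i : i < r -> genr pairs (hm (m i), one) (hm (m i), p i).
Proof.
by move=> hi; apply: genr_in; apply/in_flat_map; exists i; split; [apply/in_seq; lia | left].
Qed.

Let pairsr i : i < r ->
  genr pairs (hu ** hm (m i) ** inv hu, one) (hu ** hm (m i) ** inv hu, kill P p i).
Proof.
by move=> hi; apply: genr_in; apply/in_flat_map; exists i; split; [apply/in_seq; lia | right; left].
Qed.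

Let over1 i : i < r -> over [(i, false)].
Proof. by move=> hi l [<-|[]]. Qed.

Let GL_m i : i < r -> GL (hm (m i)) (wn (pp i)).
Proof.
by move=> hi; apply: grel_hi; exists [(i, false)]; split; [apply: over1 | rewrite /= !mulg1].
Qed.

Let GL_um i : i < r -> GL (hu ** hm (m i) ** inv hu) (wn (fun c => pp i (negb c))).
Proof.
move=> hi; rewrite -wq_conj {1}wq_inv -{2}wq_inv.
have hq : GL hu wq := grel_ht PhiL_pip Ga (fun _ => wq) (tt, true).
by apply: grelM; [apply: grelM => //; apply: GL_m | apply: grelV].
Qed.

Let graph a b : genr pairs a b -> snd a = one /\ fst b = fst a /\
  exists f, GL (fst a) (wn f) /\ snd b = f false.
Proof.
move: a b; apply: genr_ind.
- do 2 split=> //; exists (fun _ => one); split=> //; rewrite (hom1 wn_hom); exact: gr1.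
- move=> [h x] [h' x'] [k y] [k' y'] /= [-> [-> [f [hf ->]]]] [-> [-> [g [hg ->]]]].
  split; first by rewrite mulg1.
  split=> //; exists (fun c => f c ** g c); split=> //.
  by have := grelM hf hg; rewrite -wn_hom.
- move=> [h x] [h' x'] /= [-> [-> [f [hf ->]]]]; split; first by rewrite inv1g.
  split=> //; exists (fun c => inv (f c)); split=> //.
  by have := grelV GaV hf; rewrite -(homV _ wn_hom).
- move=> a b /in_pairs [i hi [[-> ->]|[-> ->]]]; do 2 split=> //=.
    by exists (pp i); split=> //; apply: GL_m.
  by exists (fun c => pp i (negb c)); split=> //; apply: GL_um.
Qed.

Lemma pairs_pip (_ : unit) : pip (genr pairs).
Proof.
apply: genr_pip => [[h x]|[h x]] /graph /= [E1 [E2 [f [hf E3]]]]; last first.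
  by rewrite -E2 E1.
rewrite E2 E3; congr (_, _).
have /GL_hi [W [hW [E Ef]]] : GL (hm one) (wn f) by rewrite /hm (hom1 (hi_hom _)).
have -> : f = eval pp W by move: Ef; rewrite /wn /sn => -[].
by rewrite eval_pp m1p.
Qed.

Let G := hnn pairs_pip.
Let gs : G := ht pairs_pip (tt, true).
Let gl (x : Hu) : G := hi pairs_pip (x, one).
Let gr (x : P) : G := hi pairs_pip (one, x).

Let gl_hom : hom gl.
Proof. by move=> x y; rewrite /gl -hi_hom prodM mulg1. Qed.

Let gr_hom : hom gr.
Proof. by move=> x y; rewrite /gr -hi_hom prodM mulg1. Qed.

Let glm_hom : hom (fun x => gl (hm x)).
Proof. by apply: hom_comp => //; apply: hi_hom. Qed.

Let glr x y : gl x ** gr y = gr y ** gl x.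
Proof. by rewrite /gl /gr -!hi_hom !prodM !mulg1 !mul1g. Qed.

Let yi i := n + 1 + i.
Let si := n + 1 + r.
Let wm i := wof n e (m i).
Let yw i : word := if bb i then [(yi i, false)] else [].
Let ge (i : nat) : G :=
  if lt_dec i n then gl (hm (e i)) else
  if Nat.eq_dec i n then gl hu else
  if lt_dec i si then gr (p (i - n - 1)) else gs.

Let comw i x : word := [(i, false); (x, false); (i, true); (x, true)].
Let relL l : word := (n, true) :: wof n e l ++ (n, false) :: winv (wof n e l).
Let rel1 i : word := (si, true) :: wm i ++ [(si, false); (yi i, true)] ++ winv (wm i).
Let rel2 i : word := [(si, true); (n, false)] ++ wm i ++ [(n, true); (si, false)] ++
  winv (yw i) ++ [(n, false)] ++ winv (wm i) ++ [(n, true)].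
(** Finitely many relators, although [P] itself may need infinitely many: those of [P] are
    consequences, recovered in [fP]. *)
Let grels := rels ++ map relL L ++
  flat_map (fun i => map (comw (yi i)) (seq 0 (n + 1))) (seq 0 r) ++
  map rel1 (seq 0 r) ++ map rel2 (seq 0 r).

Let in_grels w : In w grels <-> In w rels \/ (exists2 l, In l L & w = relL l) \/
  (exists i x, i < r /\ x < n + 1 /\ w = comw (yi i) x) \/
  (exists2 i, i < r & w = rel1 i) \/ (exists2 i, i < r & w = rel2 i).
Proof.
rewrite /grels !in_app_iff !in_map_iff in_flat_map.
split.
- case=> [h|[[l [<- h]]|[[i [/in_seq hi /(in_map_iff _ _ _) [x [<- /in_seq hx]]]]|[[i [<- /in_seq hi]]|[i [<- /in_seq hi]]]]]].
  + by left.
  + by right; left; exists l.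
  + by do 2 right; left; exists i, x; do !split=> //; lia.
  + by do 3 right; left; exists i => //; lia.
  + by do 4 right; exists i => //; lia.
- case=> [h|[[l h ->]|[[i [x [hi [hx ->]]]]|[[i hi ->]|[i hi ->]]]]].
  + by left.
  + by right; left; exists l.
  + do 2 right; left; exists i; split; first by apply/in_seq; lia.
    by apply: in_map; apply/in_seq; lia.
  + by do 3 right; left; exists i; split=> //; apply/in_seq; lia.
  + by do 4 right; exists i; split=> //; apply/in_seq; lia.
Qed.

Let ge_e i : i < n -> ge i = gl (hm (e i)).
Proof. by rewrite /ge; case: lt_dec. Qed.
Let ge_u : ge n = gl hu.
Proof. by rewrite /ge; case: lt_dec => [|_]; [lia | case: Nat.eq_dec]. Qed.
Let ge_y i : i < r -> ge (yi i) = gr (p i).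
Proof.
rewrite /ge /yi /si => hi; case: lt_dec => [|_]; first lia.
case: Nat.eq_dec => [|_]; first lia.
by case: lt_dec => [_|]; [do 2 f_equal; lia | lia].
Qed.
Let ge_s : ge si = gs.
Proof.
rewrite /ge /si; case: lt_dec => [|_]; first lia.
case: Nat.eq_dec => [|_]; first lia.
by case: lt_dec => //; lia.
Qed.

Let wofo x : word_over (fun i => i < n) (wof n e x).
Proof. exact: (proj1 (wofP x fH)). Qed.
Let wofE x : eval e (wof n e x) = x.
Proof. exact: (proj2 (wofP x fH)). Qed.

Let ge_wof x : eval ge (wof n e x) = gl (hm x).
Proof.
have := hom_eval e (wof n e x) glm_hom; rewrite wofE => ->.
exact: (eval_ext ge_e (@wofo x)).
Qed.

Let eval_yw (K : group) (k : nat -> K) i : eval k (yw i) = if bb i then k (yi i) else one.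
Proof. by rewrite /yw; case: (bb i); rewrite /= ?mulg1. Qed.

Let hu_L l : genl L l -> hm l ** hu = hu ** hm l.
Proof. by move=> h; apply: (ht_rel PhiL_pip (j := (tt, true))). Qed.

Let gs_1 i : i < r -> inv gs ** gl (hm (m i)) ** gs = gl (hm (m i)) ** gr (p i).
Proof.
move=> hi; have := ht_rel pairs_pip (j := (tt, true)) (pairsl hi).
rewrite -/gs -/(gl (hm (m i))) mulAr => ->; rewrite mulKVg /gl /gr -hi_hom prodM.
by rewrite mulg1 mul1g.
Qed.

Let gs_2 i : i < r -> inv gs ** gl (hu ** hm (m i) ** inv hu) ** gs =
  gl (hu ** hm (m i) ** inv hu) ** gr (kill P p i).
Proof.
move=> hi; have := ht_rel pairs_pip (j := (tt, true)) (pairsr hi).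
rewrite -/gs -/(gl (hu ** hm (m i) ** inv hu)) (mulAr (inv gs)) => ->.
by rewrite mulKVg /gl /gr -hi_hom prodM mulg1 mul1g.
Qed.

Let ge_rel w : In w grels -> eval ge w = one.
Proof.
case/in_grels => [h|[[l hl ->]|[[i [x [hi [hx ->]]]]|[[i hi ->]|[i hi ->]]]]].
- rewrite (eval_ext ge_e (fp_over fH h)).
  by have := hom_eval e w glm_hom; rewrite (fp_rel fH h) (hom1 glm_hom) => <-.
- rewrite /relL /= eval_app /= eval_winv ge_wof /evl /= ge_u.
  rewrite (mulA (gl (hm l))) -gl_hom hu_L; last by apply: gen_in.
  by rewrite gl_hom; grp.
- rewrite /comw /= /evl /= ge_y // mulg1.
  have [c ->] : exists c, ge x = gl c.
    case: (lt_dec x n) => h; first by exists (hm (e x)); rewrite ge_e.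
    by exists hu; have -> : x = n; [lia | rewrite ge_u].
  by rewrite mulA -glr; grp.
- rewrite /rel1 /= eval_app /= eval_winv ge_wof /evl /= ge_s ge_y //.
  have := gs_1 hi; rewrite mulAr => E; rewrite (mulA (gl _) gs) (mulA (inv gs)) E; grp.
- rewrite /rel2 /= !eval_app /= !eval_app /= !eval_app /= !eval_winv !ge_wof eval_yw /evl /= ge_s ge_u mulg1.
  have -> : (if bb i then ge (yi i) else one) = gr (kill P p i).
    by case: (bb i); rewrite ?ge_y // (hom1 gr_hom).
  have := gs_2 hi; rewrite !gl_hom (homV _ gl_hom) => E.
  have {}E : inv gs ** (gl hu ** (gl (hm (m i)) ** (inv (gl hu) ** gs))) =
     gl hu ** gl (hm (m i)) ** inv (gl hu) ** gr (kill P p i) by rewrite -E; grp.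
  rewrite -(mulg1 (_ ** _)); apply: (mulIg (gl hu ** gl (hm (m i)) ** inv (gl hu) ** gr (kill P p i))).
  by rewrite mul1g -{2}E; grp.
Qed.

Let nn := n + 2 + r.
Let T := @gen G (fun y => exists2 i, i < nn & y = ge i).

Let T_in i : i < nn -> T (ge i).
Proof. by move=> hi; apply: gen_in; exists i. Qed.

Let T_hnn_sign (G' : group) (Phi : unit -> G' -> G' -> Prop) (hP : forall i, pip (Phi i)) i b
  (A : hnn hP -> Prop) : subgroup A -> A (ht hP (tt, true)) -> A (ht hP (i, b)).
Proof.
case: i; case: b => // hA h; have := ht_inv hP (tt, true); rewrite /jinv /= => ->.
exact: (sgV hA).
Qed.

Let T_gl z : T (gl z).
Proof.
have hs : subgroup (fun z => T (gl z)).
  split; first by rewrite (hom1 gl_hom); apply: gen1.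
    by move=> x y; rewrite gl_hom; apply: genM.
  by move=> x; rewrite (homV _ gl_hom); apply: genV.
move: z; apply: hnn_ind; first exact: (sg1 hs).
  move=> x h hx; apply: (sgM hs) => //; rewrite -/(hm h) -(ge_wof h).
  have hw : word_over (fun i => i < nn) (wof n e h).
    by apply: (word_over_mono _ (@wofo h)); rewrite /nn; lia.
  exact: eval_gen hw.
move=> x [i b] hx; apply: (sgM hs) => //.
apply: (@T_hnn_sign _ _ PhiL_pip i b (fun z => T (gl z))) => //.
by rewrite -/hu -ge_u; apply: T_in; rewrite /nn; lia.
Qed.

Let T_gr x : T (gr x).
Proof.
apply: (gen_img gr_hom (gen_sg _) _ (pgen x)) => _ [i hi ->].
by rewrite -ge_y //; apply: T_in; rewrite /nn /yi; lia.
Qed.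

Let T_all x : T x.
Proof.
move: x; apply: hnn_ind; first exact: gen1.
  move=> x [z y] hx; apply: genM => //.
  have -> : hi pairs_pip (z, y) = gl z ** gr y by rewrite /gl /gr -hi_hom prodM mulg1 mul1g.
  by apply: genM; [apply: T_gl | apply: T_gr].
move=> x [i b] hx; apply: genM => //.
apply: (@T_hnn_sign _ _ pairs_pip i b T); first exact: gen_sg.
by rewrite -/gs -ge_s; apply: T_in; rewrite /nn /si; lia.
Qed.

Lemma quot_eq (K : group) (x v A : K) : x ** (inv v ** inv A) = one -> x = A ** v.
Proof. by move=> E; apply: (mulIg (inv v ** inv A)); rewrite E; grp. Qed.

Section Univ.
Variables (K : group) (k : nat -> K).
Hypothesis hk : forall w, In w grels -> eval k w = one.

Let y i := k (yi i).
Variable f : H -> K.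
Hypothesis hf : hom f.
Hypothesis fe : forall i, i < n -> f (e i) = k i.

Let k_wof x : eval k (wof n e x) = f x.
Proof.
have := hom_eval e (wof n e x) hf; rewrite wofE => ->.
by symmetry; apply: (eval_ext fe (@wofo x)).
Qed.

Lemma rope_comm l : genl L l -> f l ** k n = k n ** f l.
Proof.
move=> hl; apply: (gen_img hf (cent_sg (k n)) _ hl) => x hx.
have : eval k (relL x) = one by apply: hk; apply/in_grels; right; left; exists x.
rewrite /relL /= eval_app /= eval_winv k_wof /evl /= !mulA => /(@inv_uniq K) E.
have {}E := f_equal inv E; rewrite !invgK in E.
apply: (mulgI (inv (k n))); rewrite mulKVg mulA -E; grp.
Qed.

Variable F : Hu -> K.
Hypothesis hF : hom F.
Hypothesis Fm : forall x, F (hm x) = f x.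
Hypothesis Fu : F hu = k n.

Let Fy z i : i < r -> F z ** y i = y i ** F z.
Proof.
move=> hi; apply: (gen_img hF (cent_sg (y i)) _ (_ : gen (fun x => (exists2 j, j < n & x = hm (e j)) \/ x = hu) z)); last first.
  move: z; apply: hnn_ind; first exact: gen1.
    move=> z h hz; apply: genM => //.
    apply: (gen_img (hi_hom PhiL_pip) (gen_sg _) _ (fp_gen fH h)) => _ [j hj ->].
    by apply: gen_in; left; exists j.
  move=> z [j b] hz; apply: genM => //.
  apply: (@T_hnn_sign _ _ PhiL_pip j b); first exact: gen_sg.
  by apply: gen_in; right.
have h x : x < n + 1 -> k x ** y i = y i ** k x.
  move=> hx; have : eval k (comw (yi i) x) = one.
    by apply: hk; apply/in_grels; do 2 right; left; exists i, x.
  rewrite /comw /= /evl /= mulg1 mulA => /(@inv_uniq K) /(f_equal inv).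
  by rewrite invMg !invgK.
move=> _ [[j hj ->]|->]; first by rewrite Fm fe //; apply: h; lia.
by rewrite Fu; apply: h; lia.
Qed.

Let s1 i : i < r -> inv (k si) ** (F (hm (m i)) ** k si) = F (hm (m i)) ** y i.
Proof.
move=> hi; have : eval k (rel1 i) = one by apply: hk; apply/in_grels; do 3 right; left; exists i.
rewrite /rel1 /= eval_app /= eval_winv k_wof /evl /= -/(y i) Fm => E.
by apply: quot_eq; rewrite -E; grp.
Qed.

Let s2 i : i < r -> inv (k si) ** (F (hu ** hm (m i) ** inv hu) ** k si) =
  F (hu ** hm (m i) ** inv hu) ** (if bb i then y i else one).
Proof.
move=> hi; have : eval k (rel2 i) = one by apply: hk; apply/in_grels; do 4 right; exists i.
rewrite !hF (homV _ hF) Fu Fm /rel2 /= !eval_app /= !eval_app /= !eval_app /= !eval_winv !k_wof eval_yw.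
rewrite -/(y i) /evl /=; move: (if bb i then y i else one) => v; rewrite mulg1 => E.
by apply: quot_eq; rewrite -E; grp.
Qed.

Let Fyk i (b : bool) z : i < r -> F z ** (if b then y i else one) = (if b then y i else one) ** F z.
Proof. by case: b => hi; [apply: Fy | rewrite mul1g mulg1]. Qed.

(** The core of the trick. If the value of [W] lies in [L], it commutes with [u], so [W(m)] and
    [u W(m) u^-1] have the same conjugate by the last letter. By [diag_word] this conjugate is
    [W(m) W(y)] on one side and [W(m)] times the killed word in [y] on the other, and cancelling
    yields the relation of [P]. *)
Let fP : exists2 g : P -> K, hom g & forall i, i < r -> g (p i) = y i.
Proof.
apply: puniv => W hW hL.
pose C (x : K) := inv (k si) ** (x ** k si).
have hC : hom C by move=> a b; rewrite /C; grp.
have a1 i : i < r -> C (f (m i)) = f (m i) ** y i by move=> hi; rewrite -Fm; apply: s1.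
have a2 i : i < r -> C (k n ** f (m i) ** inv (k n)) =
    k n ** f (m i) ** inv (k n) ** (if bb i then y i else one).
  by move=> hi; rewrite -Fm -Fu -(homV _ hF) -!hF; apply: s2.
have c1 i j : i < r -> j < r -> f (m i) ** y j = y j ** f (m i).
  by move=> hi hj; rewrite -Fm Fy.
have c2 i j : i < r -> j < r -> (k n ** f (m i) ** inv (k n)) ** (if bb j then y j else one) =
    (if bb j then y j else one) ** (k n ** f (m i) ** inv (k n)).
  by move=> hi hj; rewrite -Fm -Fu -(homV _ hF) -!hF Fyk.
have E1 := diag_word hC a1 c1 hW.
have E2 := diag_word hC a2 c2 hW.
have hcj : hom (fun x => k n ** x ** inv (k n)) by move=> a b; grp.
have := hom_eval m W (hom_comp hf hcj); rewrite -(hom_eval m W hf) in E1 => E3.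
rewrite -E3 -(rope_comm hL) mulAr mulgV mulg1 E1 in E2.
exact: (mulgI _ _ _ E2).
Qed.

Lemma rope_univ : exists2 F' : G -> K, hom F' & forall i, i < nn -> F' (ge i) = k i.
Proof.
have [g hg gy] := fP.
have cFg z x : F z ** g x = g x ** F z.
  symmetry; apply: (gen_img hg (cent_sg (F z)) _ (pgen x)) => _ [i hi ->].
  by rewrite gy // Fy.
have [f2 Ef2] : exists f2 : prodg Hu P -> K, forall x, f2 x = F (fst x) ** g (snd x) by eexists.
have hf2 : hom f2.
  move=> [a b] [a' b']; rewrite !Ef2 /= hF hg !mulAr; congr mul.
  by rewrite !mulA cFg.
have [|F2 [hF2 [E1 E2]]] := @hnn_univ _ _ _ pairs_pip K f2 (fun _ => k si) hf2.
{ move=> _ a b; move: a b; apply: genr_ind.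
  - by rewrite (hom1 hf2) mul1g mulg1.
  - move=> a b a' b' h h'; by rewrite !hf2 mulAr h' !mulA h.
  - move=> a b h; rewrite !(homV _ hf2); apply: (mulgI (f2 a)); apply: (mulIg (f2 b)).
    by rewrite mulKg mulA h; grp.
  - move=> a b /in_pairs [i hi [[-> ->]|[-> ->]]]; rewrite !Ef2 /= (hom1 hg) mulg1 -(mulKg (k si) (F _ ** k si)).
      by rewrite s1 // gy.
    rewrite s2 //; congr (_ ** (_ ** _)).
    by case: (bb i); rewrite ?gy // (hom1 hg). }
exists F2 => // i hi.
case: (lt_dec i n) => h1; first by rewrite ge_e // E1 !Ef2 /= (hom1 hg) mulg1 Fm fe.
case: (Nat.eq_dec i n) => [->|h2]; first by rewrite ge_u E1 !Ef2 /= (hom1 hg) mulg1 Fu.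
case: (lt_dec i si) => h3.
  have hi' : i - n - 1 < r by move: h3; rewrite /si; lia.
  have -> : i = yi (i - n - 1) by rewrite /yi; lia.
  by rewrite ge_y // E1 !Ef2 /= (hom1 hF) mul1g gy.
have -> : i = si by move: hi h3; rewrite /nn /si; lia.
by rewrite ge_s E2.
Qed.

End Univ.

Lemma rope : exists (G : group) (j : P -> G),
  is_fp G /\ tf N G /\ hom j /\ (forall x, j x = one -> x = one).
Proof.
have hinj x : gr x = one -> x = one.
  by rewrite /gr -(hom1 (hi_hom pairs_pip)) => /hi_inj [].
have htf : tf N G by apply: hnn_tf => //; apply: prod_tf => //; apply: hnn_tf.
exists G, gr; split; last by (split; [exact: htf | split; [exact: gr_hom | exact: hinj]]).
exists nn, ge, grels; split.
- move=> w; case/in_grels => [h|[[l hl ->]|[[i [x [hi [hx ->]]]]|[[i hi ->]|[i hi ->]]]]].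
  + by apply: word_over_mono (fp_over fH h); rewrite /nn; lia.
  + have hw x : word_over (fun i => i < nn) (wof n e x).
      by apply: (word_over_mono _ (@wofo x)); rewrite /nn; lia.
    apply: word_over_cons; first by rewrite /nn /=; lia.
    apply: word_over_app; first exact: hw.
    apply: word_over_cons; first by rewrite /nn /=; lia.
    exact: (word_over_winv (hw _)).
  + by do !(apply: word_over_cons; first by rewrite /nn /yi /=; lia).
  + have hw x : word_over (fun i => i < nn) (wof n e x).
      by apply: (word_over_mono _ (@wofo x)); rewrite /nn; lia.
    apply: word_over_cons; first by rewrite /nn /si /=; lia.
    apply: word_over_app; first exact: hw.
    do 2 (apply: word_over_cons; first by rewrite /nn /si /yi /=; lia).
    exact: (word_over_winv (hw _)).
  + have hw x : word_over (fun i => i < nn) (wof n e x).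
      by apply: (word_over_mono _ (@wofo x)); rewrite /nn; lia.
    have hn : n < nn by rewrite /nn; lia.
    have hsi : si < nn by rewrite /nn /si; lia.
    have hy : word_over (fun i => i < nn) (yw i).
      by rewrite /yw; case: (bb i) => //; apply: word_over_cons => //; rewrite /nn /yi /=; lia.
    do 2 apply: word_over_cons => //; apply: word_over_app; first exact: hw.
    do 2 apply: word_over_cons => //; apply: word_over_app; first exact: (word_over_winv hy).
    apply: word_over_cons => //; apply: word_over_app; first exact: (word_over_winv (hw _)).
    exact: word_over_cons.
- exact: ge_rel.
- exact: T_all.
- move=> K k hk.
  have [|f hf fe] := fp_univ fH (K := K) (k := k).
    by move=> w hw; apply: hk; apply/in_grels; left.
  have ku := rope_comm hk hf fe.
  have [|F [hF [Fm Fu]]] := @hnn_univ _ _ _ PhiL_pip K f (fun _ => k n) hf.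
    by move=> _ a b [<- h]; apply: ku.
  exact: (rope_univ hk hf fe hF Fm (Fu tt)).
Qed.
End Rope.

(** * Killing a subgroup described by reachability *)

Lemma eval_one (G : group) W : eval (fun _ => one : G) W = one.
Proof. by elim: W => // -[i b] W /= ->; rewrite /evl /=; case: b; grp. Qed.

(* Killing [T] by a finitely presented group, when membership in [T] is
   reachability for a system of partial affine bijections. *)
Section KillReachable.
Variables (N : nat -> Prop) (d : nat) (V : group) (r : nat).
Notation F := (fr (ord d)).
Notation Q := (prodg V F).
Variables (R : ord r -> rule Q) (s : Q) (acc : V) (T : F -> Prop).
Hypothesis N0 : forall n, N n -> 0 < n.
Hypothesis fV : is_fp V.
Hypothesis tV : tf N V.
Hypothesis T_sg : subgroup T.
Hypothesis T_reach : forall w, T w <-> reach R s (acc, w).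
Variables (P : group) (pi : F -> P).
Hypothesis pi_hom : hom pi.
Hypothesis pi_surj : forall x, exists w, x = pi w.
Hypothesis pi_ker : forall w, pi w = one <-> T w.
Hypothesis tP : tf N P.

Let fF : is_fp F. Proof. by exists d, (fre d), []; apply: fr_fp. Qed.
Let tF : tf N F. Proof. exact: fr_tf. Qed.

Let actF (f : F) : fr Q -> fr Q := frl (fun g : Q => frx (g ** ((one, f) : Q))).

Let actF_ract : ract actF.
Proof.
have h := kg_act Q; split.
- by move=> b; apply: frl_hom.
- by move=> x; apply: (act1 h).
- move=> b b' x; have := actC h ((one, b) : Q) ((one, b') : Q) x.
  by rewrite prodM mul1g.
Qed.

Let K' := semi actF_ract.
Let inc (x : K') : kg Q := (((one, fst x) : Q), snd x).

Let inc_hom : hom inc.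
Proof. by move=> [f x] [f' x']; rewrite /inc !semiM prodM mul1g. Qed.

Let PhiT (_ : unit) (a b : F) := a = b /\ T a.

Let PhiT_pip i : pip (PhiT i).
Proof.
case: T_sg => T1 TM TV.
by split=> [|a b a' b' [-> h] [-> h']|a b [-> h]|b []|a []] //; split; auto.
Qed.

Let Ps := hnn PhiT_pip.
Let z : Ps := ht PhiT_pip (tt, true).
Let hf (w : F) : Ps := hi PhiT_pip w.

Let hf_hom : hom hf. Proof. exact: hi_hom. Qed.

(** From [ka] and [kb] come homomorphisms [A] and [B] sending [m' i] to [p i] and to its killed
    version. On basis elements that are reachable, [(acc, w)] has [w] in [T], so [w^-1 z w = z] and
    the two maps agree; this is [mLp] for the first rope. *)
Let ka : fr Q -> Ps := frl (fun g : Q =>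
  if excluded_middle_informative (fst g = acc) then inv (hf (snd g)) ** z ** hf (snd g) else one).
Let kb : fr Q -> Ps := frl (fun g : Q =>
  if excluded_middle_informative (fst g = acc) then z else one).

Let ka_hom : hom ka. Proof. exact: frl_hom. Qed.
Let kb_hom : hom kb. Proof. exact: frl_hom. Qed.

Let ka_act f n : ka (actF f n) = inv (hf f) ** ka n ** hf f.
Proof.
move: n; apply: fr_ext; first by apply: hom_comp => //; apply: frl_hom.
  by move=> x y; rewrite ka_hom; grp.
move=> [v w]; rewrite /actF frlx prodM mulg1 /ka !frlx /=.
by case: excluded_middle_informative => _; rewrite ?hf_hom; grp.
Qed.

Let kb_act f n : kb (actF f n) = kb n.
Proof.
move: n; apply: fr_ext => //; first by apply: hom_comp => //; apply: frl_hom.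
by move=> [v w]; rewrite /actF frlx prodM mulg1 /kb !frlx /=.
Qed.

Let A (x : K') : Ps := hf (fst x) ** ka (snd x).
Let B (x : K') : Ps := kb (snd x).

Let A_hom : hom A.
Proof. by move=> [f x] [f' x']; rewrite /A semiM /= ka_hom ka_act hf_hom; grp. Qed.

Let B_hom : hom B.
Proof. by move=> [f x] [f' x']; rewrite /B semiM /= kb_hom kb_act. Qed.

Let m' (i : nat) : K' :=
  match i with 0 => (one, frx ((acc, one) : Q)) | S i => (fre d i, one) end.
Let p (i : nat) : Ps := match i with 0 => z | S i => hf (fre d i) end.
Let bb (i : nat) : bool := match i with 0 => true | S _ => false end.

Let A_m i : A (m' i) = p i.
Proof.
case: i => [|i] /=; rewrite /A /=; last by rewrite (hom1 ka_hom) mulg1.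
rewrite /ka frlx (hom1 hf_hom) mul1g /=; case: excluded_middle_informative => //= _; grp.
Qed.

Let B_m i : B (m' i) = (if bb i then p i else one).
Proof.
case: i => [|i] /=; rewrite /B /=; last by rewrite (hom1 kb_hom).
by rewrite /kb frlx /=; case: excluded_middle_informative.
Qed.

Let p_eval W : eval p W = A (eval m' W).
Proof. by rewrite (hom_eval _ _ A_hom); f_equal; apply: functional_extensionality => i; rewrite A_m. Qed.

Let pk_eval W : eval (fun i => if bb i then p i else one) W = B (eval m' W).
Proof. by rewrite (hom_eval _ _ B_hom); f_equal; apply: functional_extensionality => i; rewrite B_m. Qed.

Let z_T w : T w -> hf w ** z = z ** hf w.
Proof. by move=> h; apply: (ht_rel PhiT_pip (j := (tt, true))). Qed.

Let p_gen x : gen (fun y => exists2 i, i < S d & y = p i) x.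
Proof.
move: x; apply: hnn_ind; first exact: gen1.
  move=> x w hx; apply: genM => //.
  apply: (gen_img hf_hom (gen_sg _) _ (fp_gen (fr_fp d) w)) => _ [i hi ->].
  by apply: gen_in; exists (S i) => //; lia.
move=> x [[] b] hx; apply: genM => //.
have hz : gen (fun y => exists2 i, i < S d & y = p i) z by apply: gen_in; exists 0 => //; lia.
by case: b => //; have := ht_inv PhiT_pip (tt, true); rewrite /jinv /= => ->; apply: genV.
Qed.

Let up (w : word) : word := map (fun l => (S (fst l), snd l)) w.

Let eval_up (G : group) (k : nat -> G) w : eval k (up w) = eval (fun i => k (S i)) w.
Proof. by elim: w => //= -[i b] w ->. Qed.

Let over_up n w : word_over (fun i => i < n) w -> word_over (fun i => i < S n) (up w).
Proof. by move=> hw l /(in_map_iff _ _ _) [l' [<- /hw]] /=; lia. Qed.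

Let frl_word (G : group) (k : nat -> G) w :
  exists W, word_over (fun i => i < d) W /\ eval (fre d) W = w /\
    eval k W = frl (fun i : ord d => k (proj1_sig i)) w.
Proof.
have [W hW E] := fp_word w (fr_fp d); exists W; split=> //; split=> //.
rewrite -E (hom_eval _ _ (frl_hom _)); apply: eval_ext hW => i hi.
by rewrite -[i]/(proj1_sig (exist (fun k => k < d) i hi)) freE frlx.
Qed.

(** First rope: it embeds the extension [Ps] of [F] by a letter [z] commuting with [T]. The subgroup
    [T] may be infinitely generated, but its membership is recognized by the list [L] of
    [reach_group]. *)
Let step1 : exists (G : group) (j : Ps -> G),
  is_fp G /\ tf N G /\ hom j /\ (forall x, j x = one -> x = one).
Proof.
have tQ : tf N Q by apply: prod_tf.
have fQ : is_fp Q by apply: prod_fp.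
have [H [j [L [[n [e [rels fH]]] [tH [jh [ji [jL1 jL2]]]]]]]] := reach_group R s N0 tQ fQ.
pose m i := j (inc (m' i)).
have m_eval W : eval m W = j (inc (eval m' W)).
  by rewrite (hom_eval _ _ (hom_comp inc_hom jh)).
have tPs : tf N Ps by apply: hnn_tf.
apply: (@rope N H n e rels L (S d) m Ps p bb) => //.
- move=> W _; rewrite m_eval p_eval => /ji; rewrite /inc.
  case: (eval m' W) => f x /= [-> ->]; rewrite /A /= (hom1 hf_hom) (hom1 ka_hom); grp.
- move=> W _; rewrite m_eval p_eval pk_eval => /jL1; rewrite /inc.
  case: (eval m' W) => f x [/= [->]] h; rewrite /A /B /= (hom1 hf_hom) mul1g.
  apply: (gen_hom_eq ka_hom kb_hom _ h) => _ [[v w] hg ->].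
  rewrite /ka /kb !frlx /=; case: excluded_middle_informative => //= Ev.
  by rewrite mulAr -z_T ?mulKVg //; apply/T_reach; rewrite -Ev.
- move=> K k hk.
  pose f : F -> K := frl (fun i : ord d => k (S (proj1_sig i))).
  have fh : hom f by apply: frl_hom.
  have [|f' [f'h [E1 E2]]] := @hnn_univ _ _ _ PhiT_pip K f (fun _ => k 0) fh.
    move=> _ w _ [<- hw].
    have [W [hW [EW Ek]]] := frl_word (fun i => k (S i)) w.
    (* The word [w^-1 z w]. Its value at [m] is the image of [kx (acc, w)], which is in [genl L] as
       [w] is in [T]; the killed word is [z]. *)
    pose Wc := winv (up W) ++ (0, false) :: up W.
    have Ec (G : group) (k' : nat -> G) : eval k' Wc =
        inv (eval (fun i => k' (S i)) W) ** (k' 0 ** eval (fun i => k' (S i)) W).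
      by rewrite /Wc eval_app eval_winv /= eval_up.
    have oc : word_over (fun i => i < S d) Wc.
      apply: word_over_app; first by (apply: word_over_winv; apply: over_up).
      by apply: word_over_cons; [rewrite /=; lia | apply: over_up].
    have Lc : genl L (eval m Wc).
      rewrite m_eval Ec /=.
      have -> : eval (fun i => (fre d i, one) : K') W = (w, one).
        by have := hom_eval (fre d) W (sq_hom actF_ract); rewrite EW => <-.
      rewrite !inc_hom (homV _ inc_hom).
      have -> : inc (w, one) = kq ((one, w) : Q) by [].
      have -> : inc (one, frx ((acc, one) : Q)) = kx ((acc, one) : Q) by [].
      rewrite mulA kx_kq; apply: jL2.
      by rewrite prodM mulg1 mul1g; apply/T_reach.
    have := hk Wc oc Lc; rewrite !Ec /= eval_one inv1g mul1g mulg1 Ek -/f => h.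
    by apply: (mulgI (inv (f w))); rewrite mulKVg.
  exists f' => // i hi; case: i hi => [|i] hi /=; first exact: E2.
  have hi' : i < d by lia.
  rewrite E1 -[i]/(proj1_sig (exist (fun k => k < d) i hi')) freE.
  by rewrite /f frlx.
Qed.

(** Second rope. By normal forms in [Ps], the finitely generated subgroup [z F z^-1] meets [F]
    exactly in [T], so it can serve as [L], with [bb] constantly false. *)
Lemma kill_reachable : exists (G : group) (j : P -> G),
  is_fp G /\ tf N G /\ hom j /\ (forall x, j x = one -> x = one).
Proof.
have [H [j [[n [e [rels fH]]] [tH [jh ji]]]]] := step1.
pose m i := j (hf (fre d i)).
pose jz (w : F) := j (z ** hf w ** inv z).
have jzh : hom jz by move=> a b; rewrite /jz hf_hom -jh; f_equal; grp.
pose L := map (fun i => jz (fre d i)) (seq 0 d).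
have m_eval W : eval m W = j (hf (eval (fre d) W)).
  by rewrite (hom_eval _ _ (hom_comp hf_hom jh)).
have p_eval' W : eval (fun i => pi (fre d i)) W = pi (eval (fre d) W).
  by rewrite (hom_eval _ _ pi_hom).
have jinj := hom_inj jh ji.
have hL x : genl L x <-> exists w, x = jz w.
  split.
  { elim=> {x} [x /(in_map_iff _ _ _) [i [<- _]]||x y _ [a ->] _ [b ->]|x _ [a ->]].
    - by exists (fre d i).
    - by exists one; rewrite (hom1 jzh).
    - by exists (a ** b); rewrite jzh.
    - by exists (inv a); rewrite (homV _ jzh). }
  move=> [w ->]; apply: (gen_img jzh (gen_sg _) _ (fp_gen (fr_fp d) w)) => _ [i hi ->].
  by apply: gen_in; apply/in_map_iff; exists i; split=> //; apply/in_seq; lia.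
have TL w : genl L (j (hf w)) <-> T w.
  split.
    move=> /hL [w' /jinj E].
    have [b [_ //]] : dom PhiT (tt, true) w.
    apply: (@ht_dom _ _ _ PhiT_pip (tt, true) w w').
    by rewrite -/(hf w) E -/(hf w') -/z; grp.
  move=> hw; apply/hL; exists w; rewrite /jz; f_equal.
  by rewrite -z_T //; grp.
apply: (@rope N H n e rels L d m P (fun i => pi (fre d i)) (fun _ => false)) => //.
- move=> x; have [w ->] := pi_surj x.
  apply: (gen_img pi_hom (gen_sg _) _ (fp_gen (fr_fp d) w)) => _ [i hi ->].
  by apply: gen_in; exists i.
- move=> W _; rewrite m_eval p_eval' => /ji; rewrite -(hom1 hf_hom) => /(@hi_inj _ _ _ _ _ _) ->.
  exact: hom1.
- move=> W _; rewrite m_eval p_eval' eval_one => /TL h.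
  exact/pi_ker.
- move=> K k hk.
  pose f : F -> K := frl (fun i : ord d => k (proj1_sig i)).
  have fh : hom f by apply: frl_hom.
  have fT w : T w -> f w = one.
    move=> hw; have [W [hW [EW Ek]]] := frl_word k w.
    by rewrite /f -Ek hk ?eval_one // m_eval EW; apply/TL.
  have fpi w w' : pi w = pi w' -> f w = f w'.
    move=> E; apply: div_eq1; rewrite -(homV _ fh) -fh; apply: fT; apply/pi_ker.
    by rewrite pi_hom (homV _ pi_hom) E mulVg.
  pose c x := proj1_sig (constructive_indefinite_description _ (pi_surj x)).
  have cP x : pi (c x) = x by rewrite /c; case: constructive_indefinite_description.
  exists (fun x => f (c x)).
    by move=> x y; rewrite -fh; apply: fpi; rewrite pi_hom !cP.
  move=> i hi; rewrite (fpi _ (fre d i)) ?cP //.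
  by rewrite -[i]/(proj1_sig (exist (fun k => k < d) i hi)) freE /f frlx.
Qed.
End KillReachable.

(** * Integer vectors and elementary affine operations *)

Lemma triv_fp : is_fp triv.
Proof.
exists 0, (fun _ => tt : triv), []; split=> //.
- by move=> []; apply: gen1.
- move=> K k _; exists (fun _ => one) => [x y|i hi]; [by rewrite mulg1 | lia].
Qed.

Fixpoint vec (K : nat) : group := match K with 0 => triv | S K => prodg zg (vec K) end.

Fixpoint vof (K : nat) (u : nat -> Z) : vec K :=
  match K with 0 => tt | S K => (u 0, vof K (fun i => u (S i))) end.

Fixpoint vto {K : nat} : vec K -> nat -> Z :=
  match K with
  | 0 => fun _ _ => 0%Z
  | S K => fun v i => match i with 0 => fst v | S i => vto (snd v) i end
  end.

Lemma vec_fp K : is_fp (vec K).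
Proof. by elim: K => [|K IH] /=; [exact: triv_fp | apply: prod_fp => //; apply: zg_fp]. Qed.

Lemma vec_tf N K : (forall n, N n -> 0 < n) -> tf N (vec K).
Proof.
move=> N0; elim: K => [|K IH] /=; first by move=> n _ [].
by apply: prod_tf => //; apply: zg_tf.
Qed.

Lemma vofK K (v : vec K) : vof K (vto v) = v.
Proof. by elim: K v => [|K IH] [] //= z v; rewrite IH. Qed.

Lemma vtoK K u i : (forall i, K <= i -> u i = 0%Z) -> vto (vof K u) i = u i.
Proof.
elim: K u i => [|K IH] u [|i] h //=; try by (rewrite h //; lia).
by apply: IH => j hj; apply: h; lia.
Qed.

Lemma vto_supp K (v : vec K) i : K <= i -> vto v i = 0%Z.
Proof. by elim: K v i => [|K IH] v [|i] h //=; [lia | apply: IH; lia]. Qed.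

Lemma vofD K (u u' : nat -> Z) : vof K (fun i => (u i + u' i)%Z) = vof K u ** vof K u'.
Proof. by elim: K u u' => [|K IH] u u' //=; rewrite IH. Qed.

Lemma vtoD K (v v' : vec K) i : vto (v ** v') i = (vto v i + vto v' i)%Z.
Proof. by elim: K v v' i => [|K IH] v v' [|i] //=; apply: IH. Qed.

Lemma vto1 K i : vto (one : vec K) i = 0%Z.
Proof. by elim: K i => [|K IH] [|i] //=; apply: IH. Qed.

Definition supp K (u : nat -> Z) := forall i, K <= i -> u i = 0%Z.

Lemma vto_inj K (v v' : vec K) : (forall i, vto v i = vto v' i) -> v = v'.
Proof.
by move=> h; rewrite -(vofK v) -(vofK v'); f_equal; apply: functional_extensionality.
Qed.

(* [u] and [u'] are related by [u = op_p + op_B z], [u' = op_q + op_C z],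
   that is, by the partial function [op_U] with domain [op_D]. *)
Record op (K : nat) := Op {
  op_p : nat -> Z; op_q : nat -> Z;
  op_B : (nat -> Z) -> nat -> Z; op_C : (nat -> Z) -> nat -> Z;
  op_D : (nat -> Z) -> Prop; op_U : (nat -> Z) -> nat -> Z;
  op_sp : supp K op_p; op_sq : supp K op_q;
  op_sB : forall z, supp K z -> supp K (op_B z);
  op_sC : forall z, supp K z -> supp K (op_C z);
  op_aB : forall z z' i, op_B (fun i => z i + z' i)%Z i = (op_B z i + op_B z' i)%Z;
  op_aC : forall z z' i, op_C (fun i => z i + z' i)%Z i = (op_C z i + op_C z' i)%Z;
  op_ker : forall z, (forall i, op_B z i = 0%Z) <-> (forall i, op_C z i = 0%Z);
  op_fw : forall z, let u i := (op_p i + op_B z i)%Z in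
    op_D u /\ forall i, op_U u i = (op_q i + op_C z i)%Z;
  op_bw : forall u, supp K u -> op_D u -> exists2 z, supp K z &
    (forall i, u i = op_p i + op_B z i)%Z /\ (forall i, op_U u i = op_q i + op_C z i)%Z }.

Definition upd (u : nat -> Z) i x : nat -> Z := fun j => if Nat.eqb j i then x else u j.

Definition zero : nat -> Z := fun _ => 0%Z.

Ltac updt := unfold upd, zero in *; repeat (let E := fresh "E" in
  match goal with |- context [Nat.eqb ?a ?b] => case: (Nat.eqb_spec a b) => E; try subst end;
  cbv beta iota in * ); try lia.

Section Ops.
Variable K : nat.

(** Nonzero factors keep the map injective. In all the operations, coordinate 0 is the main register
    [g], coordinates 1 and 2 are the work registers [a] and [b], and the others are the registers
    [r]. *)
Definition odiag (c e : nat -> Z) (he : supp K e) (hc : forall i, c i <> 0%Z) : op K.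
Proof.
refine (@Op K zero e (fun z => z) (fun z i => c i * z i)%Z (fun _ => True) (fun u i => c i * u i + e i)%Z
  _ he _ _ _ _ _ _ _) => //.
- by move=> z h i hi; rewrite h //; lia.
- by move=> z z' i; lia.
- move=> z; split=> h i; have := h i; first by move=> ->; lia.
  by move=> E; have := hc i; nia.
- by move=> z; split=> // i; rewrite /zero; lia.
- by move=> u hu _; exists u => //; split=> i; rewrite /zero; lia.
Defined.

(* a := r_x, b := 2 r_y + 1, provided a = b = 0 *)
Definition oinit x y (hK : 3 <= K) (hx : 3 <= x < K) (hy : 3 <= y < K) : op K.
Proof.
refine (@Op K zero (upd zero 2 1%Z) (fun z => upd (upd z 1 0%Z) 2 0%Z)
  (fun z => upd (upd z 1 (z x)) 2 (2 * z y)%Z)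
  (fun u => u 1 = 0%Z /\ u 2 = 0%Z) (fun u => upd (upd u 1 (u x)) 2 (2 * u y + 1)%Z) _ _ _ _ _ _ _ _ _) => //.
- by move=> i hi; updt.
- by move=> z h i hi; updt; apply: h.
- by move=> z h i hi; updt; apply: h.
- by move=> z z' i; updt.
- by move=> z z' i; updt.
- move=> z; split=> h i.
    have hx' := h x; have hy' := h y; have hi := h i; move: hx' hy' hi; updt.
  have hi := h i; move: hi; updt.
- move=> z u; rewrite /u; split; first by split; rewrite /zero; updt.
  move=> i; rewrite /zero; updt.
- move=> u hu [h1 h2]; exists u => //; split=> i; rewrite /zero; updt.
Defined.

(* a := 0, b := 0, provided a = 0 and b = r_l *)
Definition ofin l (hK : 3 <= K) (hl : 3 <= l < K) : op K.
Proof.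
refine (@Op K zero zero (fun z => upd (upd z 1 0%Z) 2 (z l)) (fun z => upd (upd z 1 0%Z) 2 0%Z)
  (fun u => u 1 = 0%Z /\ u 2 = u l) (fun u => upd (upd u 1 0%Z) 2 0%Z) _ _ _ _ _ _ _ _ _) => //.
- by move=> z h i hi; updt; apply: h.
- by move=> z h i hi; updt; apply: h.
- by move=> z z' i; updt.
- by move=> z z' i; updt.
- move=> z; split=> h i.
    have hi := h i; move: hi; updt.
  have hx' := h l; have hi := h i; move: hx' hi; updt.
- move=> z u; rewrite /u; split; first by split; rewrite /zero; updt.
  move=> i; rewrite /zero; updt.
- move=> u hu [h1 h2]; exists u => //; split=> i; rewrite /zero; updt.
Defined.

(* g := r_y, provided g = r_x *)
Definition oswap x y (hx : 3 <= x < K) (hy : 3 <= y < K) : op K.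
Proof.
refine (@Op K zero zero (fun z => upd z 0 (z x)) (fun z => upd z 0 (z y))
  (fun u => u 0 = u x) (fun u => upd u 0 (u y)) _ _ _ _ _ _ _ _ _) => //.
- by move=> z h i hi; updt; apply: h.
- by move=> z h i hi; updt; apply: h.
- by move=> z z' i; updt.
- by move=> z z' i; updt.
- move=> z; split=> h i.
    have hx' := h y; have hi := h i; move: hx' hi; updt.
  have hx' := h x; have hi := h i; move: hx' hi; updt.
- move=> z u; rewrite /u; split; first by rewrite /zero; updt.
  move=> i; rewrite /zero; updt.
- move=> u hu h1; exists u => //; split=> i; rewrite /zero; updt.
Defined.

Definition ochk x (hx : x < K) : op K.
Proof.
refine (@Op K zero zero (fun z => upd z x 0%Z) (fun z => upd z x 0%Z)
  (fun u => u x = 0%Z) (fun u => u) _ _ _ _ _ _ _ _ _) => //.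
- by move=> z h i hi; updt; apply: h.
- by move=> z h i hi; updt; apply: h.
- by move=> z z' i; updt.
- by move=> z z' i; updt.
- by move=> z u; rewrite /u; split; [rewrite /zero; updt|].
- move=> u hu h1; exists u => //; split=> i; rewrite /zero; updt.
Defined.
End Ops.

(** * Machines with control states *)

Section Machine.
Variables (K d : nat).
Notation F := (fr (ord d)).
Notation V := (prodg (prodg zg zg) (vec K)).
Notation Q := (prodg V F).

Record lrule := LRule { l_c : Z * Z; l_c' : Z * Z; l_op : op K; l_out : F }.

Inductive mreach (l : list lrule) : Z * Z -> (nat -> Z) -> F -> Prop :=
| mreach0 : mreach l (0%Z, 0%Z) zero one
| mreachS r u f : In r l -> mreach l (l_c r) u f -> op_D (l_op r) u ->
    mreach l (l_c' r) (op_U (l_op r) u) (l_out r ** f).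

Section Rule.
Variable r : lrule.

(** The control state is imposed by the translation parts, hence trivial here. The output component
    is free, so that a rule applies whatever has been printed; [l_out] is added by left
    translation. *)
Definition mB (x : Q) : Q := ((one, vof K (op_B (l_op r) (vto (snd (fst x))))), snd x).
Definition mC (x : Q) : Q := ((one, vof K (op_C (l_op r) (vto (snd (fst x))))), snd x).

Lemma mB_hom : hom mB.
Proof.
move=> [[c v] f] [[c' v'] f']; rewrite /mB !prodM mul1g; do 2 f_equal.
rewrite -vofD; f_equal; apply: functional_extensionality => i /=.
rewrite -op_aB; f_equal; apply: functional_extensionality => j; exact: vtoD.
Qed.

Lemma mC_hom : hom mC.
Proof.
move=> [[c v] f] [[c' v'] f']; rewrite /mC !prodM mul1g; do 2 f_equal.
rewrite -vofD; f_equal; apply: functional_extensionality => i /=.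
rewrite -op_aC; f_equal; apply: functional_extensionality => j; exact: vtoD.
Qed.

Lemma vof_one u : supp K u -> (vof K u = one <-> forall i, u i = 0%Z).
Proof.
move=> hu; split=> [E i|E]; first by rewrite -(vtoK i hu) E vto1.
by apply: vto_inj => i; rewrite vtoK // vto1.
Qed.

Lemma m_ker x : mB x = one <-> mC x = one.
Proof.
case: x => [[c v] f]; rewrite /mB /mC /= !prod1.
have sv : supp K (vto v) by move=> i; apply: vto_supp.
have vB := vof_one (@op_sB _ (l_op r) _ sv); have vC := vof_one (@op_sC _ (l_op r) _ sv).
have key (a b : vec K) : (((one, a), f) : Q) = ((one, one), one) -> (b = one) -> (((one, b), f) : Q) = ((one, one), one).
  by move=> -[_ ->] ->.
split=> E; apply: (key _ _ E).
  apply/vC/(op_ker (l_op r))/vB; exact: (f_equal (fun x : Q => snd (fst x)) E).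
apply/vB/(op_ker (l_op r))/vC; exact: (f_equal (fun x : Q => snd (fst x)) E).
Qed.

Definition mrule : rule Q :=
  @Rule Q ((l_c r, vof K (op_p (l_op r))), one) mB mC ((l_c' r, vof K (op_q (l_op r))), l_out r)
    mB_hom mC_hom m_ker.

Lemma mrule_src v : rp mrule ** rbe mrule v =
  ((l_c r, vof K (fun i => op_p (l_op r) i + op_B (l_op r) (vto (snd (fst v))) i)%Z), snd v).
Proof. by rewrite /= /mB !prodM mulg1 mul1g vofD. Qed.

Lemma mrule_tgt v : rq mrule ** rga mrule v =
  ((l_c' r, vof K (fun i => op_q (l_op r) i + op_C (l_op r) (vto (snd (fst v))) i)%Z),
   l_out r ** snd v).
Proof. by rewrite /= /mC !prodM mulg1 vofD. Qed.
End Rule.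

Variable l : list lrule.
Variable r0 : lrule.
Definition mrules (i : ord (length l)) : rule Q := mrule (nth (proj1_sig i) l r0).
Definition mstart : Q := (((0%Z, 0%Z), vof K zero), one).

Lemma op_Usupp (o : op K) u : supp K u -> op_D o u -> supp K (op_U o u).
Proof.
move=> hu hD i hi; have [z sz [_ ->]] := op_bw hu hD.
by rewrite op_sq // (op_sC _ sz).
Qed.

Lemma mreach_supp c u f : mreach l c u f -> supp K u.
Proof. by elim=> // r u' f' _ _ h; apply: op_Usupp. Qed.

Lemma mreach_reach c u f : mreach l c u f -> reach mrules mstart ((c, vof K u), f).
Proof.
elim=> {c u f} [|r u f hr hm IH hD]; first exact: reach_s.
have hu := mreach_supp hm.
have [z sz [Eu EU]] := op_bw hu hD.
have [i [hi Er]] := In_nth l r r0 hr.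
pose i' : ord (length l) := exist _ i hi.
have := @reach_step _ _ mrules mstart i' ((one, vof K z), f).
rewrite /mrules /= Er mrule_src mrule_tgt /=.
have -> : vto (vof K z) = z by apply: functional_extensionality => j; apply: vtoK.
have -> : (fun i => op_p (l_op r) i + op_B (l_op r) z i)%Z = u.
  by apply: functional_extensionality => j; rewrite Eu.
have -> : (fun i => op_q (l_op r) i + op_C (l_op r) z i)%Z = op_U (l_op r) u.
  by apply: functional_extensionality => j; rewrite EU.
by apply.
Qed.

Lemma reach_mreach x : reach mrules mstart x ->
  exists c u f, x = ((c, vof K u), f) /\ mreach l c u f.
Proof.
elim=> {x} [|i v _ [c [u [f [E hm]]]]]; first by exists (0%Z, 0%Z), zero, one; split=> //; apply: mreach0.
move: E; rewrite /mrules; set r := nth _ _ _.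
have hr : In r l by apply: nth_In; apply: (proj2_sig i).
rewrite mrule_src mrule_tgt => -[Ec Eu Ef].
have sz : supp K (vto (snd (fst v))) by move=> j; apply: vto_supp.
have {}Eu : u = (fun i => op_p (l_op r) i + op_B (l_op r) (vto (snd (fst v))) i)%Z.
  apply: functional_extensionality => j.
  rewrite -(vtoK j (mreach_supp hm)) -Eu vtoK // => k hk.
  by rewrite op_sp // (op_sB _ sz).
have [hD hU] := op_fw (l_op r) (vto (snd (fst v))).
exists (l_c' r), (op_U (l_op r) u), (l_out r ** f); split.
  rewrite Ef; suff -> : op_U (l_op r) u =
      (fun i => op_q (l_op r) i + op_C (l_op r) (vto (snd (fst v))) i)%Z by [].
  by apply: functional_extensionality => j; rewrite Eu hU.
by apply: mreachS => //; [rewrite Ec | rewrite Eu].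
Qed.

Lemma reach_cfg c u f : supp K u -> (reach mrules mstart ((c, vof K u), f) <-> mreach l c u f).
Proof.
move=> hu; split; last exact: mreach_reach.
move=> /reach_mreach [c' [u' [f' [[-> Eu ->] hm]]]].
suff -> : u = u' by [].
apply: functional_extensionality => j.
by rewrite -(vtoK j hu) Eu vtoK //; apply: (mreach_supp hm).
Qed.
End Machine.

(** * Programs *)

Inductive instr K := Atom (o : op K) | Loop (o : op K).

Section Programs.
Variable K : nat.

Inductive loop (o : op K) (u : nat -> Z) : (nat -> Z) -> Prop :=
| loop0 : loop o u u
| loopS u' : loop o u u' -> op_D o u' -> loop o u (op_U o u').

Definition exec1 (i : instr K) u u' :=
  match i with Atom o => op_D o u /\ u' = op_U o u | Loop o => loop o u u' end.

Fixpoint exec (p : list (instr K)) u u' :=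
  match p with [] => u' = u | i :: p => exists2 v, exec1 i u v & exec p v u' end.

Lemma exec_app p q u u' : exec (p ++ q) u u' <-> exists2 v, exec p u v & exec q v u'.
Proof.
elim: p u => [|i p IH] u /=; first by split=> [h|[v ->] //]; exists u.
split=> [[v h /IH [v' h1 h2]]|[v' [v h h1] h2]]; first by exists v' => //; exists v.
by exists v => //; apply/IH; exists v'.
Qed.

Variable ps : list (list (instr K)).

Inductive pstar u : (nat -> Z) -> Prop :=
| pstar0 : pstar u u
| pstarS p v v' : pstar u v -> In p ps -> exec p v v' -> pstar u v'.

Variable d : nat.
Notation F := (fr (ord d)).
Variable outs : list (nat * F).

Definition onop : op K := @odiag K (fun _ => 1%Z) zero (fun _ _ => eq_refl) (fun i => Z.neq_succ_diag_l 0).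

Variable hK : 1 <= K.

(** On register 0 this is [n -> 2^k (2n + 1)], the code of a tree with sons coded by [k] and [n]: a
    printed letter is consed onto the coded word. *)
Definition oprint (k : nat) : op K.
Proof.
refine (@odiag K (upd (fun _ => 1%Z) 0 (2 ^ Z.of_nat (S k))%Z) (upd zero 0 (2 ^ Z.of_nat k)%Z) _ _).
- by move=> i hi; updt.
- by move=> i; updt; apply: Z.pow_nonzero; lia.
Defined.

(** Control [(0, 0)] guesses a word, multiplying its values and storing its code. The last rule puts
    a leaf in front of the coded word ([n -> 2n + 1]) and passes to [(0, 1)], from which the
    programs are called. *)
Definition prules : list (lrule K d) :=
  map (fun ko => LRule (0%Z, 0%Z) (0%Z, 0%Z) (oprint (fst ko)) (snd ko)) outs ++
  [LRule (0%Z, 0%Z) (0%Z, 1%Z) (oprint 0) one].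

(** The successor separates control inside programs from [(0, 0)] and [(0, 1)]. *)
Definition st (rho pc : nat) : Z * Z := (Z.of_nat (S rho), Z.of_nat pc).

Definition irules rho (p : list (instr K)) pc : list (lrule K d) :=
  match nth_error p pc with
  | Some (Atom o) => [LRule (st rho pc) (st rho (S pc)) o one]
  | Some (Loop o) => [LRule (st rho pc) (st rho pc) o one; LRule (st rho pc) (st rho (S pc)) onop one]
  | None => []
  end.

Definition grules rho p : list (lrule K d) :=
  LRule (0%Z, 1%Z) (st rho 0) onop one :: LRule (st rho (length p)) (0%Z, 1%Z) onop one ::
  flat_map (irules rho p) (seq 0 (length p)).

Definition allrules := prules ++ flat_map (fun rho => grules rho (nth rho ps [])) (seq 0 (length ps)).

Fixpoint cw (W : list (nat * F)) : Z :=
  match W with [] => 0 | ko :: W => 2 ^ Z.of_nat (fst ko) * (2 * cw W + 1) end%Z.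
Fixpoint ew (W : list (nat * F)) : F :=
  match W with [] => one | ko :: W => snd ko ** ew W end.

Definition gset (n : Z) : nat -> Z := upd zero 0 n.

Lemma onopE u : op_U onop u = u.
Proof. by apply: functional_extensionality => i; change (1 * u i + zero i = u i)%Z; unfold zero; lia. Qed.

Lemma oprintE k n : op_U (oprint k) (gset n) = gset (2 ^ Z.of_nat k * (2 * n + 1))%Z.
Proof.
apply: functional_extensionality => i.
change (upd (fun _ => 1) 0 (2 ^ Z.of_nat (S k)) i * gset n i + upd zero 0 (2 ^ Z.of_nat k) i =
  gset (2 ^ Z.of_nat k * (2 * n + 1)) i)%Z.
rewrite /gset; updt.
by rewrite Nat2Z.inj_succ Z.pow_succ_r; lia.
Qed.

Definition Wok W := forall ko, In ko W -> In ko outs.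

Lemma allrules_in r : In r allrules <->
  (exists2 ko, In ko outs & r = LRule (0%Z, 0%Z) (0%Z, 0%Z) (oprint (fst ko)) (snd ko)) \/
  r = LRule (0%Z, 0%Z) (0%Z, 1%Z) (oprint 0) one \/
  exists rho, rho < length ps /\ In r (grules rho (nth rho ps [])).
Proof.
rewrite /allrules /prules !in_app_iff in_map_iff in_flat_map; split.
- case; first case.
  + by move=> [ko [<- h]]; left; exists ko.
  + by case=> // <-; right; left.
  + by move=> [rho [/in_seq h h']]; do 2 right; exists rho; split=> //; lia.
- case=> [[ko h ->]|[->|[rho [h h']]]].
  + by do 2 left; exists ko.
  + by left; right; left.
  + by right; exists rho; split=> //; apply/in_seq; lia.
Qed.

Lemma firstn_S (T : Type) (p : list T) n x : nth_error p n = Some x -> firstn (S n) p = firstn n p ++ [x].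
Proof. by elim: n p => [|n IH] [|y p] //= => [[->]|/IH E] //; rewrite -E. Qed.

(* The iterations that a loop interrupted at [pc] has performed lead from [u] to [u']. *)
Definition part (p : list (instr K)) pc u u' :=
  match nth_error p pc with Some (Loop o) => loop o u u' | _ => u' = u end.

Lemma part_refl p pc u : part p pc u u.
Proof. by rewrite /part; case: nth_error => // -[] // o; apply: loop0. Qed.

(** The three cases are the phases: printing, between two programs, and inside program [rho] at
    [pc]. The guessed word is remembered throughout, since it determines both the output and the
    initial register. *)
Definition minv (c : Z * Z) u f :=
  exists W, Wok W /\ f = ew W /\
    ((c = (0%Z, 0%Z) /\ u = gset (cw W)) \/
     (c = (0%Z, 1%Z) /\ pstar (gset (2 * cw W + 1)) u) \/
     (exists rho pc v, c = st rho pc /\ rho < length ps /\ pc <= length (nth rho ps []) /\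
        pstar (gset (2 * cw W + 1)) v /\
        exists2 u0, exec (firstn pc (nth rho ps [])) v u0 & part (nth rho ps []) pc u0 u)).

Lemma st_inj a b a' b' : st a b = st a' b' -> a = a' /\ b = b'.
Proof. by rewrite /st => -[]; lia. Qed.

Lemma mreach_minv c u f : mreach allrules c u f -> minv c u f.
Proof.
elim=> {c u f} [|r u f hr _ [W [hW [-> H]]] hD].
  exists []; split=> //; split=> //; left; split=> //.
  by apply: functional_extensionality => i; rewrite /gset; updt.
case/allrules_in: hr hD H => [[[k o] hko ->]|[->|[rho [hrho hr]]]] hD H.
- case: H => [[_ ->]|[[//]|[rho [pc [v [E]]]]]]; last by rewrite /st in E; case: E; lia.
  exists ((k, o) :: W); split; first by move=> ? [<-|/hW].
  by split=> //; left; split=> //; rewrite [l_op _]/= oprintE.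
- case: H => [[_ ->]|[[//]|[rho [pc [v [E]]]]]]; last by rewrite /st in E; case: E; lia.
  exists W; split=> //; rewrite mul1g; split=> //; right; left; split=> //.
  rewrite [l_op _]/= oprintE; have -> : (2 ^ Z.of_nat 0 * (2 * cw W + 1) = 2 * cw W + 1)%Z by lia.
  exact: pstar0.
- have hp : In (nth rho ps []) ps by apply: nth_In.
exists W; split=> //.
have no_st (T : Prop) c : st rho c = (0%Z, 0%Z) \/ st rho c = (0%Z, 1%Z) -> T.
  by rewrite /st => -[] [] E; exfalso; lia.
have inst c : ((st rho c = (0%Z, 0%Z) /\ u = gset (cw W)) \/
     (st rho c = (0%Z, 1%Z) /\ pstar (gset (2 * cw W + 1)) u) \/
     (exists rho' pc v, st rho c = st rho' pc /\ rho' < length ps /\ pc <= length (nth rho' ps []) /\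
        pstar (gset (2 * cw W + 1)) v /\
        exists2 u0, exec (firstn pc (nth rho' ps [])) v u0 & part (nth rho' ps []) pc u0 u)) ->
     exists v u0, pstar (gset (2 * cw W + 1)) v /\ exec (firstn c (nth rho ps [])) v u0 /\
       part (nth rho ps []) c u0 u.
  case=> [[E _]|[[E _]|[rho' [pc' [v [E [h1 [h2 [h3 [u0 h4 h5]]]]]]]]]]; try by (apply: (no_st _ c); auto).
  by exists v, u0; case/st_inj: E h4 h5 => -> ->.
case: hr hD H => [<-|[<-|/in_flat_map [pc [/in_seq hpc]]]].
+ rewrite [l_op _]/= onopE [l_out _]/= mul1g [l_c _]/= [l_c' _]/= => _ H; split=> //; do 2 right.
  case: H => [[//]|[[_ H]|[rho' [pc [v [E]]]]]]; last by rewrite /st in E; case: E; lia.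
  exists rho, 0, u; do !split=> //; first lia.
  by exists u => //; apply: part_refl.
+ rewrite [l_op _]/= onopE [l_out _]/= mul1g [l_c _]/= [l_c' _]/= => _ H; split=> //; right; left; split=> //.
  have [v [u0 [h3 [h4 h5]]]] := inst _ H; rewrite firstn_all in h4.
  have En : nth_error (nth rho ps []) (length (nth rho ps [])) = None by apply/nth_error_None.
  move: h5; rewrite /part En => ->.
  exact: pstarS h3 hp h4.
+ rewrite /irules; case En : nth_error => [[o|o]|] //.
  * case=> // <-; rewrite [l_op _]/= [l_out _]/= mul1g [l_c _]/= [l_c' _]/= => hD H; split=> //; do 2 right.
    have [v [u0 [h3 [h4]]]] := inst _ H; rewrite /part En => h5; subst u0.
    exists rho, (S pc), v; do 2 (split=> //); split; first lia.
    split=> //; exists (op_U o u); last exact: part_refl.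
    by rewrite (firstn_S En); apply/exec_app; exists u => //; exists (op_U o u).
  * have hpc' : S pc <= length (nth rho ps []) by lia.
    case=> [<-|[<-|//]]; rewrite [l_op _]/= [l_out _]/= mul1g [l_c _]/= [l_c' _]/= => hD H; split=> //;
      do 2 right; have [v [u0 [h3 [h4]]]] := inst _ H; rewrite /part En => h5.
      exists rho, pc, v; do 2 (split=> //); split; first lia.
      by split=> //; exists u0 => //; rewrite /part En; apply: loopS.
    rewrite onopE; exists rho, (S pc), v; do 4 (split=> //); exists u; last exact: part_refl.
    by rewrite (firstn_S En); apply/exec_app; exists u0 => //; exists u.
Qed.

Lemma mreach_print W : Wok W -> mreach allrules (0%Z, 0%Z) (gset (cw W)) (ew W).
Proof.
elim: W => [|[k o] W IH] hW /=.
  have -> : gset 0 = zero by apply: functional_extensionality => i; rewrite /gset; updt.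
  exact: mreach0.
have hr : In (LRule (0%Z, 0%Z) (0%Z, 0%Z) (oprint k) o) allrules.
  by apply/allrules_in; left; exists (k, o) => //; apply: hW; left.
have := mreachS hr (IH (fun ko h => hW ko (or_intror h))) Logic.I.
by rewrite [l_op _]/= oprintE.
Qed.

Lemma mreach_exec rho (f : F) : rho < length ps -> forall n pc v w, n + pc = length (nth rho ps []) ->
  mreach allrules (st rho pc) v f -> exec (skipn pc (nth rho ps [])) v w ->
  mreach allrules (0%Z, 1%Z) w f.
Proof.
move=> hrho; set p := nth rho ps [].
have hin r : In r (grules rho p) -> In r allrules.
  by move=> h; apply/allrules_in; do 2 right; exists rho.
elim=> [|n IH] pc v w En hm.
  have Epc : pc = length p by lia.
  rewrite Epc skipn_all /= => ->; rewrite Epc in hm.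
  have hr := hin (LRule (st rho (length p)) (0%Z, 1%Z) onop one) (or_intror (or_introl eq_refl)).
  have := mreachS hr hm Logic.I.
  by rewrite [l_op _]/= onopE [l_out _]/= mul1g.
have [i Ei] : exists i, nth_error p pc = Some i.
  case E : (nth_error p pc) => [i|]; first by exists i.
  by move/nth_error_None: E; lia.
have -> : skipn pc p = i :: skipn (S pc) p.
  elim: (pc) (p) Ei => [|m IHm] [|y q] //=; first by move=> [->].
  by move=> /IHm.
have hi r : In r (irules rho p pc) -> In r allrules.
  move=> h; apply: hin; do 2 right; apply/in_flat_map; exists pc; split=> //; apply/in_seq; lia.
case=> v' h1 h2; apply: (IH (S pc) v') => //; first lia.
move: hi h1; rewrite /irules Ei; case: i {Ei} => o hi /=.
  move=> [hD ->]; have := mreachS (hi _ (or_introl eq_refl)) hm hD.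
  by rewrite [l_out _]/= mul1g.
move=> hl; have hm' : mreach allrules (st rho pc) v' f.
  elim: hl => // v1 _ IH1 hD; have := mreachS (hi _ (or_introl eq_refl)) IH1 hD.
  by rewrite [l_out _]/= mul1g.
have := mreachS (hi _ (or_intror (or_introl eq_refl))) hm' Logic.I.
by rewrite [l_op _]/= onopE [l_out _]/= mul1g.
Qed.

Lemma mreach_main u f : mreach allrules (0%Z, 1%Z) u f <->
  exists W, Wok W /\ f = ew W /\ pstar (gset (2 * cw W + 1)) u.
Proof.
split.
  move=> /mreach_minv [W [hW [Ef H]]]; exists W; do 2 split=> //.
  case: H => [[//]|[[//]|[rho [pc [v [E]]]]]].
  by rewrite /st in E; case: E; lia.
move=> [W [hW [-> ]]].
have h0 : mreach allrules (0%Z, 1%Z) (gset (2 * cw W + 1)) (ew W).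
  have hr : In (LRule (0%Z, 0%Z) (0%Z, 1%Z) (oprint 0) one) allrules by apply/allrules_in; right; left.
  have := mreachS hr (mreach_print hW) Logic.I.
  rewrite [l_op _]/= oprintE [l_out _]/= mul1g [l_c' _]/=.
  by have -> : (2 ^ Z.of_nat 0 * (2 * cw W + 1) = 2 * cw W + 1)%Z by lia.
elim=> // p v v' _ IH hp he.
have [rho [hrho Ep]] := In_nth ps p [] hp; subst p.
apply: (@mreach_exec rho (ew W) hrho (length (nth rho ps [])) 0 v) => //; last first.
have hr : In (LRule (0%Z, 1%Z) (st rho 0) onop one) allrules.
  by apply/allrules_in; do 2 right; exists rho; split=> //; left.
have := mreachS hr IH Logic.I.
by rewrite [l_op _]/= onopE [l_out _]/= mul1g.
Qed.
End Programs.

#[local] Arguments Z.mul : simpl never.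
#[local] Arguments Z.add : simpl never.
#[local] Arguments Z.pow : simpl never.
#[local] Arguments Z.of_nat : simpl never.

(** * Binary trees, coded bijectively by natural numbers *)

Inductive tree := TL | TN (a b : tree).

(** Every positive integer is uniquely [2^x (2y + 1)], whence a bijection with the naturals. Since
    doubling is affine, the node relation can be tested by a simple loop. *)
Fixpoint tz (t : tree) : Z :=
  match t with TL => 0 | TN a b => 2 ^ tz a * (2 * tz b + 1) end%Z.

Lemma tz_ge0 t : (0 <= tz t)%Z.
Proof.
elim: t => [|a ha b hb] //=.
by have := Z.pow_pos_nonneg 2 (tz a) ltac:(lia) ha; nia.
Qed.
Arguments tz_ge0 : clear implicits.

Lemma node_inj (x x' : nat) (y y' : Z) : (0 <= y)%Z -> (0 <= y')%Z ->
  (2 ^ Z.of_nat x * (2 * y + 1) = 2 ^ Z.of_nat x' * (2 * y' + 1))%Z -> x = x' /\ y = y'.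
Proof.
have pS n : (2 ^ Z.of_nat (S n) = 2 * 2 ^ Z.of_nat n)%Z by rewrite Nat2Z.inj_succ Z.pow_succ_r; lia.
have p0 : (2 ^ Z.of_nat 0 = 1)%Z by [].
move=> hy hy'; elim: x x' => [|x IH] [|x']; rewrite ?pS ?p0 -?Z.mul_assoc.
- by split=> //; lia.
- by move: (2 ^ _ * _)%Z; lia.
- by move: (2 ^ Z.of_nat x * _)%Z; lia.
- by move=> h; have [|-> ->] := IH x'; lia.
Qed.

Lemma tz_inj t t' : tz t = tz t' -> t = t'.
Proof.
have pos x : (0 < 2 ^ tz x)%Z by apply: Z.pow_pos_nonneg; [lia | apply: tz_ge0].
elim: t t' => [|a ha b hb] [|a' b'] //=.
- by have := pos a'; have := tz_ge0 b'; nia.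
- by have := pos a; have := tz_ge0 b; nia.
- have ga := tz_ge0 a; have ga' := tz_ge0 a'.
rewrite -{1}(Z2Nat.id (tz a)) // -{1}(Z2Nat.id (tz a')) // => /node_inj [||E1 /hb ->]; try exact: tz_ge0.
by rewrite (ha a') //; lia.
Qed.

Lemma node_split z : (0 < z)%Z -> exists x y, (0 <= x < z)%Z /\ (0 <= y < z)%Z /\
  z = (2 ^ x * (2 * y + 1))%Z.
Proof.
have [n hn] : exists n, (z <= Z.of_nat n)%Z by exists (Z.to_nat z); lia.
elim: n z hn => [|n IH] z hn hz; first lia.
have [y [E|E]] : exists y, (z = 2 * y \/ z = 2 * y + 1)%Z.
- exists (z / 2)%Z; have := Z.div_mod z 2; have := Z.mod_pos_bound z 2; lia.
- have [||x [y' [hx [hy E']]]] := IH y; try lia.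
  by exists (x + 1)%Z, y'; rewrite Z.add_1_r Z.pow_succ_r; lia.
- by exists 0%Z, y; rewrite Z.pow_0_r; lia.
Qed.

Lemma tz_surj z : (0 <= z)%Z -> exists t, tz t = z.
Proof.
have [n hn] : exists n, (z <= Z.of_nat n)%Z by exists (Z.to_nat z); lia.
elim: n z hn => [|n IH] z hn hz; first by exists TL => /=; lia.
have [E|h] := Z.eq_dec z 0; first by exists TL.
have [|x [y [hx [hy E]]]] := node_split (z := z); first lia.
have [||a Ea] := IH x; try lia.
have [||b Eb] := IH y; try lia.
by exists (TN a b); rewrite /= Ea Eb.
Qed.

(** * Root rewriting of trees by register programs *)

(** A rewrite rule with all subterms named by registers: [fleaf] and [fnode] are the constraints on
    them, [fa] names the tree to be rewritten and [fb] the result. *)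
Record frule := FRule { fm : nat; fleaf : list nat; fnode : list (nat * nat * nat); fa : nat; fb : nat }.

Definition fok (r : frule) M := fm r <= S M /\ fa r < fm r /\ fb r < fm r /\
  (forall i, In i (fleaf r) -> i < fm r) /\
  (forall i x y, In (i, x, y) (fnode r) -> i < fm r /\ x < fm r /\ y < fm r).

Section TreeProg.
Variable M : nat.
Definition KK := 4 + M.
(** Truncation makes every index legal unconditionally; it is the identity on the registers of a
    rule satisfying [fok]. *)
Definition reg i := 3 + Nat.min i M.

Lemma reg_bd i : 3 <= reg i < KK.
Proof. by rewrite /reg /KK; lia. Qed.

Lemma reg_lt i : reg i < KK.
Proof. by rewrite /reg /KK; lia. Qed.

Lemma KK3 : 3 <= KK. Proof. by rewrite /KK; lia. Qed.

Lemma supp1 i x : i < KK -> supp KK (upd zero i x).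
Proof. by move=> h j hj; updt. Qed.

Definition oadd i (x : Z) : op KK := odiag (supp1 x (reg_lt i)) (fun i => Z.neq_succ_diag_l 0).

Definition odbl : op KK.
Proof.
refine (@odiag KK (upd (fun _ => 1%Z) 2 2%Z) (upd zero 1 (-1)%Z) (supp1 _ _) _).
- by rewrite /KK; lia.
- by move=> i; updt.
Defined.

Lemma oaddE i x u : op_U (oadd i x) u = upd u (reg i) (u (reg i) + x)%Z.
Proof.
apply: functional_extensionality => j; change ((1 * u j + upd zero (reg i) x j)%Z = upd u (reg i) (u (reg i) + x)%Z j).
rewrite /upd; case: (Nat.eqb_spec j (reg i)) => [->|_]; unfold zero; lia.
Qed.

Lemma odblE u : op_U odbl u = upd (upd u 1 (u 1%nat - 1)%Z) 2 (2 * u 2%nat)%Z.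
Proof.
apply: functional_extensionality => j.
change ((upd (fun _ => 1%Z) 2 2%Z j * u j + upd zero 1 (-1)%Z j)%Z =
  upd (upd u 1 (u 1%nat - 1)%Z) 2 (2 * u 2%nat)%Z j).
updt.
Qed.

(** From [a = r_x] and [b = 2 r_y + 1], each turn decrements [a] and doubles [b]; the final test
    [a = 0] forces exactly [r_x] turns. *)
Definition pnode (t : nat * nat * nat) : list (instr KK) :=
  [Atom (oinit KK3 (reg_bd (snd (fst t))) (reg_bd (snd t))); Loop odbl;
   Atom (ofin KK3 (reg_bd (fst (fst t))))].
Definition pclear i : list (instr KK) := [Loop (oadd i (-1)%Z); Atom (ochk (reg_lt i))].

(** Guess all registers, test the constraints, replace input by output, erase the guesses. Erasing
    is done by counting down to 0, because setting a register to 0 is not injective. *)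
Definition prog (r : frule) : list (instr KK) :=
  map (fun i => Loop (oadd i 1%Z)) (seq 0 (fm r)) ++
  map (fun i => Atom (ochk (reg_lt i))) (fleaf r) ++
  flat_map pnode (fnode r) ++
  Atom (oswap (reg_bd (fa r)) (reg_bd (fb r))) ::
  flat_map pclear (seq 0 (fm r)).

Definition rs (n : Z) (rho : nat -> Z) (k : nat) : nat -> Z := fun j =>
  match j with 0 => n | 1 | 2 => 0%Z | S (S (S i)) => if Nat.ltb i k then rho i else 0%Z end.

Lemma rs_reg n rho k i : k <= S M -> i < k -> rs n rho k (reg i) = rho i.
Proof.
move=> h hi; rewrite /reg /=; have -> : Nat.min i M = i by lia.
by case: Nat.ltb_spec => //; lia.
Qed.

Lemma rs_out n rho k : k <= M -> rs n rho k (reg k) = 0%Z.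
Proof.
move=> h; have -> : reg k = 3 + k by rewrite /reg; lia.
by rewrite /=; case: Nat.ltb_spec => //; lia.
Qed.

Lemma rs_upd n rho k x : k <= M -> upd (rs n rho k) (reg k) x = rs n (upd rho k x) (S k).
Proof.
move=> h; apply: functional_extensionality => j; rewrite /upd /reg.
have -> : Nat.min k M = k by lia.
case: (Nat.eqb_spec j (3 + k)) => [->|hj] /=.
  by case: Nat.ltb_spec; [rewrite Nat.eqb_refl | lia].
case: j hj => [|[|[|j]]] //= hj; case: Nat.ltb_spec => h1; case: Nat.ltb_spec => h2 //; try lia.
  by case: Nat.eqb_spec => //; lia.
Qed.

Lemma updupd u i x y : upd (upd u i x) i y = upd u i y.
Proof. by apply: functional_extensionality => j; rewrite /upd; case: Nat.eqb. Qed.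

Lemma updid u i : upd u i (u i) = u.
Proof. by apply: functional_extensionality => j; rewrite /upd; case: Nat.eqb_spec => // ->. Qed.

Lemma upd_same u i x : upd u i x i = x.
Proof. by rewrite /upd Nat.eqb_refl. Qed.

Lemma loop_add i x u u' : loop (oadd i x) u u' <->
  exists k : nat, u' = upd u (reg i) (u (reg i) + Z.of_nat k * x)%Z.
Proof.
split.
  elim=> [|v _ [k ->] _]; first by exists 0; rewrite /= Z.add_0_r updid.
  by exists (S k); rewrite oaddE updupd upd_same; f_equal; lia.
move=> [k ->]; elim: k => [|k IH]; first by rewrite /= Z.add_0_r updid; apply: loop0.
have := loopS IH Logic.I; rewrite oaddE updupd upd_same.
by have -> : (u (reg i) + Z.of_nat k * x + x = u (reg i) + Z.of_nat (S k) * x)%Z by lia.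
Qed.

Lemma loop_dbl u u' : loop odbl u u' <->
  exists k : nat, u' = upd (upd u 1 (u 1%nat - Z.of_nat k)%Z) 2 (2 ^ Z.of_nat k * u 2%nat)%Z.
Proof.
have S1 k : upd (upd (upd (upd u 1 (u 1%nat - Z.of_nat k)%Z) 2 (2 ^ Z.of_nat k * u 2%nat)%Z) 1
    (u 1%nat - Z.of_nat k - 1)%Z) 2 (2 * (2 ^ Z.of_nat k * u 2%nat))%Z =
  upd (upd u 1 (u 1%nat - Z.of_nat (S k))%Z) 2 (2 ^ Z.of_nat (S k) * u 2%nat)%Z.
  apply: functional_extensionality => j; rewrite Nat2Z.inj_succ Z.pow_succ_r; last lia.
  updt.
have Z1 : u = upd (upd u 1 (u 1%nat - Z.of_nat 0)%Z) 2 (2 ^ Z.of_nat 0 * u 2%nat)%Z.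
  apply: functional_extensionality => j; rewrite [(2 ^ _)%Z]/=; updt.
have D1 k : op_U odbl (upd (upd u 1 (u 1%nat - Z.of_nat k)%Z) 2 (2 ^ Z.of_nat k * u 2%nat)%Z) =
  upd (upd u 1 (u 1%nat - Z.of_nat (S k))%Z) 2 (2 ^ Z.of_nat (S k) * u 2%nat)%Z by rewrite odblE -S1.
split.
  elim=> [|v _ [k ->] _]; first by exists 0.
  by exists (S k); rewrite D1.
move=> [k ->]; elim: k => [|k IH]; first by rewrite -Z1; apply: loop0.
by rewrite -D1; apply: loopS.
Qed.

Lemma exec_guess n k u : k <= S M -> (exec (map (fun i => Loop (oadd i 1%Z)) (seq 0 k)) (gset n) u <->
  exists2 rho, (forall i, 0 <= rho i)%Z & u = rs n rho k).
Proof.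
elim: k u => [|k IH] u hk.
  have E rho : rs n rho 0 = gset n.
    by apply: functional_extensionality => -[|[|[|j]]].
  split=> [->|[rho _ ->]]; last by rewrite E.
  by exists zero => [i|]; [unfold zero; lia | rewrite E].
rewrite seq_S map_app exec_app /=; split.
  move=> [v /IH [|rho h0 Ev]]; first lia.
  move=> [v' /loop_add [m Ev'] ->]; rewrite Ev' Ev.
  have E0 : rs n rho k (reg k) = 0%Z.
    by apply: rs_out; lia.
  exists (upd rho k (Z.of_nat m)); first by move=> i; rewrite /upd; case: Nat.eqb => //; lia.
  by rewrite E0 rs_upd; [do 2 f_equal; lia | lia].
move=> [rho h0 ->]; exists (rs n rho k); first by apply/IH; [lia | exists rho].
exists (rs n rho (S k)) => //; apply/loop_add; exists (Z.to_nat (rho k)).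
have E0 : rs n rho k (reg k) = 0%Z.
  by apply: rs_out; lia.
rewrite E0 rs_upd; last lia.
have -> : (0 + Z.of_nat (Z.to_nat (rho k)) * 1 = rho k)%Z by have := h0 k; lia.
by rewrite updid.
Qed.

Lemma exec_leafs l u u' : exec (map (fun i => Atom (ochk (reg_lt i))) l) u u' <->
  u' = u /\ forall i, In i l -> u (reg i) = 0%Z.
Proof.
elim: l u u' => [|i l IH] u u' /=; first by split=> [|[]].
split=> [[v [h ->] h1]|[-> h]].
  have [-> h'] := proj1 (IH u u') h1.
  by split=> // j [<-|/h'].
by exists u; [split=> //; apply: h; left | apply/IH; split=> // j hj; apply: h; right].
Qed.

Lemma exec_node i x y u u' : u 1 = 0%Z -> u 2 = 0%Z -> (0 <= u (reg x))%Z ->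
  (exec (pnode (i, x, y)) u u' <-> u' = u /\ u (reg i) = 2 ^ u (reg x) * (2 * u (reg y) + 1))%Z.
Proof.
move=> h1 h2 hx; have ri := reg_bd i; split.
  move=> [v1 [/= _ ->]] [v2 /loop_dbl [k ->]] [v3 [[]]].
  rewrite /upd /= => E1 E2 -> ->; have Ek : Z.of_nat k = u (reg x) by lia.
  rewrite -Ek; split; last by rewrite -E2.
  apply: functional_extensionality => j.
  by case: (Nat.eqb_spec j 2) => [->|] //; case: (Nat.eqb_spec j 1) => [->|].
move=> [-> E].
set u1 := upd (upd u 1 (u (reg x))) 2 (2 * u (reg y) + 1)%Z.
set u2 := upd (upd u1 1 (u1 1%nat - u (reg x))%Z) 2 (2 ^ u (reg x) * u1 2%nat)%Z.
exists u1 => //; exists u2.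
  by apply/loop_dbl; exists (Z.to_nat (u (reg x))); rewrite Z2Nat.id.
exists u => //=; split.
  by rewrite /u2 /u1 /upd /=; split; [lia | rewrite E].
apply: functional_extensionality => j; rewrite /u2 /u1 /upd.
by case: (Nat.eqb_spec j 2) => [->|] //; case: (Nat.eqb_spec j 1) => [->|].
Qed.

Lemma exec_nodes l u u' : u 1 = 0%Z -> u 2 = 0%Z -> (forall x, 0 <= u (reg x))%Z ->
  (exec (flat_map pnode l) u u' <-> u' = u /\
   forall i x y, In (i, x, y) l -> u (reg i) = 2 ^ u (reg x) * (2 * u (reg y) + 1))%Z.
Proof.
move=> h1 h2 hx; elim: l u' => [|[[i x] y] l IH] u'; first by split=> [->|[->]].
change (flat_map pnode ((i, x, y) :: l)) with (pnode (i, x, y) ++ flat_map pnode l).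
rewrite exec_app; split.
  move=> [v /exec_node [] // -> E /IH [-> h]]; split=> // i' x' y' [[<- <- <-] //|]; exact: h.
move=> [-> h]; exists u; first by apply/exec_node => //; split=> //; apply: h; left.
by apply/IH; split=> // i' x' y' h'; apply: h; right.
Qed.

(** The sign condition appears because counting down reaches 0 only from a nonnegative value. *)
Lemma exec_clear k u u' : k <= S M -> (exec (flat_map pclear (seq 0 k)) u u' <->
  (forall i, i < k -> (0 <= u (reg i))%Z) /\
  u' = fun j => if andb (Nat.leb 3 j) (Nat.ltb j (3 + k)) then 0%Z else u j).
Proof.
elim: k u' => [|k IH] u' hk.
  have E : u = (fun j => if andb (Nat.leb 3 j) (Nat.ltb j (3 + 0)) then 0%Z else u j).
    apply: functional_extensionality => j; case: Nat.leb_spec => //= h; case: Nat.ltb_spec => //; lia.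
  split=> [->|[_ ->]]; last by rewrite /= -E.
  by split=> [i|]; [lia | rewrite -E].
rewrite seq_S flat_map_app exec_app /=.
set w := fun j : nat => if andb (Nat.leb 3 j) (Nat.ltb j (3 + k)) then 0%Z else u j.
have rk : reg k = 3 + k by rewrite /reg; lia.
have wk : w (reg k) = u (reg k) by rewrite /w rk; case: (Nat.ltb_spec (3 + k) (3 + k)); [lia | rewrite Bool.andb_false_r].
have Ew : upd w (reg k) 0%Z = (fun j => if andb (Nat.leb 3 j) (Nat.ltb j (3 + S k)) then 0%Z else u j).
  apply: functional_extensionality => j; rewrite /upd /w rk.
  case: (Nat.eqb_spec j (3 + k)) => [->|hj].
    by case: Nat.leb_spec => h; [case: Nat.ltb_spec => h2 //=; lia | lia].
  case: Nat.leb_spec => //= h; case: Nat.ltb_spec => h1; case: Nat.ltb_spec => h2 //; lia.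
split.
  move=> [v /IH [|hv ->]]; first lia.
  rewrite -/w; move=> [v1 /loop_add [m ->] [v2 [hz ->]]] ->.
  have {}hz : (w (reg k) + Z.of_nat m * -1 = 0)%Z by have := hz; rewrite /= upd_same.
  rewrite wk in hz *; split; last by rewrite -Ew /= hz.
  move=> i hi; case: (Nat.eq_dec i k) => [->|h]; first lia.
  by apply: hv; lia.
move=> [h ->]; exists w; first by apply/IH; [lia | split=> // i hi; apply: h; lia].
exists (upd w (reg k) 0%Z); last by exists (upd w (reg k) 0%Z) => //=; rewrite upd_same.
apply/loop_add; exists (Z.to_nat (u (reg k))); rewrite wk; f_equal.
by have := h k (Nat.lt_succ_diag_r k); lia.
Qed.

Lemma exec_prog r n u : fok r M -> (exec (prog r) (gset n) u <->
  exists rho, (forall i, 0 <= rho i)%Z /\ (forall i, In i (fleaf r) -> rho i = 0%Z) /\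
   (forall i x y, In (i, x, y) (fnode r) -> rho i = 2 ^ rho x * (2 * rho y + 1))%Z /\
   n = rho (fa r) /\ u = gset (rho (fb r))).
Proof.
move=> [hm [ha [hb [hl hn]]]].
have rr rho i : i < fm r -> rs n rho (fm r) (reg i) = rho i by move=> hi; apply: rs_reg.
have rn rho : (forall i, 0 <= rho i)%Z -> forall j, (0 <= rs n rho (fm r) (reg j))%Z.
  by move=> h j; rewrite /reg /=; case: Nat.ltb => //; lia.
have clr rho : (fun j => if andb (Nat.leb 3 j) (Nat.ltb j (3 + fm r)) then 0%Z
    else upd (rs n rho (fm r)) 0 (rho (fb r)) j) = gset (rho (fb r)).
  apply: functional_extensionality => -[|[|[|j]]] //=; rewrite /upd /gset /upd /zero /=.
  by case: (Nat.ltb_spec (S (S (S j))) (3 + fm r)) => //= h; case: Nat.ltb_spec => //; lia.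
have EU rho : op_U (oswap (reg_bd (fa r)) (reg_bd (fb r))) (rs n rho (fm r)) =
    upd (rs n rho (fm r)) 0 (rho (fb r)).
  by change (upd (rs n rho (fm r)) 0 (rs n rho (fm r) (reg (fb r))) = upd (rs n rho (fm r)) 0 (rho (fb r))); rewrite rr.
rewrite /prog !exec_app; split.
  move=> [v /exec_guess [//|rho h0 ->]] /exec_app [v1 /exec_leafs [-> h1]].
  move=> /exec_app [v2 /exec_nodes [//|//| |-> h2]]; first exact: rn.
  move=> [v3 [h3 ->]] /exec_clear [//|_ ->].
  have {}h3 : n = rs n rho (fm r) (reg (fa r)) := h3.
  rewrite (rr _ _ ha) in h3; rewrite EU clr.
  exists rho; split=> //; split; first by move=> i hi; rewrite -(h1 i hi) rr //; apply: hl.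
  split.
    move=> i x y hi; have [? [? ?]] := hn _ _ _ hi.
    by have := h2 _ _ _ hi; rewrite !rr.
  by [].
move=> [rho [h0 [h1 [h2 [h3 ->]]]]].
exists (rs n rho (fm r)); first by apply/exec_guess => //; exists rho.
apply/exec_app; exists (rs n rho (fm r)).
  by apply/exec_leafs; split=> // i hi; rewrite rr; [apply: h1 | apply: hl].
apply/exec_app; exists (rs n rho (fm r)).
  apply/exec_nodes => //; first exact: rn.
  by split=> // i x y hi; have [? [? ?]] := hn _ _ _ hi; rewrite !rr //; apply: h2.
exists (upd (rs n rho (fm r)) 0 (rho (fb r))).
  by split; [change (n = rs n rho (fm r) (reg (fa r))); rewrite rr | rewrite EU].
apply/exec_clear => //; split; last by rewrite clr.
by move=> i hi; change (0 <= rs n rho (fm r) (reg i))%Z; rewrite rr.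
Qed.

Definition tstep (r : frule) (t t' : tree) := exists rho : nat -> tree,
  (forall i, In i (fleaf r) -> rho i = TL) /\
  (forall i x y, In (i, x, y) (fnode r) -> rho i = TN (rho x) (rho y)) /\
  t = rho (fa r) /\ t' = rho (fb r).

Lemma exec_tstep r t u : fok r M -> (exec (prog r) (gset (tz t)) u <->
  exists2 t', tstep r t t' & u = gset (tz t')).
Proof.
move=> h; rewrite exec_prog //; split.
  move=> [rho [h0 [h1 [h2 [h3 h4]]]]].
  have [rt hrt] : exists rt : nat -> tree, forall i, tz (rt i) = rho i.
    exists (fun i => proj1_sig (constructive_indefinite_description _ (tz_surj (h0 i)))) => i.
    by case: constructive_indefinite_description.
  exists (rt (fb r)); last by rewrite hrt.
  exists rt; split; first by move=> i /h1 E; apply: tz_inj; rewrite hrt.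
  split; first by move=> i x y /h2 E; apply: tz_inj; rewrite /= !hrt.
  by split=> //; apply: tz_inj; rewrite hrt.
move=> [t' [rt [h1 [h2 [-> ->]]]] ->]; exists (fun i => tz (rt i)); split; first by move=> i; apply: tz_ge0.
split; first by move=> i /h1 ->.
by split=> // i x y /h2 ->.
Qed.

Variable rl : list frule.
Hypothesis rok : forall r, In r rl -> fok r M.

Inductive tstar t : tree -> Prop :=
| tstar0 : tstar t t
| tstarS r t' t'' : tstar t t' -> In r rl -> tstep r t' t'' -> tstar t t''.

Lemma pstar_tstar t u : pstar (map prog rl) (gset (tz t)) u <->
  exists2 t', tstar t t' & u = gset (tz t').
Proof.
split.
  elim=> [|p v v' _ [t' h ->] /(in_map_iff _ _ _) [r [<- hr]]]; first by exists t; [apply: tstar0|].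
  by move=> /(exec_tstep _ _ (rok hr)) [t'' h' ->]; exists t'' => //; apply: tstarS h hr h'.
move=> [t' h ->]; elim: h => [|r t1 t2 _ IH hr h]; first exact: pstar0.
by apply: pstarS IH (in_map _ _ _ hr) _; apply/exec_tstep; [apply: rok | exists t2].
Qed.
End TreeProg.

(** * Horn clauses over trees *)

Inductive tm := TV (i : nat) | TmL | TmN (a b : tm).

Fixpoint tsub (s : nat -> tree) (t : tm) : tree :=
  match t with TV i => s i | TmL => TL | TmN a b => TN (tsub s a) (tsub s b) end.

Fixpoint tv (t : tm) : nat :=
  match t with TV i => S i | TmL => 0 | TmN a b => Nat.max (tv a) (tv b) end.

Lemma tsub_ext s s' t : (forall i, i < tv t -> s i = s' i) -> tsub s t = tsub s' t.
Proof.
elim: t => [i|//|a ha b hb] /= h; first by apply: h.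
by rewrite ha ?hb // => i hi; apply: h; lia.
Qed.

Record flatr := Flat { fl_k : nat; fl_n : nat; fl_l : list nat; fl_d : list (nat * nat * nat) }.

Fixpoint flat (t : tm) (nx : nat) : flatr :=
  match t with
  | TV i => Flat i nx [] []
  | TmL => Flat nx (S nx) [nx] []
  | TmN a b =>
      let ra := flat a nx in
      let rb := flat b (fl_n ra) in
      Flat (fl_n rb) (S (fl_n rb)) (fl_l ra ++ fl_l rb)
        ((fl_n rb, fl_k ra, fl_k rb) :: fl_d ra ++ fl_d rb)
  end.

Definition sat (rho : nat -> tree) (l : list nat) (d : list (nat * nat * nat)) :=
  (forall i, In i l -> rho i = TL) /\ (forall i x y, In (i, x, y) d -> rho i = TN (rho x) (rho y)).

Definition lbd n (l : list nat) (d : list (nat * nat * nat)) :=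
  (forall i, In i l -> i < n) /\ (forall i x y, In (i, x, y) d -> i < n /\ x < n /\ y < n).

Lemma sat_app rho l l' d d' : sat rho (l ++ l') (d ++ d') <-> sat rho l d /\ sat rho l' d'.
Proof.
rewrite /sat; split.
  by move=> [h1 h2]; split; split=> *; [apply: h1|apply: h2|apply: h1|apply: h2]; apply/in_app_iff; auto.
by move=> [[h1 h2] [h3 h4]]; split=> *; match goal with H : In _ _ |- _ => case/in_app_iff: H end; auto.
Qed.

Lemma lbd_app n l l' d d' : lbd n l d -> lbd n l' d' -> lbd n (l ++ l') (d ++ d').
Proof.
by move=> [h1 h2] [h3 h4]; split=> *; match goal with H : In _ _ |- _ => case/in_app_iff: H end; auto.
Qed.

Lemma lbd_mono n n' l d : n <= n' -> lbd n l d -> lbd n' l d.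
Proof. by move=> h [h1 h2]; split=> [i /h1|i x y /h2]; lia. Qed.

Lemma sat_ext rho rho' n l d : lbd n l d -> (forall i, i < n -> rho i = rho' i) ->
  sat rho l d -> sat rho' l d.
Proof.
move=> [b1 b2] E [h1 h2]; split.
  by move=> i hi; rewrite -E; [apply: h1 | apply: b1].
by move=> i x y hi; have [? [? ?]] := b2 _ _ _ hi; rewrite -!E //; apply: h2.
Qed.

Lemma flat_sound rho t nx : sat rho (fl_l (flat t nx)) (fl_d (flat t nx)) ->
  rho (fl_k (flat t nx)) = tsub rho t.
Proof.
elim: t nx => [//|nx|a ha b hb nx] /=; first by case=> h _; apply: h; left.
move=> [h1 h2]; have [sa sb] : sat rho (fl_l (flat a nx)) (fl_d (flat a nx)) /\
    sat rho (fl_l (flat b (fl_n (flat a nx)))) (fl_d (flat b (fl_n (flat a nx)))).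
  by apply/sat_app; split=> // i x y hi; apply: h2; right.
by rewrite -(ha _ sa) -(hb _ sb); apply: h2; left.
Qed.

Lemma flat_bd t nx : tv t <= nx -> nx <= fl_n (flat t nx) /\
  (fl_k (flat t nx) < fl_n (flat t nx)) /\ lbd (fl_n (flat t nx)) (fl_l (flat t nx)) (fl_d (flat t nx)).
Proof.
elim: t nx => [i|nx _|a ha b hb nx] /=; first by move=> nx h; split=> //; split=> //.
  by split; first lia; split; [lia | split=> // i [<-|[]]; lia].
move=> h; have [|a1 [a2 a3]] := ha nx; first lia.
have [|b1 [b2 b3]] := hb (fl_n (flat a nx)); first lia.
split; first lia; split; first lia.
have [c1 c2] := lbd_app (lbd_mono b1 a3) b3.
split; first by move=> i /c1; lia.
by move=> i x y [[<- <- <-]|/c2]; lia.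
Qed.

Lemma flat_complete t nx rho : tv t <= nx -> exists rho', (forall i, i < nx -> rho' i = rho i) /\
  sat rho' (fl_l (flat t nx)) (fl_d (flat t nx)) /\ rho' (fl_k (flat t nx)) = tsub rho t.
Proof.
elim: t nx rho => [i|nx rho _|a ha b hb nx rho] /=.
- by move=> nx rho h; exists rho.
- exists (fun i => if Nat.eqb i nx then TL else rho i); split.
    by move=> i hi; case: Nat.eqb_spec => // E; lia.
  by rewrite Nat.eqb_refl; split=> //; split=> // i [<-|[]]; rewrite Nat.eqb_refl.
- move=> h.
have [|a1 [a2 a3]] := @flat_bd a nx; first lia.
have [|b1 [b2 b3]] := @flat_bd b (fl_n (flat a nx)); first lia.
have [|r1 [e1 [s1 k1]]] := ha nx rho; first lia.
have [|r2 [e2 [s2 k2]]] := hb (fl_n (flat a nx)) r1; first lia.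
set n := fl_n (flat b _) in b1 b2 b3 *.
pose r3 := fun i => if Nat.eqb i n then TN (tsub rho a) (tsub rho b) else r2 i.
have e3 i : i < n -> r3 i = r2 i by move=> hi; rewrite /r3; case: Nat.eqb_spec => // E; lia.
have kb : tsub r1 b = tsub rho b by apply: tsub_ext => i hi; apply: e1; lia.
exists r3; split; first by move=> i hi; rewrite e3 ?e2 ?e1 //; lia.
have rn : r3 n = TN (tsub rho a) (tsub rho b) by rewrite /r3 Nat.eqb_refl.
split=> //.
have [s31 s32] : sat r3 (fl_l (flat a nx) ++ fl_l (flat b (fl_n (flat a nx))))
    (fl_d (flat a nx) ++ fl_d (flat b (fl_n (flat a nx)))).
  apply/sat_app; split.
    by apply: (sat_ext a3 _ s1) => i hi; rewrite e3 ?e2 //; lia.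
  by apply: (sat_ext b3 _ s2) => i hi; rewrite e3.
split=> // i x y [[<- <- <-]|/s32 //].
by rewrite rn; rewrite e3 ?e2 ?k1 //; [rewrite e3 // k2 kb | lia].
Qed.

Definition trule (l r : tm) : frule :=
  let nv := Nat.max (tv l) (tv r) in
  let fl := flat l nv in
  let fr := flat r (fl_n fl) in
  FRule (fl_n fr) (fl_l fl ++ fl_l fr) (fl_d fl ++ fl_d fr) (fl_k fl) (fl_k fr).

Lemma trule_ok l r M : fm (trule l r) <= S M -> fok (trule l r) M.
Proof.
move=> h; rewrite /fok /=; set nv := Nat.max _ _.
have [|a1 [a2 a3]] := @flat_bd l nv; first lia.
have [|b1 [b2 b3]] := @flat_bd r (fl_n (flat l nv)); first lia.
have [c1 c2] := lbd_app (lbd_mono b1 a3) b3.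
by do !split=> //; try lia; move=> *; case: (c2 _ _ _ H) => ? [].
Qed.

Lemma tstep_trule l r t t' : tstep (trule l r) t t' <-> exists s, t = tsub s l /\ t' = tsub s r.
Proof.
rewrite /tstep /=; set nv := Nat.max _ _; split.
  move=> [rho [h1 [h2 [-> ->]]]].
  have [s1 s2] : sat rho (fl_l (flat l nv)) (fl_d (flat l nv)) /\
    sat rho (fl_l (flat r (fl_n (flat l nv)))) (fl_d (flat r (fl_n (flat l nv)))) by apply/sat_app.
  by exists rho; rewrite -(flat_sound s1) -(flat_sound s2).
move=> [s [-> ->]].
have [|a1 [a2 a3]] := @flat_bd l nv; first lia.
have [|r1 [e1 [s1 k1]]] := @flat_complete l nv s; first lia.
have [|r2 [e2 [s2 k2]]] := @flat_complete r (fl_n (flat l nv)) r1; first lia.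
have s1' : sat r2 (fl_l (flat l nv)) (fl_d (flat l nv)).
  by apply: (sat_ext a3 _ s1) => i hi; rewrite e2.
have [h1 h2] := proj2 (sat_app r2 _ _ _ _) (conj s1' s2).
exists r2; split=> //; split=> //; split; first by rewrite e2.
by rewrite k2; apply: tsub_ext => i hi; rewrite e1 //; lia.
Qed.

Definition clause := (tm * list tm)%type.

Inductive prov (cl : list clause) : tree -> Prop :=
| prov_cl c s : In c cl -> (forall b, In b (snd c) -> prov cl (tsub s b)) -> prov cl (tsub s (fst c)).

Section Horn.
Variables (cl : list clause) (IT : tree) (tIT : tm).
Hypothesis hIT : forall s, tsub s tIT = IT.
Hypothesis hcl : forall c, In c cl -> exists a b, fst c = TmN a b.
Hypothesis hcb : forall c t, In c cl -> In t (snd c) -> exists a b, t = TmN a b.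

(** A tree is read as a stack of goals, and a top goal matching the head is replaced by the body.
    The variable [m], beyond all those of the clause, stands for the rest of the stack. *)
Definition crule (c : clause) : frule :=
  let m := fold_right (fun t n => Nat.max (tv t) n) (tv (fst c)) (snd c) in
  trule (TmN (fst c) (TV m)) (fold_right TmN (TV m) (snd c)).

Definition hrules : list frule :=
  trule (TmN TmL (TV 0)) (TmN (TmN tIT (TV 0)) TmL) :: map crule cl.

(** An invariant for reading runs backwards from the empty stack. The last constructor is the
    initial configuration; its top leaf cannot be mistaken for a goal, as heads and bodies of
    clauses are never leaves. *)
Inductive good : tree -> Prop :=
| good0 : good TL
| goodS g r : prov cl g -> good r -> good (TN g r)
| goodI x : prov cl (TN IT x) -> good (TN TL x).

Lemma prov_TL : ~ prov cl TL.
Proof.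
suff H t : prov cl t -> t <> TL by move=> /H.
by case=> c s hc _; have [a [b ->]] := hcl hc.
Qed.

Lemma crule_step c t t' : In c cl -> (tstep (crule c) t t' <-> exists s r,
  t = TN (tsub s (fst c)) r /\ t' = fold_right (fun b => TN (tsub s b)) r (snd c)).
Proof.
move=> hc; rewrite /crule; set m := fold_right _ _ _; rewrite tstep_trule.
have hm : tv (fst c) <= m /\ forall b, In b (snd c) -> tv b <= m.
  rewrite /m; elim: (snd c) => [|b l [IH1 IH2]] /=; first by split.
  by split; [lia | move=> b' [<-|/IH2]; lia].
have hf s l : tsub s (fold_right TmN (TV m) l) = fold_right (fun b => TN (tsub s b)) (s m) l.
  by elim: l => //= b l ->.
split.
  by move=> [s [-> ->]]; exists s, (s m); rewrite hf.
move=> [s [r [-> ->]]]; pose s' := fun i => if Nat.eqb i m then r else s i.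
have Es i : i < m -> s' i = s i by move=> hi; rewrite /s'; case: Nat.eqb_spec => // E; lia.
have Em : s' m = r by rewrite /s' Nat.eqb_refl.
exists s'; rewrite /= Em hf Em; split.
  by f_equal; apply: tsub_ext => i hi; rewrite Es //; lia.
move: (proj2 hm); elim: (snd c) => [|b l IH] //= hb.
rewrite IH; last by move=> b' hb'; apply: hb; right.
by f_equal; apply: tsub_ext => i hi; rewrite Es //; have := hb b (or_introl eq_refl); lia.
Qed.

Lemma good_back t : tstar hrules t TL -> good t.
Proof.
move=> h; have : good TL by apply: good0.
elim: h => [//|r t' t'' _ IH [<-|/(in_map_iff _ _ _) [c [<- hc]]] hs hg]; apply: IH.
  move: hs => /tstep_trule [s [E1 E2]]; move: hg; rewrite E1 E2 /= hIT => hg.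
  by apply: goodI; inversion hg.
move: hs => /(crule_step _ _ hc) [s [r' [-> E2]]].
have : (forall b, In b (snd c) -> prov cl (tsub s b)) /\ good r'.
  have hb b : In b (snd c) -> tsub s b <> TL by move=> /(hcb hc) [a [b' ->]].
  move: hg; rewrite E2; elim: (snd c) hb => [|b l IH] hb //= hg.
  inversion hg as [|g r2 h1 h2|x h1]; subst.
    have [h3 h4] := IH (fun b' h => hb b' (or_intror h)) h2.
    by split=> // b' [<-|/h3].
  by case: (hb b (or_introl eq_refl)).
move=> [h1 h2]; apply: goodS => //; exact: prov_cl.
Qed.

Lemma tstar_trans rl t t' t'' : tstar rl t t' -> tstar rl t' t'' -> tstar rl t t''.
Proof. by move=> h; elim=> // r t1 t2 _ IH hr hs; apply: tstarS IH hr hs. Qed.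

Lemma prov_star g : prov cl g -> forall r, tstar hrules (TN g r) r.
Proof.
elim=> {g} c s hc _ IH r.
have h1 : tstar hrules (TN (tsub s (fst c)) r) (fold_right (fun b => TN (tsub s b)) r (snd c)).
  apply: (tstarS (tstar0 _ _) (r := crule c)); first by right; apply: in_map.
  by apply/crule_step => //; exists s, r.
apply: (tstar_trans h1); elim: (snd c) IH => [|b l IHl] IH /=; first exact: tstar0.
apply: (tstar_trans (IH b (or_introl eq_refl) _)).
by apply: IHl => b' h; apply: IH; right.
Qed.

Lemma hstar x : tstar hrules (TN TL x) TL <-> prov cl (TN IT x).
Proof.
split.
  move=> /good_back h; inversion h as [|g r h1 h2|y h1]; subst => //.
  by case: (prov_TL h1).
move=> h.
have h1 : tstar hrules (TN TL x) (TN (TN IT x) TL).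
  apply: (tstarS (tstar0 _ _) (r := trule (TmN TmL (TV 0)) (TmN (TmN tIT (TV 0)) TmL))); first by left.
  by apply/tstep_trule; exists (fun _ => x); rewrite /= hIT.
exact: tstar_trans h1 (prov_star h _).
Qed.

Definition hM := fold_right (fun r n => Nat.max (fm r) n) 0 hrules.

Lemma hrules_ok r : In r hrules -> fok r hM.
Proof.
have h : forall l r, In r l -> fm r <= fold_right (fun r n => Nat.max (fm r) n) 0 l.
  by elim=> [|r' l IH] r1 //= [<-|/IH h]; apply/Nat.max_le_iff; auto.
move=> hr; have := h _ _ hr; rewrite -/hM => hm.
by case: hr hm => [<-|/(in_map_iff _ _ _) [c [<- _]]] hm; apply: trule_ok; apply: Nat.le_le_succ_r.
Qed.

Fixpoint tword (W : list tree) : tree := match W with [] => TL | t :: W => TN t (tword W) end.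

(* Groups [F / T] with [T] the set of values of the provable words. *)
Lemma horn_kill (N : nat -> Prop) (d : nat) (outs : list (tree * fr (ord d)))
  (T : fr (ord d) -> Prop) (P : group) (pi : fr (ord d) -> P) :
  (forall n, N n -> 0 < n) -> subgroup T ->
  (forall f, T f <-> exists W, (forall o, In o W -> In o outs) /\
     f = fold_right (fun o x => snd o ** x) one W /\ prov cl (TN IT (tword (map fst W)))) ->
  hom pi -> (forall x, exists w, x = pi w) -> (forall w, pi w = one <-> T w) -> tf N P ->
  exists (G : group) (j : P -> G),
    is_fp G /\ tf N G /\ hom j /\ (forall x, j x = one -> x = one).
Proof.
move=> N0 sT hT hpi spi kpi tP.
pose K := KK hM.
have hK : 1 <= K by rewrite /K /KK; lia.
pose outs' := map (fun o => (Z.to_nat (tz (fst o)), snd o)) outs.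
pose ps := map (prog hM) hrules.
pose V := prodg (prodg zg zg) (vec K).
have fV : is_fp V by apply: prod_fp; [apply: prod_fp; apply: zg_fp | apply: vec_fp].
have tV : tf N V by apply: prod_tf; [apply: prod_tf; apply: zg_tf | apply: vec_tf].
pose r0 : lrule K d := LRule (0%Z, 0%Z) (0%Z, 0%Z) (onop K) one.
pose ar := allrules ps outs' hK.
have s0 : supp K zero by [].
have cwE W : cw (map (fun o => (Z.to_nat (tz (fst o)), snd o)) W) = tz (tword (map fst W)) :> Z.
  elim: W => [//|[t f] W IH] /=; rewrite IH Z2Nat.id //; exact: tz_ge0.
have ewE (W : list (tree * fr (ord d))) : ew (map (fun o => (Z.to_nat (tz (fst o)), snd o)) W) =
    fold_right (fun o x => snd o ** x) one W by elim: W => //= o W ->.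
have key W : pstar ps (gset (2 * tz (tword W) + 1)) zero <-> prov cl (TN IT (tword W)).
  have E : (2 * tz (tword W) + 1)%Z = tz (TN TL (tword W)).
    by change (2 * tz (tword W) + 1 = 1 * (2 * tz (tword W) + 1))%Z; lia.
  have E0 t : zero = gset (tz t) -> t = TL.
    by move=> /(f_equal (fun u => u 0)) h; apply: tz_inj; rewrite -[tz t]/(gset (tz t) 0) -h.
  rewrite E (pstar_tstar hrules_ok) -hstar; split; first by (move=> [t' h /E0 E']; rewrite E' in h).
  by move=> h; exists TL => //; apply: functional_extensionality => -[].
have T_reach w : T w <-> reach (mrules (l := ar) r0) (mstart K d) ((((0%Z, 1%Z) : prodg zg zg), vof K zero), w).
  rewrite (reach_cfg _ _ _ _ s0) (mreach_main _ _ hK) hT; split.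
    move=> [W [hW [-> h]]]; exists (map (fun o => (Z.to_nat (tz (fst o)), snd o)) W); split.
      by move=> o /(in_map_iff _ _ _) [o' [<- /hW ho]]; apply/in_map_iff; exists o'.
    by rewrite ewE cwE; split=> //; apply/key.
  move=> [W [hW [-> h]]].
  have [W' [EW hW']] : exists W', W = map (fun o => (Z.to_nat (tz (fst o)), snd o)) W' /\
      forall o, In o W' -> In o outs.
    elim: W hW {h} => [|o W IH] hW; first by exists [].
    have [W' [-> hW']] := IH (fun o h => hW o (or_intror h)).
    have /(in_map_iff _ _ _) [o' [<- ho]] := hW o (or_introl eq_refl).
    by exists (o' :: W'); split=> // o2 [<-|/hW'].
  exists W'; split=> //; rewrite EW ewE; split=> //; apply/key.
  by rewrite EW cwE in h.
exact: (kill_reachable N0 fV tV sT T_reach hpi spi kpi tP).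
Qed.
End Horn.

(** * The Horn program enumerating relators *)

Fixpoint num (n : nat) : tree := match n with 0 => TL | S n => TN TL (num n) end.
(* Natural numbers are read off trees as lengths of spines, so that every tree
   denotes a number. *)
Fixpoint len (t : tree) : nat := match t with TL => 0 | TN _ t => S (len t) end.
Fixpoint spine (t : tree) : list tree := match t with TL => [] | TN a t => a :: spine t end.
Fixpoint tapp (x y : tree) : tree := match x with TL => y | TN a x => TN a (tapp x y) end.
Fixpoint tconst (t : tree) : tm := match t with TL => TmL | TN a b => TmN (tconst a) (tconst b) end.
Definition lens (t : tree) : list nat := map len (spine t).

Lemma tsub_const s t : tsub s (tconst t) = t.
Proof. by elim: t => //= a -> b ->. Qed.

Lemma len_num n : len (num n) = n.
Proof. by elim: n => //= n ->. Qed.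

Lemma len_tapp x y : len (tapp x y) = len x + len y.
Proof. by elim: x => //= a _ x ->. Qed.

Lemma tapp_num m n : tapp (num m) (num n) = num (m + n).
Proof. by elim: m => //= m ->. Qed.

Lemma tapp_tword u v : tapp (tword u) (tword v) = tword (u ++ v).
Proof. by elim: u => //= a u ->. Qed.

Fixpoint enc (p : prf) : tree :=
  match p with
  | PZero => TN (num 0) TL
  | PSucc => TN (num 1) TL
  | PProj i => TN (num 2) (num i)
  | PComp f gs => TN (num 3) (TN (enc f) (tword (map enc gs)))
  | PRec f g => TN (num 4) (TN (enc f) (enc g))
  end.

Definition ltr (l : letter) : tree := TN (num (fst l)) (if snd l then TN TL TL else TL).
Definition tw (u : word) : tree := tword (map ltr u).

Section Program.
Variable cA : prf.

(** The numeral [k] is the predicate symbol: 1 concatenation, 2 lookup in a list, 3 and 4 evaluation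
    of a program and of a list of programs, 5 triangular numbers (for [pair_nat]), 6 codes of words,
    7 the word [d] of a tree with its inverse, 8 translation of words, 9 powers, 10 acceptance. *)
Definition at2 k a b := TmN (tconst (num k)) (TmN a b).
Definition at3 k a b c := TmN (tconst (num k)) (TmN a (TmN b c)).
Notation v0 := (TV 0). Notation v1 := (TV 1). Notation v2 := (TV 2). Notation v3 := (TV 3).
Notation v4 := (TV 4). Notation v5 := (TV 5). Notation v6 := (TV 6). Notation v7 := (TV 7).
Notation v8 := (TV 8). Notation v9 := (TV 9).
Notation App := (at3 1). Notation Nth := (at3 2). Notation Eval := (at3 3).
Notation EvalL := (at3 4). Notation Tri := (at2 5). Notation CW := (at2 6).
Notation Gam := (at3 7). Notation Tr := (at3 8). Notation Pow := (at3 9).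
Definition aInT a := TmN (tconst (num 10)) a.
Notation InT := aInT.
Notation c n := (tconst (num n)).
Definition lt i b := tconst (ltr (i, b)).

Definition letters : list letter := flat_map (fun i => [(i, false); (i, true)]) (seq 0 4).

(* [InT] is closed under inserting and deleting accepted words and under taking
   roots with exponent in [A], and contains the translation of the relators of
   every presentation. *)
Definition basecl : list clause := [
  (App TmL v0 v0, []);
  (App (TmN v0 v1) v2 (TmN v0 v3), [App v1 v2 v3]);
  (Nth v0 TmL TmL, []);
  (Nth TmL (TmN v0 v1) v0, []);
  (Nth (TmN v0 v1) (TmN v2 v3) v4, [Nth v1 v3 v4]);
  (Eval (TmN (c 0) TmL) v0 TmL, []);
  (Eval (TmN (c 1) TmL) TmL (TmN TmL TmL), []);
  (Eval (TmN (c 1) TmL) (TmN v0 v1) (TmN TmL v0), []);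
  (Eval (TmN (c 2) v0) v1 v2, [Nth v0 v1 v2]);
  (Eval (TmN (c 3) (TmN v0 v1)) v2 v3, [EvalL v1 v2 v4; Eval v0 v4 v3]);
  (EvalL TmL v0 TmL, []);
  (EvalL (TmN v0 v1) v2 (TmN v3 v4), [Eval v0 v2 v3; EvalL v1 v2 v4]);
  (Eval (TmN (c 4) (TmN v0 v1)) TmL v2, [Eval v0 TmL v2]);
  (Eval (TmN (c 4) (TmN v0 v1)) (TmN TmL v2) v3, [Eval v0 v2 v3]);
  (Eval (TmN (c 4) (TmN v0 v1)) (TmN (TmN v2 v3) v4) v5,
    [Eval (TmN (c 4) (TmN v0 v1)) (TmN v3 v4) v6; Eval v1 (TmN v3 (TmN v6 v4)) v5]);
  (Tri TmL TmL, []);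
  (Tri (TmN v0 v1) v2, [Tri v1 v3; App (TmN v0 v1) v3 v2]);
  (CW TmL TmL, []);
  (CW (TmN (TmN TmL v0) v1) (TmN TmL v2),
    [CW v1 v3; App v0 v0 v4; App v4 v3 v5; Tri v5 v6; App v6 v3 v2]);
  (CW (TmN (TmN (TmN TmL TmL) v0) v1) (TmN TmL v2),
    [CW v1 v3; App v0 v0 v4; App (TmN TmL v4) v3 v5; Tri v5 v6; App v6 v3 v2]);
  (Gam TmL (TmN (lt 2 false) TmL) (TmN (lt 2 true) TmL), []);
  (Gam (TmN v0 v1) (TmN (lt 3 false) v2) v3,
    [Gam v0 v4 v5; Gam v1 v6 v7; App v4 v6 v2; App v5 (TmN (lt 3 true) TmL) v8; App v7 v8 v3]);
  (Tr v0 TmL TmL, []);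
  (Tr v0 (TmN (TmN TmL v1) v2) (TmN (lt 0 false) v3),
    [Gam (TmN v0 v1) v4 v5; Tr v0 v2 v6; App v5 (TmN (lt 1 false) v4) v7;
     App v5 (TmN (lt 1 true) v4) v8; App v8 v6 v9; App v7 (TmN (lt 0 true) v9) v3]);
  (Tr v0 (TmN (TmN (TmN TmL TmL) v1) v2) v3,
    [Gam (TmN v0 v1) v4 v5; Tr v0 v2 v6; App v5 (TmN (lt 1 false) v4) v7;
     App v5 (TmN (lt 1 true) v4) v8; App v8 (TmN (lt 0 true) v6) v9; App v7 (TmN (lt 0 false) v9) v3]);
  (Pow v0 TmL TmL, []);
  (Pow v0 (TmN v1 v2) v3, [Pow v0 v2 v4; App v0 v4 v3]);
  (InT TmL, []);
  (InT v0, [App v1 v2 v3; InT v3; InT v4; App v4 v2 v5; App v1 v5 v0]);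
  (InT v3, [App v1 v2 v3; App v4 v2 v5; App v1 v5 v0; InT v0; InT v4]);
  (InT v0, [App v1 v1 v2; Eval (tconst (enc cA)) (TmN v2 (TmN v3 TmL)) TmL; Pow v0 v1 v4; InT v4]);
  (InT v0, [App v1 v1 (TmN v5 v2); Eval (tconst (enc cA)) (TmN v2 (TmN v3 TmL)) TmL; Pow v0 v1 v4; InT v4]);
  (InT v0, [Eval v1 (TmN v2 (TmN v3 TmL)) TmL; CW v4 v2; Tr v1 v4 v0])
].

Definition hcl : list clause :=
  basecl ++ map (fun l : letter => (InT (TmN (tconst (ltr l)) (TmN (tconst (ltr (linv l))) TmL)), [])) letters.

Lemma hcl_head cl : In cl hcl -> exists a b, fst cl = TmN a b.
Proof.
rewrite /hcl => h; case/in_app_iff: h => [h|/(in_map_iff _ _ _) [l [<- _]]]; last by do 2 eexists.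
by repeat (case: h => [<-|h]; first by do 2 eexists).
Qed.

Lemma hcl_body cl t : In cl hcl -> In t (snd cl) -> exists a b, t = TmN a b.
Proof.
rewrite /hcl => h; case/in_app_iff: h => [h|/(in_map_iff _ _ _) [l [<- _]] //].
by repeat (case: h => [<- h|h];
  first by repeat (case: h => [<-|h]; first by do 2 eexists)).
Qed.

(** * Completeness: the intended facts are derivable *)

Notation P := (prov hcl).
Definition sg (l : list tree) : nat -> tree := fun i => nth i l TL.

Fixpoint allP (l : list Prop) : Prop := match l with [] => True | p :: l => p /\ allP l end.

Lemma prov_nth k s : k < length basecl ->
  allP (map (fun b => P (tsub s b)) (snd (nth k basecl (TmL, [])))) ->
  P (tsub s (fst (nth k basecl (TmL, [])))).
Proof.
move=> hk h; apply: prov_cl; first by apply/in_app_iff; left; apply: nth_In.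
move: h; elim: (snd _) => [//|b l IH] /= [h1 h2] b' [<- //|hb]; exact: IH.
Qed.

Definition g2 k a b := TN (num k) (TN a b).
Definition g3 k a b c := TN (num k) (TN a (TN b c)).
Definition gT a := TN (num 10) a.

(** [k] is the position of a clause in [basecl], and [l] lists the values of its variables from [v0]
    on. *)
Ltac use k l := apply: (@prov_nth k (sg l)); [rewrite /=; lia | rewrite /= ?tsub_const; do ?split=> //].

Lemma pApp x y : P (g3 1 x y (tapp x y)).
Proof.
elim: x => [|a _ x IH]; first by use 0 [y].
by use 1 [a; x; y; tapp x y].
Qed.

Definition encl (a : list nat) : tree := tword (map num a).

Lemma pNth i a : P (g3 2 (num i) (encl a) (num (nth i a 0))).
Proof.
elim: a i => [|x a IH] [|i].
- by use 2 [TL].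
- by use 2 [num (S i)].
- by use 3 [num x; encl a].
- by use 4 [TL; num i; num x; encl a; num (nth i a 0)]; apply: IH.
Qed.

Section PrfInd.
Variable Q : prf -> Prop.
Hypotheses (h0 : Q PZero) (h1 : Q PSucc) (h2 : forall i, Q (PProj i)).
Hypothesis h3 : forall f gs, Q f -> (forall g, In g gs -> Q g) -> Q (PComp f gs).
Hypothesis h4 : forall f g, Q f -> Q g -> Q (PRec f g).
Fixpoint prf_ind' (p : prf) : Q p :=
  match p with
  | PZero => h0 | PSucc => h1 | PProj i => h2 i
  | PComp f gs => h3 (prf_ind' f)
      ((fix all (gs : list prf) : forall g, In g gs -> Q g :=
          match gs with
          | [] => fun g h => match h with end
          | g0 :: gs => fun g h => match h with
              | or_introl e => match e in _ = g' return Q g' with eq_refl => prf_ind' g0 end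
              | or_intror h => all gs g h end
          end) gs)
  | PRec f g => h4 (prf_ind' f) (prf_ind' g)
  end.
End PrfInd.

Lemma pEval p a : P (g3 3 (enc p) (encl a) (num (prf_eval p a))).
Proof.
elim/prf_ind': p a => [a||i a|f gs IHf IHg a|f g IHf IHg].
- by use 5 [encl a].
- move=> [|x a]; first by use 6 ([] : list tree).
  by use 7 [num x; encl a].
- by use 8 [num i; encl a; num (nth i a 0)]; apply: pNth.
- set vs := map (fun g => prf_eval g a) gs.
  have hl : P (g3 4 (tword (map enc gs)) (encl a) (encl vs)).
    rewrite /vs; elim: gs IHg {vs} => [|g gs IH] hg; first by use 10 [encl a].
    use 11 [enc g; tword (map enc gs); encl a; num (prf_eval g a); encl (map (fun g => prf_eval g a) gs)].
      by apply: hg; left.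
    by apply: IH => g' h; apply: hg; right.
  by use 9 [enc f; tword (map enc gs); encl a; num (prf_eval f vs); encl vs]; apply: IHf.
- have hr n r : P (g3 3 (enc (PRec f g)) (encl (n :: r)) (num (prf_eval (PRec f g) (n :: r)))).
    elim: n => [|n IH]; first by use 13 [enc f; enc g; encl r; num (prf_eval f r)]; apply: IHf.
    use 14 [enc f; enc g; TL; num n; encl r; num (prf_eval (PRec f g) (S n :: r)); num (prf_eval (PRec f g) (n :: r))].
    exact: (IHg (n :: prf_eval (PRec f g) (n :: r) :: r)).
  (* The empty argument list has its own clause, since [hd] then defaults to [0]. *)
  move=> [|n r]; last exact: hr.
  by use 12 [enc f; enc g; num (prf_eval f [])]; apply: (IHf []).
Qed.

Lemma tri_S s : S s * (S s + 1) / 2 = S s + s * (s + 1) / 2.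
Proof.
have -> : S s * (S s + 1) = S s * 2 + s * (s + 1) by lia.
by rewrite Nat.div_add_l.
Qed.

Lemma pAppn m n : P (g3 1 (num m) (num n) (num (m + n))).
Proof. by rewrite -tapp_num; apply: pApp. Qed.

Lemma pTri s : P (g2 5 (num s) (num (s * (s + 1) / 2))).
Proof.
elim: s => [|s IH]; first by use 15 ([] : list tree).
rewrite tri_S; move: (s * (s + 1) / 2) IH => t IH.
use 16 [TL; num s; num (S s + t); num t].
exact: (pAppn (S s) t).
Qed.

(** For words over the generators of a presentation. The sign precedes the index, unlike in [tw],
    which codes words over the four letters. *)
Definition encu (u : word) : tree :=
  tword (map (fun l : letter => TN (if snd l then TN TL TL else TL) (num (fst l))) u).

Lemma pCW u : P (g2 6 (encu u) (num (code_word u))).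
Proof.
elim: u => [|[g b] u IH]; first by use 17 ([] : list tree).
set n := code_word u in IH *.
case: b.
  use 19 [num g; encu u; num (pair_nat (2 * g + 1) n); num n; num (g + g); num (2 * g + 1 + n);
    num ((2 * g + 1 + n) * (2 * g + 1 + n + 1) / 2)]; try exact: pAppn; try exact: pTri.
  by have := pAppn (S (g + g)) n; have -> : S (g + g) + n = 2 * g + 1 + n by lia.
use 18 [num g; encu u; num (pair_nat (2 * g + 0) n); num n; num (g + g); num (2 * g + 0 + n);
    num ((2 * g + 0 + n) * (2 * g + 0 + n + 1) / 2)]; try exact: pAppn; try exact: pTri.
by have := pAppn (g + g) n; have -> : g + g + n = 2 * g + 0 + n by lia.
Qed.

(** Polish notation, with letter 2 for a leaf and letter 3 for a node: a positive, uniquely readable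
    word. *)
Fixpoint gam (x : tree) : tree :=
  match x with
  | TL => TN (ltr (2, false)) TL
  | TN a b => TN (ltr (3, false)) (tapp (gam a) (gam b))
  end.
Fixpoint gami (x : tree) : tree :=
  match x with
  | TL => TN (ltr (2, true)) TL
  | TN a b => tapp (gami b) (tapp (gami a) (TN (ltr (3, true)) TL))
  end.

Lemma pGam x : P (g3 7 x (gam x) (gami x)).
Proof.
elim: x => [|a IHa b IHb]; first by use 20 ([] : list tree).
use 21 [a; b; tapp (gam a) (gam b); gami (TN a b); gam a; gami a; gam b; gami b;
  tapp (gami a) (TN (ltr (3, true)) TL)]; exact: pApp.
Qed.

Definition cj (g : tree) (b : bool) : tree := tapp (gami g) (TN (ltr (1, b)) (gam g)).

(* In the presentation with index [c], the generator [g] becomes the commutator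
   of letter 0 with the conjugate of letter 1 by [gam (TN c (num g))]. *)
Fixpoint trw (c : tree) (u : word) : tree :=
  match u with
  | [] => TL
  | (g, b) :: u =>
      let x := TN c (num g) in
      if b then tapp (cj x false) (TN (ltr (0, false)) (tapp (cj x true) (TN (ltr (0, true)) (trw c u))))
      else TN (ltr (0, false)) (tapp (cj x false) (TN (ltr (0, true)) (tapp (cj x true) (trw c u))))
  end.

Lemma pTr c u : P (g3 8 c (encu u) (trw c u)).
Proof.
elim: u => [|[g b] u IH]; first by use 22 [c].
set x := TN c (num g).
have E b' : P (g3 1 (gami x) (TN (ltr (1, b')) (gam x)) (cj x b')) by apply: pApp.
have Eg := pGam x.
case: b.
  use 24 [c; num g; encu u; trw c ((g, true) :: u); gam x; gami x; trw c u; cj x false; cj x true;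
    tapp (cj x true) (TN (ltr (0, true)) (trw c u))]; try exact: pApp; try exact: E.
use 23 [c; num g; encu u; tapp (cj x false) (TN (ltr (0, true)) (tapp (cj x true) (trw c u)));
  gam x; gami x; trw c u; cj x false; cj x true; tapp (cj x true) (trw c u)]; try exact: pApp; exact: E.
Qed.

Fixpoint tpow (u : tree) n : tree := match n with 0 => TL | S n => tapp u (tpow u n) end.

Lemma pPow u n : P (g3 9 u (num n) (tpow u n)).
Proof.
elim: n => [|n IH]; first by use 25 [u].
by use 26 [u; TL; num n; tpow u (S n); tpow u n]; apply: pApp.
Qed.

Lemma pInT0 : P (gT TL).
Proof. by use 27 ([] : list tree). Qed.

Lemma pInT_ins x y v : P (gT (tapp x y)) -> P (gT v) -> P (gT (tapp x (tapp v y))).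
Proof.
by move=> h1 h2; use 28 [tapp x (tapp v y); x; y; tapp x y; v; tapp v y]; apply: pApp.
Qed.

Lemma pInT_del x y v : P (gT (tapp x (tapp v y))) -> P (gT v) -> P (gT (tapp x y)).
Proof.
by move=> h1 h2; use 29 [tapp x (tapp v y); x; y; tapp x y; v; tapp v y]; apply: pApp.
Qed.

(** [code_Z] takes [p] to [2p] and, for positive [p], [-p] to [2p - 1]. This clause thus handles the
    exponents [p] in [A], and the next one the exponents [-p]. *)
Lemma pInT_even u (p m : nat) : prf_eval cA [p + p; m] = 0 -> P (gT (tpow u p)) -> P (gT u).
Proof.
move=> h1 h2; use 30 [u; num p; num (p + p); num m; tpow u p].
- exact: pAppn.
- by have := pEval cA [p + p; m]; rewrite h1.
- exact: pPow.
Qed.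

Lemma pInT_odd u (p q m : nat) : p + p = S q -> prf_eval cA [q; m] = 0 -> P (gT (tpow u p)) -> P (gT u).
Proof.
move=> hq h1 h2; use 31 [u; num p; num q; num m; tpow u p; TL].
- by have := pAppn p p; rewrite hq.
- by have := pEval cA [q; m]; rewrite h1.
- exact: pPow.
Qed.

Lemma pInT_rel c u (m : nat) : prf_eval c [code_word u; m] = 0 -> P (gT (trw (enc c) u)).
Proof.
move=> h1; use 32 [trw (enc c) u; enc c; num (code_word u); num m; encu u].
- by have := pEval c [code_word u; m]; rewrite h1.
- exact: pCW.
- exact: pTr.
Qed.

Lemma pInT_pair l : In l letters -> P (gT (tw [l; linv l])).
Proof.
move=> hl.
pose c0 : clause := (InT (TmN (tconst (ltr l)) (TmN (tconst (ltr (linv l))) TmL)), []).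
have hc : In c0 hcl by apply/in_app_iff; right; apply: (in_map _ _ _ hl).
have := @prov_cl hcl c0 (fun _ => TL) hc (fun b h => match h with end).
by rewrite /= !tsub_const.
Qed.

(** ** Soundness *)
Section Model.
Variables (E : group) (e : nat -> E).

Definition isL (t : tree) := match t with TL => true | _ => false end.
Definition lev (t : tree) : E := match t with TN i b => evl e (len i, negb (isL b)) | TL => one end.
Fixpoint evT (t : tree) : E := match t with TN a u => lev a ** evT u | TL => one end.
Fixpoint gE (t : tree) : E := match t with TL => e 2 | TN a b => e 3 ** gE a ** gE b end.
Definition xE (x : tree) : E := e 0 ** (inv (gE x) ** e 1 ** gE x) ** inv (e 0) ** (inv (gE x) ** inv (e 1) ** gE x).
Fixpoint trE (c : tree) (u : tree) : E :=
  match u with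
  | TL => one
  | TN (TN b g) u => (if isL b then xE (TN c g) else inv (xE (TN c g))) ** trE c u
  | TN TL u => xE (TN c TL) ** trE c u
  end.
Definition ldec (t : tree) : letter := match t with TN b g => (len g, negb (isL b)) | TL => (0, false) end.
Definition ldecs (u : tree) : word := map ldec (spine u).

Hypothesis A_ok : forall p x m : nat, prf_eval cA [x; m] = 0 -> p + p = x \/ p + p = S x ->
  forall y : E, pow y p = one -> y = one.
Hypothesis R_ok : forall c u n m, (forall p, c = enc p -> prf_eval p [n; m] = 0) ->
  n = code_word (ldecs u) -> trE c u = one.

(** Clauses apply to arbitrary trees, so every tree is read as a number, a list or a word, as
    required. Only for programs is the claim restricted to genuine codes. *)
Definition model (g : tree) : Prop :=
  match g with
  | TL => False
  | TN s a =>
    match len s, a with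
    | 1, TN x (TN y z) => z = tapp x y
    | 2, TN i (TN a v) => len v = nth (len i) (lens a) 0
    | 3, TN c (TN a v) => forall p, c = enc p -> len v = prf_eval p (lens a)
    | 4, TN gs (TN a vs) => forall ps, gs = tword (map enc ps) -> lens vs = map (fun p => prf_eval p (lens a)) ps
    | 5, TN s t => len t = len s * (len s + 1) / 2
    | 6, TN u n => len n = code_word (ldecs u)
    | 7, TN x (TN g g') => evT g = gE x /\ evT g' = inv (gE x)
    | 8, TN c (TN u w) => evT w = trE c u
    | 9, TN u (TN n v) => evT v = pow (evT u) (len n)
    | 10, u => evT u = one
    | _, _ => False
    end
  end.

Lemma evT_app x y : evT (tapp x y) = evT x ** evT y.
Proof. by elim: x => [|a _ x IH] /=; rewrite ?mul1g // IH mulA. Qed.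

Lemma lev_ltr i b : lev (ltr (i, b)) = evl e (i, b).
Proof. by rewrite /lev /= len_num; case: b. Qed.

Lemma evT_pair l : evT (TN (ltr l) (TN (ltr (linv l)) TL)) = one.
Proof. by case: l => i b; rewrite /evT -/(linv (i, b)) [ltr (linv _)]/(ltr (i, negb b)) !lev_ltr mulg1 -[(i, negb b)]/(linv (i, b)) evl_linv mulgV. Qed.

(** Induction on derivations, clause by clause. [A_ok] and [R_ok] serve for the last three base
    clauses, on roots and relators; the others are correct for every choice of the values [e]. *)
Lemma prov_model g : P g -> model g.
Proof.
elim=> {g} cl s hc _ IH.
have {}IH : allP (map (fun b => model (tsub s b)) (snd cl)).
  by elim: (snd cl) IH => //= b l IHl h; split; [apply: h; left | apply: IHl => b' hb; apply: h; right].
move: hc IH; rewrite /hcl => h; case/in_app_iff: h => [h|/(in_map_iff _ _ _) [l [<- _]] _]; last first.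
  change (evT (TN (tsub s (tconst (ltr l))) (TN (tsub s (tconst (ltr (linv l)))) TL)) = one).
  by rewrite !tsub_const; apply: evT_pair.
repeat (case: h => [<-|h]; first (cbn [map allP snd fst tsub]; rewrite ?tsub_const)); last by case: h.
all: cbn -[Nat.div Nat.mul Nat.add enc code_word]; rewrite ?tsub_const; cbn -[Nat.div Nat.mul Nat.add enc code_word].
all: try by [].
- by case=> ->.
- by rewrite /lens; case: (len _).
- by case.
- by move=> _; case.
- by move=> _; case.
- by move=> _; case.
- by case=> [h _]; case=> //= i [e1]; rewrite h e1 len_num.
- case=> h1 [h2 _]; case=> //= f gs [e1 e2].
  by rewrite (h2 f e1) (h1 gs e2).
- by move=> _; case.
- case=> h1 [h2 _]; case=> //= p ps [e1 e2].
  by rewrite /lens /= (h1 p e1) -(h2 ps e2).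
- by case=> h _; case=> //= f g [e1 e2]; rewrite (h f e1).
- by case=> h _; case=> //= f g [e1 e2]; rewrite (h f e1).
- case=> h1 [h2 _]; case=> //= f g [e1 e2].
  rewrite (h2 g e2) /lens /= (h1 (PRec f g)) /= ?e1 ?e2 //.
- by case=> h [-> _]; rewrite tri_S -h /= len_tapp.
- case=> h [h4 [h5 [h6 [h2 _]]]].
  rewrite h2 /ldecs /= -/(ldecs _) len_tapp h6 h5 h4 !len_tapp h /pair_nat -/(ldecs _).
  by have -> : len (s 0) + (len (s 0) + 0) + 0 = len (s 0) + len (s 0) by lia.
- case=> h [h4 [h5 [h6 [h2 _]]]].
  rewrite h2 /ldecs /= -/(ldecs _) len_tapp h6 h5 /= h4 !len_tapp h /pair_nat.
  by have -> : len (s 0) + (len (s 0) + 0) + 1 = S (len (s 0) + len (s 0)) by lia.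
- by rewrite !mulg1; split.
- case=> [[a1 a2] [[b1 b2] [h2 [h8 [h3 _]]]]].
  by rewrite h2 h3 evT_app h8 !evT_app /= a1 a2 b1 b2; split; grp.
- case=> [[a1 a2] [b [h7 [h8 [h9 [h3 _]]]]]].
  by rewrite h3 evT_app h7 evT_app /= h9 evT_app h8 evT_app /= a1 a2 b /xE /=; grp.
- case=> [[a1 a2] [b [h7 [h8 [h9 [h3 _]]]]]].
  by rewrite h3 evT_app h7 evT_app /= h9 evT_app h8 evT_app /= a1 a2 b /xE /=; grp.
- by case=> h [-> _]; rewrite evT_app h.
- case=> h2 [h3 [h4 [h5 [-> _]]]].
  by rewrite evT_app h5 evT_app h4 mul1g -evT_app -h2.
- case=> h2 [h5 [h0 [hi [h4 _]]]].
  by rewrite h2 evT_app -hi h0 evT_app h5 evT_app h4 mul1g.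
- case=> h2 [h3 [h4 [h5 _]]].
  apply: (A_ok (p := len (s 1)) (x := len (s 2)) (m := len (s 3))); last by rewrite -h4.
    by rewrite -(h3 cA).
  by left; rewrite h2 len_tapp.
- case=> h2 [h3 [h4 [h5 _]]].
  apply: (A_ok (p := len (s 1)) (x := len (s 2)) (m := len (s 3))); last by rewrite -h4.
    by rewrite -(h3 cA).
  by right; rewrite -len_tapp -h2.
- case=> h1 [h2 [h3 _]]; rewrite h3; apply: (R_ok (n := len (s 2)) (m := len (s 3))) => //.
  by move=> p hp; rewrite -(h1 p hp).
Qed.
End Model.
End Program.

(** * The group used for soundness *)

(* The lamplighter-like group Z wr Z contains a free monoid of rank two: a
   product of letters records, on its support, the word that was multiplied. *)
Definition lam : group := wr zg zg.
Definition lamx (b : bool) : lam := (1%Z, fun x : Z => if b then if Z.eq_dec x 0 then 1%Z else 0%Z else 0%Z).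
Definition lamw (l : list bool) : lam := fold_right (fun b x => lamx b ** x) one l.

Lemma lamw_fst l : fst (lamw l) = Z.of_nat (length l).
Proof. elim: l => // b l IH; change (1 + fst (lamw l) = Z.of_nat (S (length l)))%Z; lia. Qed.

Lemma lamw_out l x : (x <= - Z.of_nat (length l))%Z -> snd (lamw l) x = 0%Z.
Proof.
elim: l x => // b l IH x; cbn [length]; rewrite Nat2Z.inj_succ => hx.
change (snd (lamx b) (fst (lamw l) + x) + snd (lamw l) x = 0)%Z.
rewrite lamw_fst IH; last by lia.
rewrite /lamx /=; case: b => //; case: Z.eq_dec => // h; lia.
Qed.

Lemma lamw_inj l m : lamw l = lamw m -> l = m.
Proof.
elim: l m => [|a l IH] [|b m] // E; try by have := f_equal fst E; rewrite !lamw_fst.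
have hl : length l = length m by have := f_equal fst E; rewrite !lamw_fst /=; lia.
have Eab : a = b.
  (* At this coordinate only the first letter can contribute: its support is shifted by the length
     of the rest, and [lamw_out] excludes the other letters. *)
  have := f_equal (fun z : lam => snd z (- Z.of_nat (length l))%Z) E.
  change (snd (lamx a) (fst (lamw l) + - Z.of_nat (length l)) + snd (lamw l) (- Z.of_nat (length l)) =
    snd (lamx b) (fst (lamw m) + - Z.of_nat (length l)) + snd (lamw m) (- Z.of_nat (length l)) -> a = b)%Z.
  rewrite !lamw_fst !lamw_out; try lia.
  rewrite -hl Z.add_opp_diag_r /=; by case: a {E}; case: b.
rewrite Eab in E *; f_equal; apply: IH; exact: (@mulgI lam (lamx b) _ _ E).
Qed.

Lemma lamw_app l m : lamw (l ++ m) = lamw l ** lamw m.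
Proof.
elim: l => [|b l IH]; first by rewrite mul1g.
change (lamx b ** lamw (l ++ m) = lamx b ** lamw l ** lamw m); by rewrite IH mulA.
Qed.

Fixpoint ser (t : tree) : list bool :=
  match t with TL => [false] | TN a b => true :: ser a ++ ser b end.

(** Polish notation is a prefix code; the two tails make the induction go through. *)
Lemma ser_inj x y u v : ser x ++ u = ser y ++ v -> x = y /\ u = v.
Proof.
elim: x y u v => [|a IHa b IHb] [|c d] u v //=; first by case.
case; rewrite -!app_assoc => /IHa [-> /IHb [-> ->]] //.
Qed.

Definition gamma (t : tree) : lam := lamw (ser t).

Lemma gamma_inj x y : gamma x = gamma y -> x = y.
Proof. by move=> /lamw_inj E; have [] := @ser_inj x y [] []; rewrite ?app_nil_r. Qed.

Lemma gammaTN a b : gamma (TN a b) = lamx true ** gamma a ** gamma b.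
Proof.
change (lamx true ** lamw (ser a ++ ser b) = lamx true ** gamma a ** gamma b).
by rewrite lamw_app mulA.
Qed.

Lemma gammaTL : gamma TL = lamx false.
Proof. exact: mulg1. Qed.

Lemma lam_tf (N : nat -> Prop) : (forall n, N n -> 0 < n) -> tf N lam.
Proof. by move=> N0; apply: wr_tf; apply: zg_tf. Qed.

Section Delta.
Variables (X : Type) (x0 : X) (P : group).

Definition delta (g : P) : fung X P := fun x => if excluded_middle_informative (x = x0) then g else one.

Lemma delta_hom : hom delta.
Proof.
move=> g h; apply: functional_extensionality => x.
change (delta (g ** h) x = delta g x ** delta h x).
by rewrite /delta; case: excluded_middle_informative => // _; rewrite mul1g.
Qed.

Lemma delta_at g : delta g x0 = g.
Proof. by rewrite /delta; case: excluded_middle_informative. Qed.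

Lemma delta_out g x : x <> x0 -> delta g x = one.
Proof. by rewrite /delta; case: excluded_middle_informative. Qed.
End Delta.

Section Commutator.
Variables (P : group) (x : nat -> P) (c0 : tree).
Notation Q := (wr zg P).
Definition sh : Q := sq (wr_act zg P) 1%Z.
(** A step function: its translate by one differs from it at a single point, so its commutator with
    the shift [sh] is [g] concentrated at [0]. Every element of [P] thereby becomes a commutator
    with one fixed element. *)
Definition ramp (g : P) : Q := sn (wr_act zg P) (fun n : Z => if Z_lt_dec n 0 then one else inv g).
Definition emb0 (g : P) : Q := sn (wr_act zg P) (delta (0%Z : zg) g).

Lemma sh_ramp g : sh ** ramp g ** inv sh ** inv (ramp g) = emb0 g.
Proof.
suff E : sh ** ramp g = emb0 g ** ramp g ** sh by rewrite E; grp.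
rewrite /ramp /emb0 -sn_hom sn_sq; apply: (f_equal (fun f => sh ** sn (wr_act zg P) f)).
apply: functional_extensionality => n.
change ((if Z_lt_dec n 0 then one else inv g) = delta (0%Z : zg) g (1 + n)%Z ** (if Z_lt_dec (1 + n) 0 then one else inv g)).
have D k : k <> 0%Z -> delta (0%Z : zg) g k = one by exact: delta_out.
case: (Z_lt_dec n 0) => h; case: (Z_lt_dec (1 + n) 0) => h'.
- by rewrite D ?mul1g //; lia.
- have -> : (1 + n)%Z = 0%Z by lia.
  by rewrite (@delta_at zg 0%Z) mulgV.
- by lia.
- by rewrite D ?mul1g //; lia.
Qed.

Notation E := (wr lam Q).
(** A single function stores all generators of the presentation [c0], at coordinates kept apart by
    [gamma_inj]. Trees of equal [len] denote the same generator. *)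
Definition dlam : fung lam Q := fun y =>
  match excluded_middle_informative (exists t, y = gamma (TN c0 t)) with
  | left h => ramp (x (len (proj1_sig (constructive_indefinite_description _ h))))
  | right _ => one
  end.

Lemma dlam_in t : dlam (gamma (TN c0 t)) = ramp (x (len t)).
Proof.
rewrite /dlam; case: excluded_middle_informative => [h|[]]; last by exists t.
case: constructive_indefinite_description => t' ht.
by change (ramp (x (len t')) = ramp (x (len t))); case: (gamma_inj ht) => ->.
Qed.

Lemma dlam_out c t : c <> c0 -> dlam (gamma (TN c t)) = one.
Proof.
move=> hc; rewrite /dlam; case: excluded_middle_informative => // h.
by exfalso; case: h => t' /gamma_inj [].
Qed.

Notation snE := (sn (wr_act lam Q)).
Notation sqE := (sq (wr_act lam Q)).
(* Conjugation by [gamma (TN c0 t)] brings the value [ramp (x (len t))] of letter 1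
   to the coordinate [one], the only one where letter 0 is not trivial, and the
   commutator of [sh] with that value is supported at [0]. *)
Definition eE (i : nat) : E :=
  match i with
  | 0 => snE (delta (one : lam) sh)
  | 1 => snE dlam
  | 2 => sqE (lamx false)
  | _ => sqE (lamx true)
  end.
Definition emb (g : P) : E := snE (delta (one : lam) (emb0 g)).

Lemma emb_hom : hom emb.
Proof. by move=> g h; rewrite /emb /emb0 !(delta_hom, sn_hom). Qed.

Lemma emb_inj g : emb g = one -> g = one.
Proof.
move=> h; have := f_equal (fun z : E => snd (snd z (one : lam)) 0%Z) h.
change (snd (delta (one : lam) (emb0 g) one) 0%Z = one -> g = one).
rewrite delta_at; change (delta (0%Z : zg) g 0%Z = one -> g = one).
by rewrite delta_at.
Qed.

Lemma gE_gamma t : gE eE t = sqE (gamma t).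
Proof.
elim: t => [|a IHa b IHb]; first by rewrite gammaTL.
by rewrite gammaTN !sq_hom -IHa -IHb.
Qed.

Lemma xE_comm (b : lam) :
  snE (delta (one : lam) sh) ** (inv (sqE b) ** snE dlam ** sqE b) ** inv (snE (delta (one : lam) sh)) **
  (inv (sqE b) ** inv (snE dlam) ** sqE b) =
  snE (delta (one : lam) (sh ** dlam b ** inv sh ** inv (dlam b))).
Proof.
have -> : inv (sqE b) ** inv (snE dlam) ** sqE b = inv (inv (sqE b) ** snE dlam ** sqE b) by grp.
have -> : inv (sqE b) ** snE dlam ** sqE b = snE (fun y => dlam (b ** y)).
  by rewrite mulAr sn_sq mulKVg.
rewrite -!(homV _ (sn_hom _)) -!sn_hom; apply: (f_equal snE).
apply: functional_extensionality => y.
change (delta (one : lam) sh y ** dlam (b ** y) ** inv (delta (one : lam) sh y) ** inv (dlam (b ** y)) =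
  delta (one : lam) (sh ** dlam b ** inv sh ** inv (dlam b)) y).
case: (classic (y = one)) => [->|hy]; first by rewrite !delta_at !mulg1.
by rewrite !delta_out //; grp.
Qed.

Lemma xE_in t : xE eE (TN c0 t) = emb (x (len t)).
Proof. by rewrite /xE gE_gamma xE_comm dlam_in sh_ramp. Qed.

Lemma xE_out c t : c <> c0 -> xE eE (TN c t) = one.
Proof.
move=> hc; rewrite /xE gE_gamma xE_comm dlam_out //.
have -> : sh ** one ** inv sh ** inv one = one by grp.
by rewrite (hom1 (@delta_hom _ _ _)) (hom1 (sn_hom _)).
Qed.

Lemma trE_in u : trE eE c0 u = emb (eval x (ldecs u)).
Proof.
have hV g : inv (emb g) = emb (inv g) by rewrite (homV _ emb_hom).
elim: u => [|[|b g] _ u IH]; first by rewrite (hom1 emb_hom).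
  change (xE eE (TN c0 TL) ** trE eE c0 u = emb (x 0 ** eval x (ldecs u))).
  by rewrite IH xE_in emb_hom.
change ((if isL b then xE eE (TN c0 g) else inv (xE eE (TN c0 g))) ** trE eE c0 u =
  emb (evl x (len g, negb (isL b)) ** eval x (ldecs u))).
by rewrite IH xE_in emb_hom; case: (isL b); rewrite ?hV.
Qed.

Lemma trE_out c u : c <> c0 -> trE eE c u = one.
Proof.
move=> hc; elim: u => [|[|b g] _ u IH] //.
  by change (xE eE (TN c TL) ** trE eE c u = one); rewrite IH xE_out // mul1g.
change ((if isL b then xE eE (TN c g) else inv (xE eE (TN c g))) ** trE eE c u = one).
by rewrite IH xE_out // mulg1; case: (isL b); rewrite ?inv1g.
Qed.

Lemma eE_tf (N : nat -> Prop) : (forall n, N n -> 0 < n) -> tf N P -> tf N E.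
Proof. by move=> N0 tP; apply: wr_tf; [apply: lam_tf | apply: wr_tf => //; apply: zg_tf]. Qed.
End Commutator.

(** * Torsion-freeness of presentations *)

Definition tN (A : Z -> Prop) (n : nat) : Prop := 0 < n /\ (A (Z.of_nat n) \/ A (- Z.of_nat n)%Z).

Lemma pcls_wpow R (u : word) z : (pcls (wpow u z) : pres R) = one <-> pow (pcls u : pres R) (Z.abs_nat z) = one.
Proof.
rewrite /wpow; case: Z.leb_spec => hz; rewrite pcls_pow.
  by have -> : Z.to_nat z = Z.abs_nat z by lia.
have -> : Z.to_nat (- z) = Z.abs_nat z by lia.
rewrite pclsV powV; split=> [h|->]; last by rewrite inv1g.
by rewrite -(invgK (pow _ _)) h inv1g.
Qed.

Lemma torsion_freeP (A : Z -> Prop) X R : ~ A 0%Z ->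
  torsion_free A X R <->
  forall n, tN A n -> forall w, word_over X w -> pow (pcls w : pres R) n = one -> (pcls w : pres R) = one.
Proof.
move=> A0; split=> [h n [n0 hn] w hw E|h w hw hw1 z Az Ez].
  apply/pcls_eq; apply: NNPP => hw1.
  case: hn => hn; apply: (h w hw hw1 _ hn); apply/pcls_eq; apply/pcls_wpow; rewrite -E; f_equal; lia.
apply: hw1; apply/pcls_eq; apply: (h (Z.abs_nat z)) => //; last by apply/pcls_wpow; apply/pcls_eq.
case: z Az {Ez} => [//|p|p] Az; split; try lia; [left|right].
  by have -> : Z.of_nat (Z.abs_nat (Zpos p)) = Zpos p by lia.
by have -> : (- Z.of_nat (Z.abs_nat (Zneg p)))%Z = Zneg p by lia.
Qed.

Lemma torsion_free_fp (A : Z -> Prop) G n e rels : ~ A 0%Z -> @fp G n e rels -> tf (tN A) G ->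
  torsion_free A (fun i => i < n) (fun r => In r rels).
Proof.
move=> A0 hG tG; apply/torsion_freeP => // k Nk w hw; rewrite -pcls_pow -pcls1.
have h0 : word_over (fun i => i < n) [] by [].
have hk : word_over (fun i => i < n) (wpow_nat w k).
  by elim: k {Nk} => //= k IH l /in_app_iff [/hw|/IH].
move=> /pcls_eq /(fp_wequiv hG hk h0); rewrite eval_pow => /(tG k Nk) E.
by apply/pcls_eq; apply/(fp_wequiv hG hw h0).
Qed.

(** * Removing the unused generators *)

Section Restrict.
Variables (X : nat -> Prop) (R : word -> Prop).
Hypothesis RX : forall r, R r -> word_over X r.

(** The group [pres] has all natural numbers as generators. Killing those outside [X] leaves the
    group presented by [X] and [R], in which every element comes from a word over [X], as
    [torsion_free] requires. *)
Definition cutR (r : word) : Prop := R r \/ exists i, ~ X i /\ r = [(i, false)].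

Definition flt (u : word) : word :=
  filter (fun l : letter => if excluded_middle_informative (X (fst l)) then true else false) u.

Lemma flt_over u : word_over X (flt u).
Proof. by move=> l /filter_In [_]; case: excluded_middle_informative. Qed.

Lemma flt_id u : word_over X u -> flt u = u.
Proof.
elim: u => //= l u IH h; case: excluded_middle_informative => [_|[]]; last by apply: h; left.
by rewrite IH // => l' h'; apply: h; right.
Qed.

Lemma flt_wequiv u v : wequiv cutR u v -> wequiv R (flt u) (flt v).
Proof.
elim=> {u v} [u|u v _ h|u v w _ h _ h'|u v l|u v r].
- exact: weq_refl.
- exact: weq_sym.
- exact: weq_trans h'.
- rewrite /flt !filter_app /=; case: excluded_middle_informative => _; [exact: weq_cancel | exact: weq_refl].
- rewrite /flt !filter_app; case=> [hr|[i [hi ->]]].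
    by rewrite -[filter _ r]/(flt r) flt_id; [exact: weq_rel | exact: RX].
  by rewrite /=; case: excluded_middle_informative => // _; exact: weq_refl.
Qed.

Lemma cut_letter i b : ~ X i -> (pcls [(i, b)] : pres cutR) = one.
Proof.
move=> hi; have h : (pcls [(i, false)] : pres cutR) = one.
  rewrite -pcls1; apply/pcls_eq; have := @weq_rel cutR [] [] [(i, false)].
  by apply; right; exists i.
by case: b => //; rewrite -[[(i, true)]]/(winv [(i, false)]) pclsV h inv1g.
Qed.

Lemma pcls_flt u : (pcls (flt u) : pres cutR) = pcls u.
Proof.
elim: u => //= [[i b] u] IH; rewrite -[(i, b) :: u]/([(i, b)] ++ u) pclsM -IH.
case: excluded_middle_informative => h; first by rewrite -pclsM.
by rewrite cut_letter // mul1g.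
Qed.

(** Deleting the letters outside [X] turns a derivation with [cutR] into one with [R], and does not
    change words over [X]. *)
Lemma pcls_cut u v : word_over X u -> word_over X v ->
  (pcls u : pres cutR) = pcls v <-> wequiv R u v.
Proof.
move=> hu hv; rewrite pcls_eq; split=> [/flt_wequiv|]; first by rewrite !flt_id.
elim=> {u v hu hv} [u|u v _ h|u v w _ h _ h'|u v l|u v r hr].
- exact: weq_refl.
- exact: weq_sym.
- exact: weq_trans h'.
- exact: weq_cancel.
- by apply: weq_rel; left.
Qed.

Lemma cut_tf (A : Z -> Prop) : ~ A 0%Z -> torsion_free A X R -> tf (tN A) (pres cutR).
Proof.
move=> A0 /torsion_freeP h n Nn x; have [u ->] := pcls_surj x.
have h0 : word_over X [] by [].
have hw := @flt_over u; move: (flt u) (pcls_flt u) hw => {u x}w <- hw E.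
have hk : word_over X (wpow_nat w n).
  by elim: n {Nn E} => //= k IH l /in_app_iff [/hw|/IH].
rewrite -pcls1; apply/pcls_cut => //; apply/pcls_eq; apply: (h A0 n Nn w hw).
by rewrite -pcls_pow -pcls1; apply/pcls_eq; apply/pcls_cut => //; rewrite pcls_pow E pcls1.
Qed.
End Restrict.

(** * The universal quotient of the free group of rank four *)

Section Universal.
Variables (A : Z -> Prop) (cA : prf).
Hypothesis hA : forall z, A z <-> exists m, prf_eval cA [code_Z z; m] = 0.
Hypothesis A0 : ~ A 0%Z.
Notation over4 := (word_over (fun i => i < 4)).
Notation ev := (eval (fre 4)).

Lemma code_Z_pos p : code_Z (Z.of_nat p) = p + p.
Proof. by case: p => // p; rewrite [code_Z _]/(2 * Pos.to_nat (Pos.of_succ_nat p)) SuccNat2Pos.id_succ; lia. Qed.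

Lemma code_Z_neg p : 0 < p -> code_Z (- Z.of_nat p) = p + p - 1.
Proof.
Proof.
case: p => [|p] hp; first by lia.
change (2 * Pos.to_nat (Pos.of_succ_nat p) - 1 = S p + S p - 1); rewrite SuccNat2Pos.id_succ; lia.
Qed.

Lemma code_even p m : prf_eval cA [p + p; m] = 0 -> tN A p.
Proof.
move=> h; have hp : A (Z.of_nat p) by apply/hA; exists m; rewrite code_Z_pos.
by case: p {h} hp => // p h; split; [lia | left].
Qed.

Lemma code_odd p x m : p + p = S x -> prf_eval cA [x; m] = 0 -> tN A p.
Proof.
move=> hx h; split; [lia | right]; apply/hA; exists m; rewrite code_Z_neg; last by lia.
by have -> : p + p - 1 = x by lia.
Qed.

Lemma tN_code p : tN A p -> exists m, prf_eval cA [p + p; m] = 0 \/ exists2 x, p + p = S x & prf_eval cA [x; m] = 0.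
Proof.
move=> [p0 [|] /hA [m]]; rewrite ?code_Z_pos ?code_Z_neg // => hm; exists m; [by left | right].
by exists (p + p - 1) => //; lia.
Qed.

Lemma A_sound (E : group) : tf (tN A) E -> forall p x m : nat, prf_eval cA [x; m] = 0 ->
  p + p = x \/ p + p = S x -> forall y : E, pow y p = one -> y = one.
Proof.
move=> tE p x m h [hx|hx] y; apply: tE; last exact: code_odd hx h.
by apply: (code_even (m := m)); rewrite hx.
Qed.

Definition accepted (u : word) : Prop := prov (hcl cA) (gT (tw u)).
Notation I := accepted.

Lemma tw_app u v : tw (u ++ v) = tapp (tw u) (tw v).
Proof. by rewrite /tw map_app tapp_tword. Qed.

Lemma acc_ins x y v : I (x ++ y) -> I v -> I (x ++ v ++ y).
Proof. by rewrite /I !tw_app; apply: pInT_ins. Qed.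

Lemma acc_del x y v : I (x ++ v ++ y) -> I v -> I (x ++ y).
Proof. by rewrite /I !tw_app; apply: pInT_del. Qed.

Lemma in_letters l : In l letters <-> fst l < 4.
Proof.
case: l => i b; split=> [h|/= h].
  by rewrite /=; repeat (case: h => [[<- _]|h]; first by lia); case: h.
by do 4 (case: i h => [|i] h; first by case: b; rewrite /letters /=; tauto); lia.
Qed.

Lemma acc_pair l : fst l < 4 -> I [l; linv l].
Proof. by move=> /in_letters; apply: pInT_pair. Qed.

Lemma acc_pow u n : tN A n -> I (wpow_nat u n) -> I u.
Proof.
move=> Nn; have E : tw (wpow_nat u n) = tpow (tw u) n.
  by elim: n {Nn} => //= n IH; rewrite tw_app IH.
rewrite /I E; have [m [h|[x hx h]]] := tN_code Nn; [exact: pInT_even h | exact: pInT_odd hx h].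
Qed.

Lemma acc_inv u : over4 u -> I (u ++ winv u).
Proof.
elim: u => [|l u IH] h; first exact: pInT0.
rewrite winv_cons -[l :: u]/([l] ++ u) -app_assoc (app_assoc u).
apply: (@acc_ins [l] [linv l]); first by apply: acc_pair; apply: h; left.
by apply: IH => k hk; apply: h; right.
Qed.

(* Free equivalence may pass through words with letters outside the four
   generators; they are clamped before comparing. *)
Definition clamp (l : letter) : letter := (Nat.min (fst l) 3, snd l).

Lemma clamp_id u : over4 u -> map clamp u = u.
Proof.
elim: u => //= [[i b] u] IH h; rewrite IH; last by move=> k hk; apply: h; right.
by have /= hi := h (i, b) (or_introl eq_refl); rewrite /clamp /=; do 2 f_equal; lia.
Qed.

Lemma acc_wequiv u v : wequiv (fun r => In r []) u v -> I (map clamp u) <-> I (map clamp v).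
Proof.
elim=> {u v} [u|u v _ h|u v w _ h _ h'|u v l|u v r []]; try tauto.
rewrite !map_app -[map clamp (l :: _)]/([clamp l; linv (clamp l)] ++ map clamp v).
have hl : I [clamp l; linv (clamp l)] by apply: acc_pair; rewrite /=; lia.
by split=> h; [apply: acc_del hl | apply: acc_ins].
Qed.

Lemma acc_ev u v : over4 u -> over4 v -> ev u = ev v -> I u -> I v.
Proof.
move=> hu hv /(fp_wequiv (fr_fp 4) hu hv) /acc_wequiv; rewrite !clamp_id //; tauto.
Qed.

Definition accF (f : fr (ord 4)) : Prop := exists u, over4 u /\ ev u = f /\ I u.

Lemma accF_ev u : over4 u -> accF (ev u) <-> I u.
Proof.
move=> hu; split=> [[v [hv [E h]]]|h]; first exact: acc_ev E h.
by exists u.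
Qed.

Lemma ev_surj (f : fr (ord 4)) : exists2 u, over4 u & ev u = f.
Proof. exact: fp_word (fr_fp 4). Qed.

Lemma accF_sub : subgroup accF.
Proof.
split=> [|x y [u [hu [<- h]]] [v [hv [<- h']]]|x [u [hu [<- h]]]].
- by exists []; split=> //; split=> //; apply: pInT0.
- exists (u ++ v); split; first exact: word_over_app.
  split; first by rewrite eval_app.
  by rewrite -[u ++ v]app_nil_r -app_assoc; apply: (@acc_ins u []) => //; rewrite app_nil_r.
- exists (winv u); split; first exact: word_over_winv.
  split; first by rewrite eval_winv.
  by have := @acc_del [] (winv u) u; rewrite /=; apply=> //; apply: acc_inv.
Qed.

(** An accepted word may be inserted in the middle of [v^-1 v], which is accepted. *)
Lemma accF_conj x g : accF x -> accF (inv g ** x ** g).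
Proof.
move=> [u [hu [<- h]]]; have [v hv <-] := ev_surj g.
exists (winv v ++ u ++ v); split; first by do !apply: word_over_app => //; apply: word_over_winv.
split; first by rewrite !eval_app eval_winv mulA.
by apply: acc_ins => //; have := acc_inv (word_over_winv hv); rewrite winvK.
Qed.

Definition outs : list (tree * fr (ord 4)) := map (fun l => (ltr l, evl (fre 4) l)) letters.

Lemma accF_outs f : accF f <-> exists W, (forall o, In o W -> In o outs) /\
  f = fold_right (fun o x => snd o ** x) one W /\ prov (hcl cA) (TN (num 10) (tword (map fst W))).
Proof.
split=> [[u [hu [<- h]]]|[W [hW [-> h]]]].
  exists (map (fun l => (ltr l, evl (fre 4) l)) u); split; last split.
  { by move=> o /in_map_iff [l [<- /hu hl]]; apply: (in_map _ _ _); apply/in_letters. }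
  { by elim: u {hu h} => //= l u <-. }
  by rewrite map_map.
have [u hu E] : exists2 u, over4 u & W = map (fun l => (ltr l, evl (fre 4) l)) u.
  elim: W hW {h} => [|o W IH] h; first by exists [].
  have [u hu ->] : exists2 u, over4 u & W = map (fun l => (ltr l, evl (fre 4) l)) u.
    by apply: IH => o' ho; apply: h; right.
  have /in_map_iff [l [<- /in_letters hl]] := h o (or_introl eq_refl).
  by exists (l :: u) => //; apply: word_over_cons.
exists u; split=> //; split; last by move: h; rewrite E map_map.
by rewrite E; elim: u {hu E} => //= l u <-.
Qed.

(** The insertion and deletion clauses make [accF] a normal subgroup, the root clauses make the
    quotient [P] torsion-free for [A], and [horn_kill] embeds [P] in a finitely presented group. *)
Lemma univ_group : exists (G : group) (th : fr (ord 4) -> G),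
  is_fp G /\ tf (tN A) G /\ hom th /\ forall u, over4 u -> (th (ev u) = one <-> I u).
Proof.
have sT := accF_sub; have hconj := accF_conj.
pose Rl (x y : fr (ord 4)) := accF (inv x ** y).
have R1 x : Rl x x by rewrite /Rl mulVg; apply: sg1.
have R2 x y : Rl x y -> Rl y x.
  by rewrite /Rl => h; have := sgV sT h; rewrite invMg invgK.
have R3 x y z : Rl x y -> Rl y z -> Rl x z.
  by rewrite /Rl => h h'; have := sgM sT h h'; rewrite mulAr mulKg.
have RM x x' y y' : Rl x x' -> Rl y y' -> Rl (x ** y) (x' ** y').
  rewrite /Rl => h h'; have := sgM sT (hconj _ y h) h'.
  by have -> : inv y ** (inv x ** x') ** y ** (inv y ** y') = inv (x ** y) ** (x' ** y') by grp.
have RA x y z : Rl (x ** (y ** z)) (x ** y ** z) by rewrite mulA.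
have RO x : Rl (one ** x) x by rewrite mul1g.
have RV x : Rl (inv x ** x) one by rewrite mulVg.
pose P := qgroup R1 R2 R3 RM RA RO RV.
pose pi x : P := qcls Rl x.
have hpi : hom pi by move=> x y; apply: qclsM.
have Kpi w : pi w = one <-> accF w.
  have <- : Rl one w <-> accF w by rewrite /Rl inv1g mul1g.
  rewrite -(qcls_eq R1 R2 R3).
  by change (qcls Rl w = qcls Rl one <-> qcls Rl one = qcls Rl w); split=> ->.
have tP : tf (tN A) P.
  move=> n Nn x; have [f ->] := qcls_surj x; rewrite -/(pi f) -hom_pow // => /Kpi.
  have [u hu <-] := ev_surj f; rewrite -eval_pow => h; apply/Kpi; apply/accF_ev => //.
  apply: (acc_pow Nn); apply/accF_ev => //.
  by elim: n {Nn h} => //= n IH; apply: word_over_app.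
have := @horn_kill (hcl cA) (num 10) (tconst (num 10)) (fun s => tsub_const s _) (@hcl_head cA) (@hcl_body cA)
  (tN A) 4 outs accF P pi (fun n h => proj1 h) sT accF_outs hpi (@qcls_surj _ _) Kpi tP.
move=> [G [j [fpG [tG [hj ij]]]]]; exists G, (fun x => j (pi x)); split=> //; split=> //; split.
  by move=> x y; rewrite hpi hj.
move=> u hu; rewrite -accF_ev // -Kpi; split=> [/ij //|->]; exact: hom1.
Qed.

(** * Interpreting an arbitrary presentation *)

Fixpoint gamW (x : tree) : word :=
  match x with TL => [(2, false)] | TN a b => (3, false) :: gamW a ++ gamW b end.

Definition xW (x : tree) : word :=
  (0, false) :: winv (gamW x) ++ (1, false) :: gamW x ++ (0, true) :: winv (gamW x) ++ (1, true) :: gamW x.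

Definition trW (c : tree) (u : word) : word :=
  flat_map (fun l : letter => if snd l then winv (xW (TN c (num (fst l)))) else xW (TN c (num (fst l)))) u.

Lemma tw_cons l u : tw (l :: u) = TN (ltr l) (tw u).
Proof. by []. Qed.

Lemma tw_gam x : tw (gamW x) = gam x.
Proof. by elim: x => //= a IHa b IHb; rewrite tw_cons tw_app IHa IHb. Qed.

Lemma tw_gami x : tw (winv (gamW x)) = gami x.
Proof.
elim: x => //= a IHa b IHb; rewrite winv_cons winv_app !tw_app IHa IHb.
by elim: (gami b) => //= y _ z ->.
Qed.

Lemma tapp_assoc x y z : tapp (tapp x y) z = tapp x (tapp y z).
Proof. by elim: x => //= a _ x ->. Qed.

Lemma winv_xW x : winv (xW x) = winv (gamW x) ++ (1, false) :: gamW x ++ (0, false) ::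
  winv (gamW x) ++ (1, true) :: gamW x ++ [(0, true)].
Proof.
have E (l : letter) u v : winv (u ++ l :: v) = winv v ++ linv l :: winv u.
  by rewrite winv_app winv_cons -app_assoc.
rewrite /xW -[_ :: _]/([] ++ (0, false) :: _) !E winvK.
by rewrite -!app_assoc.
Qed.

Lemma tw_trW c u : tw (trW c u) = trw c u.
Proof.
elim: u => [//|[g b] u IH].
change (tw ((if b then winv (xW (TN c (num g))) else xW (TN c (num g))) ++ trW c u) = trw c ((g, b) :: u)).
rewrite tw_app IH [trw c (_ :: _)]/=; move: (TN c (num g)) => x.
have tappTN a y z : tapp (TN a y) z = TN a (tapp y z) by [].
rewrite /cj; case: b; rewrite ?winv_xW /xW !(tw_cons, tw_app, tw_gam, tw_gami).
  by rewrite !(tapp_assoc, tappTN).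
by rewrite !(tapp_assoc, tappTN).
Qed.

Lemma trW_over c u : over4 (trW c u).
Proof.
have hc i b v : i < 4 -> over4 v -> over4 ((i, b) :: v).
  by move=> hi hu; apply: (@word_over_cons (fun i => i < 4)).
have hg x : over4 (gamW x).
  elim: x => [|a IHa b IHb]; first by refine (hc _ _ _ _ _); [lia | apply: word_over_nil].
  by refine (hc _ _ _ _ _); [lia | refine (@word_over_app _ _ _ _ _)].
have hx x : over4 (xW x).
  have hv := word_over_winv (hg x).
  have h1 i i' b b' v v' : i < 4 -> i' < 4 -> over4 v -> over4 v' -> over4 ((i, b) :: v ++ (i', b') :: v').
    by move=> *; refine (hc _ _ _ _ _) => //; refine (@word_over_app _ _ _ _ _) => //; refine (hc _ _ _ _ _).
  rewrite /xW; refine (h1 _ _ _ _ _ _ _ _ _ _); [lia | lia | by [] |].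
  by refine (@word_over_app _ _ _ _ _) => //; refine (h1 _ _ _ _ _ _ _ _ _ _); [lia | lia | |].
elim: u => [//|[g b] u IH]; refine (@word_over_app _ _ _ _ _) => //.
by case: b; [exact (word_over_winv (hx _)) | exact (hx _)].
Qed.

Lemma ev_trW c u : ev (trW c u) = eval (fun i => ev (xW (TN c (num i)))) u.
Proof.
elim: u => [//|[g b] u IH].
change (ev ((if b then winv (xW (TN c (num g))) else xW (TN c (num g))) ++ trW c u) =
  evl (fun i => ev (xW (TN c (num i)))) (g, b) ** eval (fun i => ev (xW (TN c (num i)))) u).
by rewrite eval_app IH; case: b; rewrite ?eval_winv.
Qed.

Lemma ldecs_encu u : ldecs (encu u) = u.
Proof.
elim: u => // [[i b] u] IH.
change ((len (num i), negb (isL (if b then TN TL TL else TL))) :: ldecs (encu u) = (i, b) :: u).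
by rewrite IH len_num; case: b.
Qed.

Lemma acc_rel (R : word -> Prop) c : (forall w, R w <-> exists m, prf_eval c [code_word w; m] = 0) ->
  forall r, R r -> I (trW (enc c) r).
Proof. by move=> hc r /hc [m hm]; rewrite /I tw_trW; apply: pInT_rel hm. Qed.

(** The interpretation [eE] is centred at the presentation [c] under study: translated words of
    other presentations have value one, and the relators of [c] hold in its own group, so all
    clauses are respected. Acceptance then says that the translation of [w] has value one, while the
    derivable translation fact identifies this value with [emb] of the class of [w], and [emb] is
    injective. *)
Lemma acc_sound (X : nat -> Prop) (R : word -> Prop) c :
  (forall w, R w <-> exists m, prf_eval c [code_word w; m] = 0) ->
  (forall r, R r -> word_over X r) -> torsion_free A X R ->
  forall w, I (trW (enc c) w) -> (pcls w : pres (cutR X R)) = one.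
Proof.
move=> hc hR tR w hw.
have tP := cut_tf hR A0 tR.
pose x i : pres (cutR X R) := pcls [(i, false)].
pose e := eE x (enc c).
have tE := eE_tf (fun n (h : tN A n) => proj1 h) tP.
have sound := @prov_model cA _ e (A_sound tE).
have Rok : forall c' u n m, (forall p, c' = enc p -> prf_eval p [n; m] = 0) ->
  n = code_word (ldecs u) -> trE e c' u = one.
  move=> c' u n m h hn; case: (classic (c' = enc c)) => hcc; last exact: trE_out.
  rewrite hcc /e trE_in /x pcls_eval.
  have -> : (pcls (ldecs u) : pres (cutR X R)) = one; last by rewrite (hom1 (@emb_hom _)).
  rewrite -pcls1; apply/pcls_eq.
  have := @weq_rel (cutR X R) [] [] (ldecs u); rewrite app_nil_r; apply; left.
  by apply/hc; exists m; rewrite -hn; apply: h.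
have m1 : evT e (trw (enc c) w) = trE e (enc c) (encu w) := sound Rok _ (pTr cA (enc c) w).
have m2 : evT e (trw (enc c) w) = one.
  by move: hw; rewrite /I tw_trW => /(sound Rok).
by move: m2; rewrite m1 /e trE_in ldecs_encu pcls_eval => /emb_inj.
Qed.
End Universal.

(** * The embedding theorem *)

Lemma torsion_free_0 (A : Z -> Prop) X R : A 0%Z -> torsion_free A X R ->
  forall w, word_over X w -> wequiv R w [].
Proof. by move=> h0 h w hw; apply: NNPP => hw1; apply: (h w hw hw1 0%Z h0); apply: weq_refl. Qed.

Lemma universal_0 (A : Z -> Prop) : A 0%Z ->
  torsion_free A (fun i => i < 0) (fun r => In r []) /\
  forall (X : nat -> Prop) (R : word -> Prop), torsion_free A X R ->
    embedding X R (fun i => i < 0) (fun r => In r []) (fun _ => []).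
Proof.
move=> h0; split=> [[|l w] hw hw1|X R h]; first by case: hw1; apply: weq_refl.
  by have := hw l (or_introl eq_refl); lia.
split; first by move=> u _ l [].

split; first by move=> *; apply: weq_refl.
split; first by move=> *; apply: weq_refl.
move=> u v hu hv _; apply: weq_trans (torsion_free_0 h0 h hu) _.
exact: weq_sym (torsion_free_0 h0 h hv).
Qed.

Lemma fp_embedding (G : group) n e rels (X : nat -> Prop) (R : word -> Prop) (z : nat -> G) :
  @fp G n e rels -> (forall r, R r -> eval z r = one) ->
  (forall w, word_over X w -> eval z w = one -> wequiv R w []) ->
  embedding X R (fun i => i < n) (fun r => In r rels) (fun u => wof n e (eval z u)).
Proof.
move=> hG hR hX.
have hw x := proj1 (wofP x hG); have he x := proj2 (wofP x hG).
split=> [u _|]; first exact: hw.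
split=> [u v _ _ h|].
  by rewrite (eval_wequiv hR h); apply: weq_refl.
split=> [u v _ _|u v hu hv].
  apply/(fp_wequiv hG (hw _) (@word_over_app _ _ _ (hw _) (hw _))).
  by rewrite !eval_app !he.
move=> /(fp_wequiv hG (hw _) (hw _)); rewrite !he => E.
have : wequiv R (u ++ winv v) [].
  apply: hX; first by apply: word_over_app => //; apply: word_over_winv.
  by rewrite eval_app eval_winv E mulgV.
move=> /(@pcls_eq R _ _); rewrite pclsM pclsV pcls1 => h; apply/pcls_eq.
by apply: (mulIg (inv (pcls v))); rewrite h mulgV.
Qed.

Theorem theorem2p11 (A : Z -> Prop) (hA : re_Z A) :
  exists (n : nat) (rels : list word),
    (forall r, In r rels -> word_over (fun i => i < n) r) /\
    torsion_free A (fun i => i < n) (fun r => In r rels) /\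
    forall (X : nat -> Prop) (R : word -> Prop),
      re_nat X -> re_word R -> (forall r, R r -> word_over X r) ->
      torsion_free A X R ->
      exists f : word -> word,
        embedding X R (fun i => i < n) (fun r => In r rels) f.
Proof.
(* If [0] is in [A], every element satisfies a forbidden equation, so only trivial groups occur and
   the group without generators works. *)
case: (classic (A 0%Z)) => [A0|A0].
  have [h1 h2] := universal_0 A0; exists 0, []; split=> //; split=> // X R _ _ _ tR.
  by exists (fun _ => []); apply: h2.
move: hA => [cA hA].
have [G [th [[n [e [rels hG]]] [tG [hth Kth]]]]] := univ_group hA.
exists n, rels; split; first exact: fp_over hG.
split; first exact: torsion_free_fp A0 hG tG.
move=> X R _ [c hc] hR tR.
pose z i := th (eval (fre 4) (xW (TN (enc c) (num i)))).
have Ez u : eval z u = th (eval (fre 4) (trW (enc c) u)) by rewrite ev_trW (hom_eval _ _ hth).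
exists (fun u => wof n e (eval z u)); apply: fp_embedding hG _ _ => [r hr|w hw].
  by rewrite Ez; apply/Kth; [apply: trW_over | apply: acc_rel hc _ hr].
rewrite Ez => /(Kth _ (@trW_over _ _)) h.
apply/(pcls_cut hR hw) => //; rewrite pcls1; exact: (@acc_sound A cA hA A0 X R c hc hR tR w h).
Qed.
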